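(* Fix $S_n\in\{I_n,-I_n\}$. With the notation of the context, uniformly for $(x,y)\in S_n\times S_n$, it holds that $$\rho_n^{(2)}(x,y)=\frac{2\tau+1}{\pi^2}\,\frac{1+f_\tau(\alpha)}{(1-x^2)(1-y^2)}\left(1+O(\sqrt[16]{\tau_n})\right).$$ Furthermore, there exists a constant $\alpha_0>0$ (independent of $n$, but possibly dependent on the constants and the rate of decay of $o_j(1)$ in the standing assumptions) such that when $\alpha\le\alpha_0$ (with $(x,y)\in S_n\times S_n$), the following holds: $$\rho_n^{(2)}(x,y)-\rho_n^{(1)}(x)\rho_n^{(1)}(y)=\frac{O(\alpha^{2\tau+1})}{(1-x^2)(1-y^2)} .$$
   Context: Fix constants $\tau>-1/2$ and $C_1,C_2,N_0>0$. For each $n$, $c_0,\dots,c_n$ are real numbers (possibly varying with $n$) such that $|c_j|=C_1j^\tau(1+o_j(1))$ for $N_0\le j\le n$ and $|c_j|\le C_2$ for $0\le j<N_0$; here $o_j(1)$ denotes a term bounded in absolute value by some $o_j$ independent of $n$ with $o_j\to0$ as $j\to\infty$. Let $\widetilde P_n(x)=\sum_{j=0}^n\widetilde\xi_jc_jx^j$ with $\widetilde\xi_j$ i.i.d. standard real Gaussian, $k_n(x)=\sum_{j=0}^nc_j^2x^j$, and let $r_n(x,y)=\dfrac{k_n(xy)}{\sqrt{k_n(x^2)k_n(y^2)}}$ be the normalized correlator of $\widetilde P_n$. The one-point and two-point correlation functions of the real roots of $\widetilde P_n$ are given by the Kac--Rice formulas $$\rho_n^{(1)}(x)=\frac1\pi\sqrt{\frac{\partial^2r_n}{\partial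 x\partial y}(x,x)},\qquad \rho_n^{(2)}(x,y)=\frac1{\pi^2}\left(\sqrt{1-\delta_n^2}+\delta_n\arcsin\delta_n\right)\frac{\sigma_n}{\sqrt{1-r_n^2(x,y)}},$$ where $$\sigma_n=\sigma_n(x,y)=\sqrt{\left(\frac{\partial^2r_n}{\partial x\partial y}(x,x)-\frac{(\frac{\partial r_n}{\partial x}(x,y))^2}{1-r_n^2(x,y)}\right)\left(\frac{\partial^2r_n}{\partial x\partial y}(y,y)-\frac{(\frac{\partial r_n}{\partial y}(x,y))^2}{1-r_n^2(x,y)}\right)},$$ $$\delta_n=\delta_n(x,y)=\frac1{\sigma_n(x,y)}\left(\frac{\partial^2r_n}{\partial x\partial y}(x,y)+\frac{r_n(x,y)\frac{\partial r_n}{\partial x}(x,y)\frac{\partial r_n}{\partial y}(x,y)}{1-r_n^2(x,y)}\right).$$ On the diagonal $x=y$ (where $\alpha=1$) both $\rho_n^{(2)}$ and $f_\tau$ are understood through their continuous extensions. Put $$\alpha=\alpha(x,y)=\frac{(1-x^2)(1-y^2)}{(1-xy)^2},\qquad \tau_n=\max_{\log(\log n)\le j\le n}\left|\frac{|c_j|}{C_1j^\tau}-1\right|+\frac1{\log\log n},$$ $$\Delta_\tau(u)=u^{\tau+1/2}\,\frac{u(1-u^{2\tau+1})-(2\tau+1)(1-u)}{1-u^{2\tau+1}-(2\tau+1)u^{2\tau+1}(1-u)},\qquad \Sigma_\tau(u)=\frac{1-u^{2\tau+1}-(2\tau+1)(1-u)u^{2\tau+1}}{(1-u^{2\tau+1})^{3/2}},$$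 $$f_\tau(u)=\left(\sqrt{1-\Delta_\tau^2(u)}+\Delta_\tau(u)\arcsin\Delta_\tau(u)\right)\Sigma_\tau(u)-1 .$$ Fix $d\in(0,1/2)$ and set $d_n=\exp((\log n)^{d/4})$, $a_n=d_n^{-1}$, $b_n=n^{-1}d_n$, $I_n=[1-a_n,1-b_n]$, $-I_n=\{-x:x\in I_n\}$. Throughout, $n$ is assumed sufficiently large, and implicit constants are independent of $n,x,y$. *)

(* Defs.v *)
From Stdlib Require Import Reals RList List.
From Coquelicot Require Import Coquelicot.

Open Scope R_scope.

(* The standing assumption on the triangular array [c], where [c n j] is the
   coefficient c_j at level n.  The sequence [o] controls the error terms
   o_j(1) uniformly in n. *)
Definition coeff_assumption (tau C1 C2 N0 : R) (o : nat -> R)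
    (c : nat -> nat -> R) : Prop :=
  forall n j : nat, (j <= n)%nat ->
    (N0 <= INR j ->
       exists e : R, Rabs e <= o j /\
         Rabs (c n j) = C1 * Rpower (INR j) tau * (1 + e)) /\
    (INR j < N0 -> Rabs (c n j) <= C2).

Definition kn (c : nat -> nat -> R) (n : nat) (x : R) : R :=
  sum_f_R0 (fun j => (c n j) ^ 2 * x ^ j) n.

Definition rn (c : nat -> nat -> R) (n : nat) (x y : R) : R :=
  kn c n (x * y) / sqrt (kn c n (x ^ 2) * kn c n (y ^ 2)).

(* [partial_derive 1 0], [partial_derive 0 1] and [partial_derive 1 1] are
   d/dx, d/dy and d^2/dxdy. *)
Definition sigman (c : nat -> nat -> R) (n : nat) (x y : R) : R :=
  sqrt ((partial_derive 1 1 (rn c n) x x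
           - (partial_derive 1 0 (rn c n) x y) ^ 2 / (1 - (rn c n x y) ^ 2))
        * (partial_derive 1 1 (rn c n) y y
           - (partial_derive 0 1 (rn c n) x y) ^ 2 / (1 - (rn c n x y) ^ 2))).

Definition deltan (c : nat -> nat -> R) (n : nat) (x y : R) : R :=
  / sigman c n x y
  * (partial_derive 1 1 (rn c n) x y
     + rn c n x y * partial_derive 1 0 (rn c n) x y
         * partial_derive 0 1 (rn c n) x y / (1 - (rn c n x y) ^ 2)).

Definition rho1 (c : nat -> nat -> R) (n : nat) (x : R) : R :=
  / PI * sqrt (partial_derive 1 1 (rn c n) x x).

(* The two-point Kac-Rice formula; meaningful for x <> y only. *)
Definition rho2_formula (c : nat -> nat -> R) (n : nat) (x y : R) : R :=
  / PI ^ 2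
  * (sqrt (1 - (deltan c n x y) ^ 2) + deltan c n x y * asin (deltan c n x y))
  * (sigman c n x y / sqrt (1 - (rn c n x y) ^ 2)).

(* On the diagonal: the limit of the formula as (u, v) -> (x, x), u <> v. *)
Definition rho2 (c : nat -> nat -> R) (n : nat) (x y : R) : R :=
  if Req_EM_T x y then
    iota (fun l : R =>
      filterlim (fun p : R * R => rho2_formula c n (fst p) (snd p))
        (within (fun p : R * R => fst p <> snd p) (locally (x, x)))
        (locally l))
  else rho2_formula c n x y.

Definition alpha (x y : R) : R :=
  (1 - x ^ 2) * (1 - y ^ 2) / (1 - x * y) ^ 2.

(* The maximum runs over the integers j with log (log n) <= j <= n. *)
Definition taun (tau C1 : R) (c : nat -> nat -> R) (n : nat) : R :=
  MaxRlist
    (map (fun j => Rabs (Rabs (c n j) / (C1 * Rpower (INR j) tau) - 1))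
       (filter (fun j => if Rle_dec (ln (ln (INR n))) (INR j)
                         then true else false)
          (seq 0 (S n))))
  + / ln (ln (INR n)).

Definition Delta (tau u : R) : R :=
  Rpower u (tau + 1 / 2)
  * ((u * (1 - Rpower u (2 * tau + 1)) - (2 * tau + 1) * (1 - u))
     / (1 - Rpower u (2 * tau + 1)
        - (2 * tau + 1) * Rpower u (2 * tau + 1) * (1 - u))).

Definition Sigma (tau u : R) : R :=
  (1 - Rpower u (2 * tau + 1)
   - (2 * tau + 1) * (1 - u) * Rpower u (2 * tau + 1))
  / Rpower (1 - Rpower u (2 * tau + 1)) (3 / 2).

(* Meaningful for 0 < u < 1. *)
Definition f_formula (tau u : R) : R :=
  (sqrt (1 - (Delta tau u) ^ 2) + Delta tau u * asin (Delta tau u))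
  * Sigma tau u - 1.

(* The values of alpha lie in (0, 1], so the extension to u = 1 is the limit
   from the left ([Rpower] is moreover junk on nonpositive bases). *)
Definition f_tau (tau u : R) : R :=
  if Req_EM_T u 1 then
    iota (fun l : R => filterlim (f_formula tau) (at_left 1) (locally l))
  else f_formula tau u.

Definition dn (d : R) (n : nat) : R := exp (Rpower (ln (INR n)) (d / 4)).
Definition an (d : R) (n : nat) : R := / dn d n.
Definition bn (d : R) (n : nat) : R := / INR n * dn d n.

Definition I_ (d : R) (n : nat) : R -> Prop :=
  fun x => 1 - an d n <= x <= 1 - bn d n.
Definition negI_ (d : R) (n : nat) : R -> Prop := fun x => I_ d n (- x).

(* Main.v *)
Require Import Defs.
From Stdlib Require Import Reals Lra Lia Psatz List FunctionalExtensionality.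
From Coquelicot Require Import Coquelicot.
Open Scope R_scope.

(** Write [b = 2 tau + 1] and let [h_j] be the coefficients of
    [(1 - t) ^ (- b)].  They grow like [j ^ (b - 1) = j ^ (2 tau)], so up to a
    constant factor the squared coefficients of the random polynomial are
    [h_j (1 + O(tau_n))] for [log log n <= j <= n], and the other indices carry
    a negligible share of the moments [sum_j h_j j ^ s t ^ j] as long as
    [1 - t] stays between [b_n / 2] and [4 a_n] ([weights_close],
    [moment_bound_of_errors]).  The limiting kernel [(1 - x y) ^ (- b)] has the
    stated two-point function exactly ([binG_density]).  It remains to compare
    the two kernels with a relative error, uniformly up to the diagonal, where
    the density vanishes.

    Conditioning on zeros at [x] and [y] turns the Kac-Rice formula into an
    expression in four Gram determinants of [f(x), f(y), f'(x), f'(y)]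
    ([kac_rice_gram]): with [D] the determinant of [f(x), f(y)], with [E1] and
    [E2] those with [f'(x)] or [f'(y)] added, and [N] the mixed one,
    [pi ^ 2 rho2 = g (N / sqrt (E1 E2)) sqrt (E1 E2) / D ^ (3/2)], where
    [g (d) = sqrt (1 - d ^ 2) + d asin d] is convex, Lipschitz and at least [1].
    So it is enough to know [D], [E1], [E2] up to a relative error and [N] up
    to a small multiple of [sqrt (E1 E2)] ([density_pert]).

    Subtracting from a vector multiples of the preceding ones among [f(x)] and
    [f(y)] does not change the determinants.  So when [x] and [y] are close,
    [f(y), f'(x), f'(y)] may be replaced by divided differences, which only
    extracts powers of [y - x] from the determinants; the new Gram entries are
    again controlled by moments of the weights, and the limiting determinants
    have a lower bound of the right order.  When [alpha <= 1/2] the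
    original vectors, rescaled, are already nondegenerate.  In both regimes an
    entrywise error [O(tau_n)] gives a relative error [O(tau_n)] for the density
    ([gram_compare], [density_compare]); this is stronger than the required
    [O(tau_n ^ (1/16))] because [tau_n <= 1] for large [n].

    For the correlation, every Gram entry linking the two points carries a
    factor [alpha ^ (b / 2)]; the variances see it squared, and so does [g],
    which is even, so the product of the two one-point densities is reached up
    to a relative error [O(alpha ^ b)] ([gram_decorrelate],
    [density_decorrelate]).

    On the diagonal both continuous extensions are [0] ([f_tau_1],
    [rho2_diagonal]), and the interval [- I_n] reduces to [I_n] since the
    determinants are even in [(x, y)]. *)

(** * Elementary estimates *)

Ltac pos :=
  repeat match goal with
    | H : 0 < ?u |- 0 < ?u => exact H
    | |- 0 < _ * _ => apply Rmult_lt_0_compat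
    | |- 0 < _ / _ => apply Rdiv_lt_0_compat
    | |- 0 < / _ => apply Rinv_0_lt_compat
    | |- 0 < _ ^ _ => apply pow_lt
    | |- 0 < sqrt _ => apply sqrt_lt_R0
    | |- 0 < Rmin _ _ => apply Rmin_glb_lt
    end; first [lra | apply exp_pos].

Ltac nneg :=
  repeat match goal with
    | H : 0 <= ?u |- 0 <= ?u => exact H
    | |- 0 <= _ ^ 2 => apply pow2_ge_0
    | |- 0 <= Rabs _ => apply Rabs_pos
    | |- 0 <= sqrt _ => apply sqrt_pos
    | |- 0 <= INR _ => apply pos_INR
    | |- 0 <= _ ^ _ => apply pow_le
    | |- 0 <= _ * _ => apply Rmult_le_pos
    end; first [lra | apply Rlt_le; pos].

Ltac mono :=
  first [ solve [apply Rmult_le_compat_l; lra] | solve [apply Rmult_le_compat_r; lra]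
        | apply Rmult_le_compat; lra ].

Lemma Rabs_div_pos : forall a u, 0 < u -> Rabs (a / u) = Rabs a / u.
Proof.
  intros a u Hu. unfold Rdiv. rewrite Rabs_mult, (Rabs_right (/ u)); [reflexivity|].
  apply Rle_ge; nneg.
Qed.

Lemma div_le : forall a u k, 0 < u -> a <= k * u -> a / u <= k.
Proof.
  intros a u k Hu H. apply Rmult_le_reg_r with u; [exact Hu|].
  unfold Rdiv. rewrite Rmult_assoc, Rinv_l by lra. lra.
Qed.

(** * The arcsine factor of the Kac-Rice formula *)

Definition arcsin_factor (d : R) : R := sqrt (1 - d ^ 2) + d * asin d.

Lemma arcsin_factor_in : forall d, -1 <= d <= 1 ->
  arcsin_factor d = cos (asin d) + asin d * sin (asin d).
Proof.
  intros d Hd. unfold arcsin_factor. rewrite cos_asin, sin_asin by lra.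
  rewrite Rsqr_pow2. ring.
Qed.

Lemma asin_ge1 : forall d, 1 <= d -> asin d = PI / 2.
Proof.
  intros d Hd. unfold asin. destruct (Rle_dec d (-1)); [lra|].
  destruct (Rle_dec 1 d); lra.
Qed.

Lemma asin_le_m1 : forall d, d <= -1 -> asin d = - (PI / 2).
Proof.
  intros d Hd. unfold asin. destruct (Rle_dec d (-1)); lra.
Qed.

Lemma arcsin_factor_ge1_out : forall d, 1 <= d -> arcsin_factor d = d * (PI / 2).
Proof.
  intros d Hd. unfold arcsin_factor. rewrite asin_ge1 by lra.
  rewrite sqrt_neg_0 by nra. ring.
Qed.

Lemma arcsin_factor_le_m1_out : forall d, d <= -1 -> arcsin_factor d = - d * (PI / 2).
Proof.
  intros d Hd. unfold arcsin_factor. rewrite asin_le_m1 by lra.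
  rewrite sqrt_neg_0 by nra. ring.
Qed.

Lemma arcsin_factor_subgradient_in : forall a b, -1 <= a <= 1 -> -1 <= b <= 1 ->
  asin a * (b - a) <= arcsin_factor b - arcsin_factor a.
Proof.
  intros a b Ha Hb. rewrite !arcsin_factor_in by lra.
  pose proof (asin_bound a) as Ba. pose proof (asin_bound b) as Bb.
  pose proof (sin_asin a Ha) as Sa. pose proof (sin_asin b Hb) as Sb.
  set (s := asin a) in *. set (t := asin b) in *.
  rewrite <- Sa at 1. rewrite <- Sb at 1.
  destruct (MVT_gen cos t s (fun x => - sin x)) as [c [Hc E]].
  - intros x _. apply is_derive_Reals. apply derivable_pt_lim_cos.
  - intros x _. apply continuity_cos.
  - assert (0 <= (t - s) * (sin t - sin c)).
    { unfold Rmin, Rmax in Hc. destruct (Rle_dec t s).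
      - assert (sin t <= sin c) by (apply sin_incr_1; lra). nra.
      - assert (sin c <= sin t) by (apply sin_incr_1; lra). nra. }
    nra.
Qed.

(** [arcsin_factor] is convex with derivative [asin].  The inequality survives
    outside [-1 <= d <= 1], because there the truncated [sqrt] and [asin] make
    the function go on along its tangent lines at [-1] and [1]; so the bounds
    below hold for every real argument. *)
Lemma arcsin_factor_subgradient : forall a b, asin a * (b - a) <= arcsin_factor b - arcsin_factor a.
Proof.
  assert (P := PI_RGT_0).
  assert (H1 : forall a b, -1 <= a <= 1 -> asin a * (b - a) <= arcsin_factor b - arcsin_factor a).
  { intros a b Ha. pose proof (asin_bound a) as B.
    destruct (Rle_dec b (-1)); [|destruct (Rle_dec 1 b)].
    - pose proof (arcsin_factor_subgradient_in a (-1) Ha ltac:(lra)) as H.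
      rewrite (arcsin_factor_le_m1_out b) by lra. rewrite (arcsin_factor_le_m1_out (-1)) in H by lra.
      nra.
    - pose proof (arcsin_factor_subgradient_in a 1 Ha ltac:(lra)) as H.
      rewrite (arcsin_factor_ge1_out b) by lra. rewrite (arcsin_factor_ge1_out 1) in H by lra.
      nra.
    - apply arcsin_factor_subgradient_in; lra. }
  intros a b.
  destruct (Rle_dec a (-1)); [|destruct (Rle_dec 1 a)].
  - pose proof (H1 (-1) b ltac:(lra)) as H.
    rewrite (arcsin_factor_le_m1_out a) by lra. rewrite (arcsin_factor_le_m1_out (-1)) in H by lra.
    rewrite asin_le_m1 by lra. rewrite asin_le_m1 in H by lra. nra.
  - pose proof (H1 1 b ltac:(lra)) as H.
    rewrite (arcsin_factor_ge1_out a) by lra. rewrite (arcsin_factor_ge1_out 1) in H by lra.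
    rewrite asin_ge1 by lra. rewrite asin_ge1 in H by lra. nra.
  - apply H1; lra.
Qed.

Lemma arcsin_factor_0 : arcsin_factor 0 = 1.
Proof.
  unfold arcsin_factor. rewrite asin_0. replace (1 - 0 ^ 2) with 1 by ring.
  rewrite sqrt_1. ring.
Qed.

Lemma arcsin_factor_ge1 : forall d, 1 <= arcsin_factor d.
Proof.
  intros d. pose proof (arcsin_factor_subgradient 0 d) as H.
  rewrite arcsin_factor_0, asin_0 in H. lra.
Qed.

Lemma arcsin_factor_lip : forall a b, Rabs (arcsin_factor b - arcsin_factor a) <= 2 * Rabs (b - a).
Proof.
  intros a b.
  pose proof (arcsin_factor_subgradient a b) as H1. pose proof (arcsin_factor_subgradient b a) as H2.
  pose proof (asin_bound a) as Ba. pose proof (asin_bound b) as Bb.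
  assert (P4 := PI_4).
  unfold Rabs; destruct (Rcase_abs (arcsin_factor b - arcsin_factor a)), (Rcase_abs (b - a)); nra.
Qed.

Lemma asin_bound_lin : forall d, 0 <= d <= 1 -> asin d <= 4 * d.
Proof.
  intros d Hd. pose proof (asin_bound d) as B. pose proof (sin_asin d ltac:(lra)) as S.
  set (t := asin d) in *. assert (P := PI_RGT_0). assert (P4 := PI_4).
  destruct (Rle_dec t 0); [lra|].
  (* up to [PI / 3] the derivative of [sin] is at least [1 / 2]; beyond, the
     crude bounds [sin t >= 1 / 2] and [t <= PI / 2 <= 2] suffice *)
  destruct (Rle_dec t (PI / 3)) as [H|H].
  - destruct (MVT_gen sin 0 t cos) as [c [Hc E]].
    + intros x _. apply is_derive_Reals. apply derivable_pt_lim_sin.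
    + intros x _. apply continuity_sin.
    + rewrite Rmin_left, Rmax_right in Hc by lra.
      assert (cos (PI / 3) <= cos c) by (apply cos_decr_1; lra).
      rewrite cos_PI3 in H0. rewrite sin_0 in E. nra.
  - assert (sin (PI / 6) <= sin t) by (apply sin_incr_1; lra).
    rewrite sin_PI6 in H0. lra.
Qed.

(** The function is even, so its linear term at [0] vanishes. *)
Lemma arcsin_factor_quad : forall d, Rabs (arcsin_factor d - 1) <= 4 * d ^ 2.
Proof.
  intros d. pose proof (arcsin_factor_ge1 d). rewrite Rabs_right by lra.
  pose proof (arcsin_factor_subgradient d 0) as H1. rewrite arcsin_factor_0 in H1.
  assert (asin d * d <= 4 * d ^ 2); [|lra].
  assert (P4 := PI_4). pose proof (asin_bound d) as B.
  destruct (Rle_dec 1 d); [nra|]. destruct (Rle_dec d (-1)); [nra|].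
  destruct (Rle_dec 0 d).
  - pose proof (asin_bound_lin d ltac:(lra)). nra.
  - pose proof (asin_bound_lin (- d) ltac:(lra)) as H2.
    rewrite asin_opp in H2. nra.
Qed.

(** * Relative perturbation of the Kac-Rice density *)

Definition gram_ratio (D E1 E2 : R) : R := sqrt (E1 * E2) / (D * sqrt D).

Lemma sqrt_near_1 : forall z, Rabs z <= 1 / 2 -> Rabs (sqrt (1 + z) - 1) <= Rabs z.
Proof.
  intros z Hz. assert (Hz' := Rabs_le_between z (1/2)). destruct Hz' as [Hz' _].
  specialize (Hz' Hz).
  assert (S : sqrt (1 + z) * sqrt (1 + z) = 1 + z) by (apply sqrt_sqrt; lra).
  assert (P := sqrt_pos (1 + z)).
  set (s := sqrt (1 + z)) in *.
  replace (s - 1) with (z / (s + 1))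
    by (replace z with ((s - 1) * (s + 1)) by lra; field; lra).
  rewrite Rabs_div_pos by lra. apply div_le; [lra|].
  rewrite <- (Rmult_1_r (Rabs z)) at 1. apply Rmult_le_compat_l; [nneg|lra].
Qed.

(** The perturbed [sqrt (E1 E2)] is returned as well, since it is also the
    denominator of the argument of [arcsin_factor]. *)
Lemma gram_ratio_pert : forall D E1 E2 d e1 e2 eta,
  0 < D -> 0 < E1 -> 0 < E2 -> 0 <= eta <= 1 / 8 ->
  Rabs d <= eta -> Rabs e1 <= eta -> Rabs e2 <= eta ->
  exists w e,
    sqrt (E1 * (1 + e1) * (E2 * (1 + e2))) = sqrt (E1 * E2) * (1 + w) /\
    Rabs w <= 3 * eta /\
    gram_ratio (D * (1 + d)) (E1 * (1 + e1)) (E2 * (1 + e2)) = gram_ratio D E1 E2 * (1 + e) /\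
    Rabs e <= 10 * eta.
Proof.
  intros D E1 E2 d e1 e2 eta HD HE1 HE2 He Hd H1 H2.
  apply Rabs_le_between in Hd, H1, H2.
  (* [(1 + e1) (1 + e2) = 1 + z] *)
  set (z := e1 + e2 + e1 * e2).
  assert (Hz : Rabs z <= 3 * eta) by (apply Rabs_le_between; unfold z; split; nra).
  exists (sqrt (1 + z) - 1).
  set (w := sqrt (1 + z) - 1).
  assert (Hw : Rabs w <= 3 * eta)
    by (apply Rle_trans with (Rabs z); [apply sqrt_near_1; lra | lra]).
  assert (ES : sqrt (E1 * (1 + e1) * (E2 * (1 + e2))) = sqrt (E1 * E2) * (1 + w)).
  { replace (E1 * (1 + e1) * (E2 * (1 + e2))) with (E1 * E2 * (1 + z))
      by (unfold z; ring).
    rewrite sqrt_mult_alt by nra. unfold w; ring. }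
  set (v := sqrt (1 + d) - 1).
  assert (Hv : Rabs v <= eta).
  { apply Rle_trans with (Rabs d); [apply sqrt_near_1; apply Rabs_le_between; lra |
      apply Rabs_le_between; lra]. }
  apply Rabs_le_between in Hw, Hv.
  assert (SD : 0 < sqrt D) by pos.
  exists ((w - (d + v + d * v)) / ((1 + d) * (1 + v))).
  split; [exact ES|]. split; [apply Rabs_le_between; lra|]. split.
  - unfold gram_ratio. rewrite ES. rewrite (sqrt_mult_alt D) by lra.
    replace (sqrt (1 + d)) with (1 + v) by (unfold v; ring).
    field. repeat split; lra.
  - assert (Hden : / ((1 + d) * (1 + v)) <= 4 / 3 * (4 / 3)).
    { rewrite Rinv_mult. apply Rmult_le_compat.
      - nneg.
      - nneg.
      - replace (4 / 3) with (/ (3 / 4)) by field. apply Rinv_le_contravar; lra.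
      - replace (4 / 3) with (/ (3 / 4)) by field. apply Rinv_le_contravar; lra. }
    unfold Rdiv. rewrite Rabs_mult.
    rewrite (Rabs_right (/ _))
      by (apply Rle_ge, Rlt_le, Rinv_0_lt_compat; nra).
    assert (Rabs (w - (d + v + d * v)) <= 41 / 8 * eta)
      by (apply Rabs_le_between; split; nra).
    assert (0 <= / ((1 + d) * (1 + v))) by (apply Rlt_le, Rinv_0_lt_compat; nra).
    pose proof (Rabs_pos (w - (d + v + d * v))). nra.
Qed.

Lemma relative_form : forall X Xn eta, 0 < X -> Rabs (Xn - X) <= eta * X ->
  exists d, Xn = X * (1 + d) /\ Rabs d <= eta.
Proof.
  intros X Xn eta HX H. exists ((Xn - X) / X). split; [field; lra|].
  rewrite Rabs_div_pos by exact HX. apply div_le; assumption.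
Qed.

(** Since [arcsin_factor] is Lipschitz and at least [1], an additive error on
    the correlation [N / sqrt (E1 E2)] is a relative error on its value. *)
Lemma density_pert : forall D E1 E2 N Dn E1n E2n Nn C eta,
  0 < D -> 0 < E1 -> 0 < E2 -> 0 <= eta <= 1 / 8 -> 0 <= C ->
  Rabs (Dn - D) <= eta * D -> Rabs (E1n - E1) <= eta * E1 ->
  Rabs (E2n - E2) <= eta * E2 ->
  Rabs N <= C * sqrt (E1 * E2) -> Rabs (Nn - N) <= eta * sqrt (E1 * E2) ->
  0 < Dn /\ 0 < E1n /\ 0 < E2n /\
  exists e, Rabs e <= (30 + 30 * C) * eta /\
   arcsin_factor (Nn / sqrt (E1n * E2n)) * gram_ratio Dn E1n E2n
   = arcsin_factor (N / sqrt (E1 * E2)) * gram_ratio D E1 E2 * (1 + e).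
Proof.
  intros D E1 E2 N Dn E1n E2n Nn C eta HD HE1 HE2 He HC HDn HE1n HE2n HN HNn.
  destruct (relative_form _ _ _ HD HDn) as [d [-> Hd]].
  destruct (relative_form _ _ _ HE1 HE1n) as [e1 [-> He1]].
  destruct (relative_form _ _ _ HE2 HE2n) as [e2 [-> He2]].
  destruct (gram_ratio_pert D E1 E2 d e1 e2 eta) as (w & e & HS & Hw & HQ & Hee); auto.
  apply Rabs_le_between in Hd, He1, He2.
  split; [nra|]. split; [nra|]. split; [nra|].
  assert (SP : 0 < sqrt (E1 * E2)) by (apply sqrt_lt_R0; nra).
  rewrite HS, HQ.
  set (s := sqrt (E1 * E2)) in *.
  set (g := arcsin_factor (N / s)). set (gn := arcsin_factor (Nn / (s * (1 + w)))).
  assert (Hw' := Hw). apply Rabs_le_between in Hw'.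
  assert (Hdel : Rabs (Nn / (s * (1 + w)) - N / s) <= (2 + 5 * C) * eta).
  { replace (Nn / (s * (1 + w)) - N / s)
      with (((Nn - N) / s - w * (N / s)) * / (1 + w)) by (field; lra).
    rewrite Rabs_mult.
    assert (HNs : Rabs (N / s) <= C).
    { rewrite Rabs_div_pos by lra. apply div_le; lra. }
    assert (HNns : Rabs ((Nn - N) / s) <= eta).
    { rewrite Rabs_div_pos by lra. apply div_le; lra. }
    assert (Hi : 0 <= / (1 + w) <= 8 / 5).
    { split; [nneg|].
      replace (8 / 5) with (/ (5 / 8)) by field. apply Rinv_le_contravar; lra. }
    rewrite (Rabs_right (/ _)) by lra.
    assert (Rabs ((Nn - N) / s - w * (N / s)) <= eta + 3 * eta * C).
    { unfold Rminus at 1. eapply Rle_trans; [apply Rabs_triang|].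
      rewrite Rabs_Ropp, Rabs_mult.
      pose proof (Rabs_pos w). pose proof (Rabs_pos (N / s)). nra. }
    pose proof (Rabs_pos ((Nn - N) / s - w * (N / s))).
    apply Rle_trans with ((eta + 3 * eta * C) * (8 / 5)); [nra|nra]. }
  assert (Hg : 1 <= g) by apply arcsin_factor_ge1.
  assert (Hgg : Rabs (gn - g) <= (4 + 10 * C) * eta).
  { eapply Rle_trans; [apply arcsin_factor_lip|]. lra. }
  exists ((gn - g) / g * (1 + e) + e). split.
  - assert (Rabs ((gn - g) / g) <= (4 + 10 * C) * eta).
    { rewrite Rabs_div_pos by lra. apply div_le; [lra|].
      rewrite <- (Rmult_1_r (Rabs (gn - g))).
      apply Rmult_le_compat; [nneg|lra|exact Hgg|exact Hg]. }
    eapply Rle_trans; [apply Rabs_triang|]. rewrite Rabs_mult.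
    assert (Rabs (1 + e) <= 9 / 4).
    { apply Rabs_le_between in Hee. apply Rabs_le_between. lra. }
    pose proof (Rabs_pos ((gn - g) / g)). pose proof (Rabs_pos (1 + e)).
    nra.
  - field. lra.
Qed.

(** * Kac-Rice densities as Gram determinants *)

(** The Gram matrix of four vectors, by its entries on and above the diagonal.
    Vectors 1 and 2 stand for the values at the two points, vectors 3 and 4 for
    the derivatives there. *)
Record gram := Gram {
  g11 : R; g12 : R; g22 : R; g13 : R; g23 : R; g14 : R; g24 : R;
  g33 : R; g34 : R; g44 : R }.

Definition detD (G : gram) : R := g11 G * g22 G - g12 G * g12 G.

(** The determinant of the scalar products of vectors 1, 2, 3 with vectors
    1, 2, 4. *)
Definition det3 (a11 a12 a22 a13 a23 a14 a24 a34 : R) : R :=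
  a34 * (a11 * a22 - a12 * a12)
  - (a11 * (a23 * a24) - a12 * (a13 * a24 + a14 * a23) + a22 * (a13 * a14)).

Definition detE1 (G : gram) : R :=
  det3 (g11 G) (g12 G) (g22 G) (g13 G) (g23 G) (g13 G) (g23 G) (g33 G).
Definition detE2 (G : gram) : R :=
  det3 (g11 G) (g12 G) (g22 G) (g14 G) (g24 G) (g14 G) (g24 G) (g44 G).
Definition detN (G : gram) : R :=
  det3 (g11 G) (g12 G) (g22 G) (g13 G) (g23 G) (g14 G) (g24 G) (g34 G).

Definition density (G : gram) : R :=
  arcsin_factor (detN G / sqrt (detE1 G * detE2 G)) * gram_ratio (detD G) (detE1 G) (detE2 G).

(** The covariances of [f(x), f(y), f'(x), f'(y)] for a centered process whose
    covariance is [k (x y)]; [k1] and [k2] are the derivatives of [k]. *)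
Definition kernel_gram (k k1 k2 : R -> R) (x y : R) : gram := {|
  g11 := k (x * x); g12 := k (x * y); g22 := k (y * y);
  g13 := x * k1 (x * x); g23 := y * k1 (x * y);
  g14 := x * k1 (x * y); g24 := y * k1 (y * y);
  g33 := k1 (x * x) + x * x * k2 (x * x);
  g34 := k1 (x * y) + x * y * k2 (x * y);
  g44 := k1 (y * y) + y * y * k2 (y * y) |}.

Definition correlator (k : R -> R) (x y : R) : R := k (x * y) / sqrt (k (x ^ 2) * k (y ^ 2)).

Lemma correlator_dy : forall (k k1 : R -> R) (x y : R), (forall t, is_derive k t (k1 t)) ->
  0 < k (x * x) -> 0 < k (y * y) ->
  is_derive (fun z => correlator k x z) y
    ((x * k1 (x * y) - k (x * y) * (y * k1 (y * y)) / k (y * y))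
     / sqrt (k (x * x) * k (y * y))).
Proof.
  intros k k1 x y Hk Hx Hy. unfold correlator.
  assert (Ex : forall t, ex_derive k t) by (intros t; exists (k1 t); apply Hk).
  assert (Dk : forall t, Derive k t = k1 t) by (intros t; apply is_derive_unique, Hk).
  replace (x ^ 2) with (x * x) by ring.
  assert (HP : 0 < k (x * x) * k (y * y)) by nra.
  assert (HS : 0 < sqrt (k (x * x) * k (y * y))) by pos.
  auto_derive.
  - simpl. rewrite Rmult_1_r. repeat split; auto; lra.
  - rewrite !Rmult_1_r. rewrite !Rmult_1_l.
    fold (Derive k) . change (Derive (fun x0 : R => k x0)) with (Derive k).
    rewrite !Dk.
    match goal with |- ?a = ?b => change (@eq R a b) end.
    set (s := sqrt (k (x * x) * k (y * y))) in *.
    assert (E : s * s = k (x * x) * k (y * y)) by (apply sqrt_sqrt; lra).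
    assert (E' : k (x * x) = s * s / k (y * y)) by (rewrite E; field; lra).
    rewrite E'. field. split; lra.
Qed.

Lemma correlator_sym : forall k x y, correlator k x y = correlator k y x.
Proof.
  intros. unfold correlator. rewrite (Rmult_comm x y), (Rmult_comm (k (x ^ 2))). reflexivity.
Qed.

Lemma correlator_dx : forall (k k1 : R -> R) (x y : R), (forall t, is_derive k t (k1 t)) ->
  0 < k (x * x) -> 0 < k (y * y) ->
  is_derive (fun z => correlator k z y) x
    ((y * k1 (x * y) - k (x * y) * (x * k1 (x * x)) / k (x * x))
     / sqrt (k (x * x) * k (y * y))).
Proof.
  intros k k1 x y Hk Hx Hy.
  apply is_derive_ext with (fun z => correlator k y z); [intros; apply correlator_sym|].
  rewrite (Rmult_comm x y), (Rmult_comm (k (x * x)) (k (y * y))).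
  apply correlator_dy; auto.
Qed.

Lemma correlator_dxy : forall (k k1 k2 : R -> R) (x y : R), (forall t, is_derive k t (k1 t)) ->
  (forall t, is_derive k1 t (k2 t)) ->
  0 < k (x * x) -> 0 < k (y * y) ->
  is_derive (fun w => (w * k1 (w * y) - k (w * y) * (y * k1 (y * y)) / k (y * y))
     / sqrt (k (w * w) * k (y * y))) x
    ((k1 (x * y) + x * y * k2 (x * y)
      - x * k1 (x * y) * (x * k1 (x * x)) / k (x * x)
      - y * k1 (x * y) * (y * k1 (y * y)) / k (y * y)
      + k (x * y) * (x * k1 (x * x)) * (y * k1 (y * y)) / (k (x * x) * k (y * y)))
     / sqrt (k (x * x) * k (y * y))).
Proof.
  intros k k1 k2 x y Hk Hk1 Hx Hy.
  assert (Ex : forall t, ex_derive k t) by (intros t; exists (k1 t); apply Hk).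
  assert (Dk : forall t, Derive k t = k1 t) by (intros t; apply is_derive_unique, Hk).
  assert (Ex1 : forall t, ex_derive k1 t) by (intros t; exists (k2 t); apply Hk1).
  assert (Dk1 : forall t, Derive k1 t = k2 t) by (intros t; apply is_derive_unique, Hk1).
  assert (HP : 0 < k (x * x) * k (y * y)) by nra.
  assert (HS : 0 < sqrt (k (x * x) * k (y * y))) by pos.
  auto_derive.
  - repeat split; auto; lra.
  - rewrite !Rmult_1_r. rewrite !Rmult_1_l.
    change (Derive (fun x0 : R => k x0)) with (Derive k).
    change (Derive (fun x0 : R => k1 x0)) with (Derive k1).
    rewrite !Dk, !Dk1.
    match goal with |- ?a = ?b => change (@eq R a b) end.
    set (s := sqrt (k (x * x) * k (y * y))) in *.
    assert (E : s * s = k (x * x) * k (y * y)) by (apply sqrt_sqrt; lra).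
    assert (E' : k (x * x) = s * s / k (y * y)) by (rewrite E; field; lra).
    rewrite E'. field. split; lra.
Qed.

(** The formula for the [y]-derivative is valid near [x], which is what
    differentiating it again requires; this is where [x <> 0] matters. *)
Lemma correlator_partials : forall (k k1 k2 : R -> R) (x y : R), (forall t, is_derive k t (k1 t)) ->
  (forall t, is_derive k1 t (k2 t)) -> (forall t, 0 < t -> 0 < k t) ->
  x <> 0 -> y <> 0 ->
  let s := sqrt (k (x * x) * k (y * y)) in
  partial_derive 1 0 (correlator k) x y =
    (y * k1 (x * y) - k (x * y) * (x * k1 (x * x)) / k (x * x)) / s /\
  partial_derive 0 1 (correlator k) x y =
    (x * k1 (x * y) - k (x * y) * (y * k1 (y * y)) / k (y * y)) / s /\
  partial_derive 1 1 (correlator k) x y =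
    (k1 (x * y) + x * y * k2 (x * y)
      - x * k1 (x * y) * (x * k1 (x * x)) / k (x * x)
      - y * k1 (x * y) * (y * k1 (y * y)) / k (y * y)
      + k (x * y) * (x * k1 (x * x)) * (y * k1 (y * y)) / (k (x * x) * k (y * y))) / s.
Proof.
  intros k k1 k2 x y Hk Hk1 Hpos Hx Hy s. unfold partial_derive. simpl.
  assert (Kx : 0 < k (x * x)) by (apply Hpos; nra).
  assert (Ky : 0 < k (y * y)) by (apply Hpos; nra).
  split; [|split].
  - apply is_derive_unique. apply correlator_dx; auto.
  - apply is_derive_unique. apply correlator_dy; auto.
  - transitivity (Derive (fun w => (w * k1 (w * y) - k (w * y) * (y * k1 (y * y)) / k (y * y))
     / sqrt (k (w * w) * k (y * y))) x).
    + apply Derive_ext_loc.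
      apply filter_imp with (fun t : R => t <> 0).
      * intros t Ht. apply is_derive_unique. apply correlator_dy; auto. apply Hpos. nra.
      * apply open_neq; auto.
    + apply is_derive_unique. apply correlator_dxy; auto.
Qed.

(** Conditioning [f'(x)] and [f'(y)] on [f(x) = f(y) = 0] divides Gram
    determinants: [1 - r ^ 2] is [D] up to the variances, the conditional
    variances are [E1 / D] and [E2 / D], the conditional covariance is
    [N / D].  The variances of [f(x)] and [f(y)] cancel in the end. *)
Lemma kac_rice_gram : forall (k k1 k2 : R -> R) (x y : R), (forall t, is_derive k t (k1 t)) ->
  (forall t, is_derive k1 t (k2 t)) -> (forall t, 0 < t -> 0 < k t) ->
  x <> 0 -> y <> 0 ->
  let G := kernel_gram k k1 k2 x y in
  0 < detD G -> 0 < detE1 G -> 0 < detE2 G ->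
  let r := correlator k x y in
  let rx := partial_derive 1 0 (correlator k) x y in
  let ry := partial_derive 0 1 (correlator k) x y in
  let sg := sqrt ((partial_derive 1 1 (correlator k) x x - rx ^ 2 / (1 - r ^ 2))
        * (partial_derive 1 1 (correlator k) y y - ry ^ 2 / (1 - r ^ 2))) in
  let dl := / sg * (partial_derive 1 1 (correlator k) x y + r * rx * ry / (1 - r ^ 2)) in
  (sqrt (1 - dl ^ 2) + dl * asin dl) * (sg / sqrt (1 - r ^ 2)) = density G.
Proof.
  intros k k1 k2 x y Hk Hk1 Hpos Hx Hy G HD HE1 HE2 r rx ry sg dl.
  destruct (correlator_partials k k1 k2 x y Hk Hk1 Hpos Hx Hy) as (Rx & Ry & Rxy).
  destruct (correlator_partials k k1 k2 x x Hk Hk1 Hpos Hx Hx) as (_ & _ & Rxx).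
  destruct (correlator_partials k k1 k2 y y Hk Hk1 Hpos Hy Hy) as (_ & _ & Ryy).
  fold rx in Rx. fold ry in Ry.
  assert (Kx : 0 < k (x * x)) by (apply Hpos; nra).
  assert (Ky : 0 < k (y * y)) by (apply Hpos; nra).
  assert (HS : 0 < sqrt (k (x * x) * k (y * y))) by (apply sqrt_lt_R0; nra).
  assert (ES : sqrt (k (x * x) * k (y * y)) * sqrt (k (x * x) * k (y * y))
           = k (x * x) * k (y * y)) by (apply sqrt_sqrt; nra).
  rewrite sqrt_square in Rxx, Ryy by lra.
  assert (Er : r = k (x * y) / sqrt (k (x * x) * k (y * y))).
  { unfold r, correlator. repeat f_equal; ring. }
  set (s := sqrt (k (x * x) * k (y * y))) in *.
  unfold detD, detE1, detE2, det3 in HD, HE1, HE2. simpl in HD, HE1, HE2.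
  assert (E1r : 1 - r ^ 2 = detD G / (k (x * x) * k (y * y))).
  { rewrite Er. unfold detD; simpl.
    replace (k (x * y) / s * (k (x * y) / s * 1))
      with (k (x * y) * k (x * y) / (s * s)) by (field; lra).
    rewrite ES. field. lra. }
  assert (HDG : 0 < detD G) by exact HD.
  assert (HE1G : 0 < detE1 G) by exact HE1.
  assert (HE2G : 0 < detE2 G) by exact HE2.
  assert (EV1 : partial_derive 1 1 (correlator k) x x - rx ^ 2 / (1 - r ^ 2)
    = detE1 G / (k (x * x) * detD G)).
  { rewrite E1r, Rx, Rxx.
    replace (((y * k1 (x * y) - k (x * y) * (x * k1 (x * x)) / k (x * x)) / s) ^ 2)
      with ((y * k1 (x * y) - k (x * y) * (x * k1 (x * x)) / k (x * x)) ^ 2 / (k (x * x) * k (y * y)))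
      by (rewrite <- ES; field; lra).
    unfold detE1, det3. unfold detD in HDG |- *. simpl in HDG |- *.
    field. repeat split; lra. }
  assert (EV2 : partial_derive 1 1 (correlator k) y y - ry ^ 2 / (1 - r ^ 2)
    = detE2 G / (k (y * y) * detD G)).
  { rewrite E1r, Ry, Ryy.
    replace (((x * k1 (x * y) - k (x * y) * (y * k1 (y * y)) / k (y * y)) / s) ^ 2)
      with ((x * k1 (x * y) - k (x * y) * (y * k1 (y * y)) / k (y * y)) ^ 2 / (k (x * x) * k (y * y)))
      by (rewrite <- ES; field; lra).
    unfold detE2, det3. unfold detD in HDG |- *. simpl in HDG |- *.
    field. repeat split; lra. }
  assert (EC : partial_derive 1 1 (correlator k) x y + r * rx * ry / (1 - r ^ 2)
    = detN G / (s * detD G)).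
  { rewrite E1r, Rx, Ry, Rxy, Er.
    replace (k (x * y) / s *
     ((y * k1 (x * y) - k (x * y) * (x * k1 (x * x)) / k (x * x)) / s) *
     ((x * k1 (x * y) - k (x * y) * (y * k1 (y * y)) / k (y * y)) / s))
      with (k (x * y) *
     ((y * k1 (x * y) - k (x * y) * (x * k1 (x * x)) / k (x * x)) ) *
     ((x * k1 (x * y) - k (x * y) * (y * k1 (y * y)) / k (y * y))) / (s * (k (x * x) * k (y * y))))
      by (rewrite <- ES; field; lra).
    unfold detN, det3. unfold detD in HDG |- *. simpl in HDG |- *.
    field. repeat split; lra. }
  assert (HSE : 0 < sqrt (detE1 G * detE2 G))
    by pos.
  assert (Esg : sg = sqrt (detE1 G * detE2 G) / (s * detD G)).
  { unfold sg. rewrite EV1, EV2.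
    replace (detE1 G / (k (x * x) * detD G) * (detE2 G / (k (y * y) * detD G)))
      with ((detE1 G * detE2 G) / ((s * detD G) * (s * detD G)))
      by (replace (s * detD G * (s * detD G)) with (s * s * (detD G * detD G)) by ring;
          rewrite ES; field; lra).
    assert (HsD : 0 < s * detD G) by pos.
    rewrite sqrt_div_alt by pos.
    rewrite sqrt_square by lra. reflexivity. }
  assert (Edl : dl = detN G / sqrt (detE1 G * detE2 G)).
  { unfold dl. rewrite EC, Esg. field. repeat split; lra. }
  assert (HSD : 0 < sqrt (detD G)) by pos.
  assert (Esr : sqrt (1 - r ^ 2) = sqrt (detD G) / s).
  { rewrite E1r, sqrt_div_alt by pos. reflexivity. }
  change (sqrt (1 - dl ^ 2) + dl * asin dl) with (arcsin_factor dl).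
  rewrite Edl, Esg, Esr. unfold density, gram_ratio. f_equal. field.
  repeat split; lra.
Qed.

Lemma rho1_gram : forall (k k1 k2 : R -> R) (x : R), (forall t, is_derive k t (k1 t)) ->
  (forall t, is_derive k1 t (k2 t)) -> (forall t, 0 < t -> 0 < k t) -> x <> 0 ->
  partial_derive 1 1 (correlator k) x x
  = (k (x * x) * (k1 (x * x) + x * x * k2 (x * x)) - (x * k1 (x * x)) ^ 2)
    / (k (x * x)) ^ 2.
Proof.
  intros k k1 k2 x Hk Hk1 Hpos Hx.
  destruct (correlator_partials k k1 k2 x x Hk Hk1 Hpos Hx Hx) as (_ & _ & ->).
  assert (Kx : 0 < k (x * x)) by (apply Hpos; nra).
  rewrite sqrt_square by lra. field. lra.
Qed.

(** Changing both signs changes the signs of vectors 3 and 4. *)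
Lemma kernel_gram_opp : forall k k1 k2 x y,
  let G := kernel_gram k k1 k2 x y in
  let H := kernel_gram k k1 k2 (- x) (- y) in
  detD H = detD G /\ detE1 H = detE1 G /\ detE2 H = detE2 G /\ detN H = detN G.
Proof.
  intros. unfold G, H, detD, detE1, detE2, detN, det3; simpl.
  rewrite !Rmult_opp_opp. repeat split; ring.
Qed.

(** * The binomial series and its moments *)

(** The coefficients [b (b + 1) ... (b + j - 1) / j!] of [(1 - t) ^ (- b)]. *)
Fixpoint binc (b : R) (j : nat) : R :=
  match j with
  | O => 1
  | S i => binc b i * (b + INR i) / (INR i + 1)
  end.

Lemma binc_pos : forall b j, 0 < b -> 0 < binc b j.
Proof.
  intros b j Hb. induction j as [|j IH]; simpl; [lra|].
  pose proof (pos_INR j). apply Rdiv_lt_0_compat; nra.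
Qed.

Lemma binc_rec : forall b j, (INR j + 1) * binc b (S j) = (b + INR j) * binc b j.
Proof. intros b j. simpl. pose proof (pos_INR j). field. lra. Qed.

(** Multiplying by [b + j] raises the parameter: derivatives and moments of the
    series for [b] thereby become multiples of the series for [b + 1]. *)
Lemma binc_shift : forall b j, 0 < b -> b * binc (b + 1) j = (b + INR j) * binc b j.
Proof.
  intros b j Hb. induction j as [|j IH].
  - simpl. ring.
  - pose proof (pos_INR j).
    apply Rmult_eq_reg_l with (INR j + 1); [|lra].
    rewrite S_INR.
    transitivity ((b + 1 + INR j) * (b * binc (b + 1) j)).
    + rewrite <- !Rmult_assoc. rewrite (Rmult_comm (INR j + 1) b), Rmult_assoc, binc_rec. ring.
    + rewrite IH.
      transitivity ((b + (INR j + 1)) * ((INR j + 1) * binc b (S j))); [|ring].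
      rewrite binc_rec. ring.
Qed.

Lemma binc_radius : forall b, 0 < b -> CV_radius (binc b) = 1.
Proof.
  intros b Hb. rewrite CV_radius_finite_DAlembert with (l := 1); try lra.
  - simpl. f_equal. field.
  - intros n. pose proof (binc_pos b n Hb). lra.
  - apply is_lim_seq_ext with (fun n => 1 + (b - 1) * / (INR n + 1)).
    + intros n. pose proof (binc_pos b n Hb). pose proof (pos_INR n).
      simpl. rewrite Rabs_right; [field; lra|].
      apply Rle_ge, Rlt_le. apply Rdiv_lt_0_compat; [|lra]. apply Rdiv_lt_0_compat; nra.
    + replace (Finite 1) with (Finite (1 + (b - 1) * 0)) by (f_equal; ring).
      apply is_lim_seq_plus'; [apply is_lim_seq_const|].
      apply is_lim_seq_mult'; [apply is_lim_seq_const|].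
      apply is_lim_seq_ext with (fun n => / INR (S n)).
      * intros n. rewrite S_INR. reflexivity.
      * apply (is_lim_seq_incr_1 (fun n => / INR n)).
        evar_last. apply is_lim_seq_inv. apply is_lim_seq_INR. discriminate. reflexivity.
Qed.

(** The differential equation [(1 - t) f' = b f], coefficient by coefficient. *)
Lemma binc_ode : forall b t, 0 < b -> 0 <= t < 1 ->
  (1 - t) * PSeries (PS_derive (binc b)) t = b * PSeries (binc b) t.
Proof.
  intros b t Hb Ht.
  assert (Hr : Rbar_lt (Rabs t) (CV_radius (binc b)))
    by (rewrite binc_radius by lra; simpl; rewrite Rabs_right; lra).
  assert (Hr' : Rbar_lt (Rabs t) (CV_radius (PS_derive (binc b))))
    by (rewrite CV_radius_derive; exact Hr).
  assert (X1 : ex_pseries (PS_derive (binc b)) t) by (apply CV_radius_inside; exact Hr').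
  rewrite <- (PSeries_scal b (binc b)).
  replace ((1 - t) * PSeries (PS_derive (binc b)) t) with
    (PSeries (PS_derive (binc b)) t - t * PSeries (PS_derive (binc b)) t) by ring.
  assert (EI : PSeries (PS_incr_1 (PS_derive (binc b))) t
    = t * PSeries (PS_derive (binc b)) t) by apply PSeries_incr_1.
  rewrite <- EI, <- PSeries_minus; auto.
  - apply PSeries_ext. intros n.
    unfold PS_minus, PS_plus, PS_opp, PS_scal, PS_incr_1, PS_derive.
    destruct n as [|n].
    + unfold plus, opp, scal, mult, zero; simpl. unfold mult; simpl. field.
    + change (INR (S (S n)) * binc b (S (S n)) + - (INR (S n) * binc b (S n))
        = b * binc b (S n)).
      rewrite (S_INR (S n)), binc_rec. ring.
  - apply ex_pseries_incr_1. exact X1.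
Qed.

(** By [binc_ode] the product of the sum with [(1 - t) ^ b] has derivative
    [0]. *)
Lemma binc_series : forall b t, 0 < b -> 0 <= t < 1 ->
  is_series (fun j => binc b j * t ^ j) (Rpower (1 - t) (- b)).
Proof.
  intros b t Hb Ht.
  assert (Hr : forall u, 0 <= u <= t -> Rbar_lt (Rabs u) (CV_radius (binc b)))
    by (intros u Hu; rewrite binc_radius by lra; simpl; rewrite Rabs_right; lra).
  assert (Hser : is_series (fun j => binc b j * t ^ j) (PSeries (binc b) t)).
  { apply Series_correct. apply ex_series_Rabs, CV_disk_inside, Hr. lra. }
  assert (Hd : forall u, 0 <= u <= t ->
    is_derive (fun u => PSeries (binc b) u * Rpower (1 - u) b) u 0).
  { intros u Hu.
    assert (D1 := is_derive_PSeries (binc b) u (Hr u Hu)).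
    assert (D2 : is_derive (fun u => Rpower (1 - u) b) u (- (b * / (1 - u)) * Rpower (1 - u) b)).
    { unfold Rpower. auto_derive; [lra|]. replace (1 + - u) with (1 - u) by ring. field. lra. }
    evar_last.
    - apply (is_derive_mult (PSeries (binc b)) (fun u => Rpower (1 - u) b) u _ _ D1 D2).
      intros; apply Rmult_comm.
    - unfold plus, mult; simpl.
      transitivity ((/ (1 - u)) * Rpower (1 - u) b * ((1 - u) * PSeries (PS_derive (binc b)) u
         - b * PSeries (binc b) u)); [field; lra|].
      rewrite binc_ode by lra. ring. }
  destruct (MVT_gen (fun u => PSeries (binc b) u * Rpower (1 - u) b) 0 t (fun _ => 0))
    as [c [_ E]].
  - intros u Hu. rewrite Rmin_left, Rmax_right in Hu by lra. apply Hd; lra.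
  - intros u Hu. rewrite Rmin_left, Rmax_right in Hu by lra.
    apply continuity_pt_filterlim. apply ex_derive_continuous with (f := fun u => PSeries (binc b) u * Rpower (1 - u) b). exists 0. apply Hd; lra.
  - rewrite PSeries_0 in E. simpl in E.
    replace (1 - 0) with 1 in E by ring.
    assert (R1 : Rpower 1 b = 1) by (unfold Rpower; rewrite ln_1, Rmult_0_r, exp_0; reflexivity).
    rewrite R1 in E.
    replace (Rpower (1 - t) (- b)) with (PSeries (binc b) t); [exact Hser|].
    rewrite Rpower_Ropp.
    assert (0 < Rpower (1 - t) b) by (unfold Rpower; apply exp_pos).
    apply Rmult_eq_reg_r with (Rpower (1 - t) b); [|lra]. rewrite Rinv_l by lra. lra.
Qed.

Definition binK (b t : R) : R := Rpower (1 - t) (- b).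

Lemma binK_pos : forall b t, 0 < binK b t.
Proof. intros. unfold binK, Rpower. apply exp_pos. Qed.

Lemma binK_succ : forall b t, t < 1 -> binK (b + 1) t = binK b t / (1 - t).
Proof.
  intros b t Ht. unfold binK. replace (- (b + 1)) with (- b + - (1)) by ring.
  rewrite Rpower_plus, (Rpower_Ropp _ 1), Rpower_1 by lra. reflexivity.
Qed.

(** For [j = 0] the factor [INR j] hides the truncated exponent. *)
Definition dpow (x : R) (j : nat) : R := INR j * x ^ (pred j).
Definition ddpow (x : R) (j : nat) : R := INR j * INR (pred j) * x ^ (pred (pred j)).

Lemma is_series_ext_R : forall (a c : nat -> R) (l : R),
  (forall j, a j = c j) -> is_series a l -> is_series c l.
Proof. intros a c l H. apply is_series_ext. exact H. Qed.

Lemma is_series_shift0 : forall (a : nat -> R) (l : R), a O = 0 ->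
  is_series (fun j => a (S j)) l -> is_series a l.
Proof.
  intros a l H0 H. apply is_series_decr_1.
  evar_last; [exact H|].
  rewrite H0. unfold plus, opp; simpl. ring.
Qed.

Lemma is_series_scal_R : forall (c : R) (a : nat -> R) (l : R),
  is_series a l -> is_series (fun j => c * a j) (c * l).
Proof. intros c a l H. exact (is_series_scal c a l H). Qed.

Lemma binc_series1 : forall b t, 0 < b -> 0 <= t < 1 ->
  is_series (fun j => binc b j * dpow t j) (b * binK b t / (1 - t)).
Proof.
  intros b t Hb Ht. apply is_series_shift0; [unfold dpow; simpl; ring|].
  apply is_series_ext_R with (fun j => b * (binc (b + 1) j * t ^ j)).
  - intros j. unfold dpow. rewrite <- Rmult_assoc, binc_shift by lra.
    rewrite <- binc_rec, S_INR. simpl pred. ring.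
  - replace (b * binK b t / (1 - t)) with (b * binK (b + 1) t)
      by (rewrite binK_succ by lra; field; lra).
    apply is_series_scal_R. apply binc_series; lra.
Qed.

Lemma binc_series2 : forall b t, 0 < b -> 0 <= t < 1 ->
  is_series (fun j => binc b j * ddpow t j) (b * (b + 1) * binK b t / (1 - t) ^ 2).
Proof.
  intros b t Hb Ht. apply is_series_shift0; [unfold ddpow; simpl; ring|].
  apply is_series_ext_R with (fun j => b * (binc (b + 1) j * dpow t j)).
  - intros j. unfold dpow, ddpow. rewrite <- Rmult_assoc, binc_shift by lra.
    rewrite <- binc_rec, S_INR. simpl pred. ring.
  - replace (b * (b + 1) * binK b t / (1 - t) ^ 2) with (b * ((b + 1) * binK (b + 1) t / (1 - t)))
      by (rewrite binK_succ by lra; field; lra).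
    apply is_series_scal_R. apply binc_series1; lra.
Qed.

Fixpoint risefact (b : R) (s : nat) : R :=
  match s with O => 1 | S s => risefact b s * (b + INR s) end.

Lemma risefact_pos : forall b s, 0 < b -> 0 < risefact b s.
Proof.
  intros b s Hb; induction s as [|s IH]; simpl; [lra|]. pose proof (pos_INR s). nra.
Qed.

(** [j] times a coefficient is at most [b + j] times it, which is [b] times the
    coefficient for [b + 1]. *)
Lemma binc_moment : forall b s j, 0 < b ->
  INR j ^ s * binc b j <= risefact b s * binc (b + INR s) j.
Proof.
  intros b s j Hb. induction s as [|s IH].
  - simpl. rewrite Rplus_0_r. lra.
  - rewrite S_INR, <- Rplus_assoc. simpl risefact. rewrite Rmult_assoc.
    pose proof (pos_INR s). pose proof (pos_INR j). rewrite binc_shift by lra.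
    pose proof (risefact_pos b s Hb).
    pose proof (binc_pos (b + INR s) j ltac:(lra)).
    simpl pow. rewrite Rmult_assoc.
    apply Rle_trans with (INR j * (risefact b s * binc (b + INR s) j)).
    + mono.
    + assert (0 < risefact b s * binc (b + INR s) j) by nra. nra.
Qed.

Lemma binK_shift : forall b s t, t < 1 -> binK (b + INR s) t = binK b t * (/ (1 - t)) ^ s.
Proof.
  intros b s t Ht. induction s as [|s IH].
  - simpl. rewrite Rplus_0_r. ring.
  - rewrite S_INR, <- Rplus_assoc, binK_succ, IH by lra. simpl. unfold Rdiv. ring.
Qed.

(** The growth [(1 - t) ^ (- b - s)] is that of the moments of [binc b].  Order
    four is reached by products of two second divided differences. *)
Definition moment_bound (b theta t : R) (w : nat -> R) : Prop :=
  forall s, (s <= 4)%nat ->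
  exists l, is_series (fun j => Rabs (w j) * INR j ^ s * t ^ j) l /\
    l <= theta * (binK b t * (/ (1 - t)) ^ s).

Lemma is_series_dom : forall (a c : nat -> R) (lc : R),
  (forall j, 0 <= a j <= c j) -> is_series c lc ->
  exists l, is_series a l /\ 0 <= l <= lc.
Proof.
  intros a c lc H Hc.
  assert (Ha : ex_series a).
  { apply (@ex_series_le R_AbsRing R_CompleteNormedModule) with c; [|exists lc; exact Hc].
    intros n. unfold norm; simpl. unfold abs; simpl. rewrite Rabs_right; [apply H|].
    apply Rle_ge, H. }
  exists (Series a). split; [apply Series_correct; exact Ha|].
  rewrite <- (is_series_unique c lc Hc). split.
  - replace 0 with (Series (fun _ => 0 * 0)).
    + apply Series_le; [|exact Ha]. intros n. specialize (H n). lra.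
    + rewrite Series_scal_l. ring.
  - apply Series_le; [exact H|]. exists lc; exact Hc.
Qed.

Lemma binc_moment_series : forall b s t, 0 < b -> 0 <= t < 1 ->
  exists l, is_series (fun j => binc b j * INR j ^ s * t ^ j) l /\
   0 <= l <= risefact b s * (binK b t * (/ (1 - t)) ^ s).
Proof.
  intros b s t Hb Ht. pose proof (pos_INR s).
  apply is_series_dom with (fun j => risefact b s * (binc (b + INR s) j * t ^ j)).
  - intros j. pose proof (binc_pos b j Hb). pose proof (pos_INR j).
    assert (0 <= t ^ j) by nneg.
    assert (0 <= INR j ^ s) by nneg.
    pose proof (binc_moment b s j Hb). split.
    + apply Rmult_le_pos; [|lra]. nneg.
    + rewrite <- Rmult_assoc. mono.
  - rewrite <- binK_shift by lra. apply is_series_scal_R. apply binc_series; lra.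
Qed.

Lemma risefact_bounded : forall b, 0 < b -> exists M, 0 < M /\
  forall s, (s <= 4)%nat -> risefact b s <= M.
Proof.
  intros b Hb. exists (1 + risefact b 0 + risefact b 1 + risefact b 2 + risefact b 3 + risefact b 4).
  pose proof (risefact_pos b 0 Hb). pose proof (risefact_pos b 1 Hb).
  pose proof (risefact_pos b 2 Hb). pose proof (risefact_pos b 3 Hb).
  pose proof (risefact_pos b 4 Hb).
  split; [lra|]. intros s Hs.
  do 5 (destruct s as [|s]; [lra|]). lia.
Qed.

(** * Growth of the binomial coefficients *)

(** [a_j - C / j] increases and [a_j + C / j] decreases; the limit is the
    supremum of the former. *)
Lemma telescoping_limit : forall (a : nat -> R) C, 0 <= C ->
  (forall j, (1 <= j)%nat -> Rabs (a (S j) - a j) <= C * (/ INR j - / INR (S j))) ->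
  exists l, forall j, (1 <= j)%nat -> Rabs (a j - l) <= C * / INR j.
Proof.
  intros a C HC H.
  (* two nested monotone sequences *)
  set (lo := fun j => a j - C * / INR j). set (up := fun j => a j + C * / INR j).
  assert (Hlo : forall j i, (1 <= j)%nat -> lo j <= lo (j + i)%nat).
  { intros j i Hj. induction i as [|i IH]; [rewrite Nat.add_0_r; lra|].
    eapply Rle_trans; [exact IH|]. rewrite Nat.add_succ_r. unfold lo.
    pose proof (H (j + i)%nat ltac:(lia)) as K. apply Rabs_le_between in K. lra. }
  assert (Hup : forall j i, (1 <= j)%nat -> up (j + i)%nat <= up j).
  { intros j i Hj. induction i as [|i IH]; [rewrite Nat.add_0_r; lra|].
    eapply Rle_trans; [|exact IH]. rewrite Nat.add_succ_r. unfold up.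
    pose proof (H (j + i)%nat ltac:(lia)) as K. apply Rabs_le_between in K. lra. }
  assert (Hlu : forall j k, (1 <= j)%nat -> (1 <= k)%nat -> lo j <= up k).
  { intros j k Hj Hk. eapply Rle_trans; [apply (Hlo j k Hj)|].
    eapply Rle_trans; [|apply (Hup k j Hk)]. rewrite (Nat.add_comm k j).
    unfold lo, up.
    assert (0 < / INR (j + k)) by (apply Rinv_0_lt_compat, lt_0_INR; lia). nra. }
  destruct (completeness (fun r => exists j, (1 <= j)%nat /\ r = lo j)) as [l [Hl1 Hl2]].
  - exists (up 1%nat). intros r [j [Hj ->]]. apply Hlu; auto.
  - exists (lo 1%nat), 1%nat. auto.
  - exists l. intros j Hj.
    assert (lo j <= l) by (apply Hl1; exists j; auto).
    assert (l <= up j) by (apply Hl2; intros r [i [Hi ->]]; apply Hlu; auto).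
    unfold lo, up in *. apply Rabs_le_between. lra.
Qed.

Lemma ln_1p_quad : forall z, - (1 / 2) <= z -> Rabs (ln (1 + z) - z) <= 2 * z ^ 2.
Proof.
  intros z Hz. apply Rabs_le_between. split.
  - assert (- ln (1 + z) <= - (z / (1 + z))).
    { rewrite <- ln_Rinv by lra.
      pose proof (exp_ineq1_le (- (z / (1 + z)))) as K.
      replace (1 + - (z / (1 + z))) with (/ (1 + z)) in K by (field; lra).
      rewrite <- (ln_exp (- (z / (1 + z)))).
      apply ln_le; [pos|exact K]. }
    assert (z / (1 + z) = z - z ^ 2 * / (1 + z)) by (field; lra).
    assert (/ (1 + z) <= 2).
    { replace 2 with (/ (1 / 2)) by field. apply Rinv_le_contravar; lra. }
    assert (0 <= z ^ 2) by nra. nra.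
  - pose proof (exp_ineq1_le z) as K.
    assert (ln (1 + z) <= ln (exp z)) by (apply ln_le; lra).
    rewrite ln_exp in H. nra.
Qed.

(** The increments of [ln (binc b j) - (b - 1) ln j] are [O(1 / j ^ 2)] because
    the terms of order [1 / j] cancel; [kap] is [1 / Gamma b]. *)
Lemma binc_asymp : forall b, 0 < b -> exists kap C, 0 < kap /\ 0 < C /\
  forall j, (1 <= j)%nat -> exists v, Rabs v <= C * / INR j /\
   binc b j = kap * Rpower (INR j) (b - 1) * exp v.
Proof.
  intros b Hb.
  set (C := 2 * (b - 1) ^ 2 + 2 * Rabs (b - 1) + 1).
  assert (HC : 0 < C)
    by (unfold C; pose proof (Rabs_pos (b - 1)); pose proof (pow2_ge_0 (b - 1)); lra).
  destruct (telescoping_limit (fun j => ln (binc b j) - (b - 1) * ln (INR j)) C) as [l Hl].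
  - lra.
  - intros j Hj. assert (J1 : 1 <= INR j) by (apply (le_INR 1 j Hj)).
    pose proof (binc_pos b j Hb) as Hp.
    (* both logarithms are expanded in [v = 1 / (j + 1)] *)
    set (v := / (INR j + 1)).
    assert (Hv : 0 < v <= 1 / 2).
    { unfold v. split; [pos|].
      replace (1 / 2) with (/ 2) by field. apply Rinv_le_contravar; lra. }
    assert (E1 : ln (binc b (S j)) - ln (binc b j) = ln (1 + (b - 1) * v)).
    { rewrite <- ln_div; [|apply binc_pos; lra|lra]. f_equal.
      simpl. unfold v. field. lra. }
    assert (E2 : ln (INR j) - ln (INR (S j)) = ln (1 + - v)).
    { rewrite S_INR, <- ln_div by lra. f_equal. unfold v. field. lra. }
    replace (ln (binc b (S j)) - (b - 1) * ln (INR (S j)) - (ln (binc b j) - (b - 1) * ln (INR j)))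
      with ((ln (1 + (b - 1) * v) - (b - 1) * v) + (b - 1) * (ln (1 + - v) - - v))
      by (rewrite <- E1, <- E2; ring).
    assert (Q1 := ln_1p_quad ((b - 1) * v) ltac:(nra)).
    assert (Q2 := ln_1p_quad (- v) ltac:(lra)).
    eapply Rle_trans; [apply Rabs_triang|]. rewrite Rabs_mult.
    apply Rle_trans with (C * v ^ 2).
    + pose proof (Rabs_pos (b - 1)) as HA.
      apply (Rmult_le_compat_l _ _ _ HA) in Q2.
      assert (0 <= v ^ 2) by nra.
      replace (C * v ^ 2) with (2 * ((b - 1) * v) ^ 2 + Rabs (b - 1) * (2 * (- v) ^ 2) + v ^ 2)
        by (unfold C; ring).
      lra.
    + apply Rmult_le_compat_l; [lra|]. rewrite S_INR.
      replace (/ INR j - / (INR j + 1)) with (v * / INR j) by (unfold v; field; lra).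
      simpl. rewrite Rmult_1_r. apply Rmult_le_compat_l; [lra|].
      unfold v. apply Rinv_le_contravar; lra.
  - exists (exp l), C. split; [apply exp_pos|]. split; [lra|]. intros j Hj.
    exists (ln (binc b j) - (b - 1) * ln (INR j) - l). split; [apply Hl; exact Hj|].
    unfold Rpower. rewrite <- !exp_plus.
    replace (l + (b - 1) * ln (INR j) + (ln (binc b j) - (b - 1) * ln (INR j) - l))
      with (ln (binc b j)) by ring.
    rewrite exp_ln; [reflexivity|]. apply binc_pos; lra.
Qed.

(** * Weighted inner products and divided differences *)

(** A scalar product for the weights [w], as a relation: it carries the
    convergence of the series, so that linear combinations need no separate
    summability argument. *)
Definition ip (w a c : nat -> R) (l : R) : Prop :=
  is_series (fun j => w j * a j * c j) l.

Lemma ip_sym : forall w a c l, ip w a c l -> ip w c a l.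
Proof.
  intros w a c l H. unfold ip in *.
  apply is_series_ext_R with (fun j => w j * a j * c j); [intros; ring|exact H].
Qed.

Definition ddiff (h : R) (a c : nat -> R) (j : nat) : R := (a j - c j) / h.

Lemma ip_ddiff_l : forall w a c e l m h, ip w a e l -> ip w c e m ->
  ip w (ddiff h a c) e ((l - m) / h).
Proof.
  intros w a c e l m h H1 H2. unfold ip in *.
  apply is_series_ext_R with (fun j => / h * (plus (w j * a j * e j) (opp (w j * c j * e j)))).
  - intros j. unfold ddiff, plus, opp; simpl. unfold Rdiv. ring.
  - replace ((l - m) / h) with (/ h * plus l (opp m))
      by (unfold plus, opp; simpl; unfold Rdiv; ring).
    apply is_series_scal_R. apply (is_series_minus _ _ _ _ H1 H2).
Qed.

Lemma ip_ddiff_r : forall w a c e l m h, ip w e a l -> ip w e c m ->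
  ip w e (ddiff h a c) ((l - m) / h).
Proof.
  intros. apply ip_sym, ip_ddiff_l; apply ip_sym; assumption.
Qed.

Lemma ip_weight_sub : forall w w' a c l l', ip w a c l -> ip w' a c l' ->
  ip (fun j => w j - w' j) a c (l - l').
Proof.
  intros w w' a c l l' H1 H2. unfold ip in *.
  apply is_series_ext_R with (fun j => plus (w j * a j * c j) (opp (w' j * a j * c j))).
  - intros j. unfold plus, opp; simpl. ring.
  - apply (is_series_minus _ _ _ _ H1 H2).
Qed.

Record gram_of (w v1 v2 v3 v4 : nat -> R) (G : gram) : Prop := GramOf {
  go11 : ip w v1 v1 (g11 G); go12 : ip w v1 v2 (g12 G); go22 : ip w v2 v2 (g22 G);
  go13 : ip w v1 v3 (g13 G); go23 : ip w v2 v3 (g23 G);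
  go14 : ip w v1 v4 (g14 G); go24 : ip w v2 v4 (g24 G);
  go33 : ip w v3 v3 (g33 G); go34 : ip w v3 v4 (g34 G); go44 : ip w v4 v4 (g44 G) }.

Definition gsub (G H : gram) : gram := {|
  g11 := g11 G - g11 H; g12 := g12 G - g12 H; g22 := g22 G - g22 H;
  g13 := g13 G - g13 H; g23 := g23 G - g23 H; g14 := g14 G - g14 H;
  g24 := g24 G - g24 H; g33 := g33 G - g33 H; g34 := g34 G - g34 H;
  g44 := g44 G - g44 H |}.

Lemma gram_of_sub : forall w w' v1 v2 v3 v4 G H,
  gram_of w v1 v2 v3 v4 G -> gram_of w' v1 v2 v3 v4 H ->
  gram_of (fun j => w j - w' j) v1 v2 v3 v4 (gsub G H).
Proof.
  intros w w' v1 v2 v3 v4 G H [] []. split; simpl; apply ip_weight_sub; assumption.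
Qed.

(** Bookkeeping for one step of divided differences: here [v2] becomes
    [(v2 - v1) / h]; below, [v3] and [v4] become [(v3 - v2) / h] and
    [(v4 - v2) / h]. *)
Definition reduce2 (h : R) (G : gram) : gram := {|
  g11 := g11 G; g12 := (g12 G - g11 G) / h;
  g22 := ((g22 G - g12 G) / h - (g12 G - g11 G) / h) / h;
  g13 := g13 G; g23 := (g23 G - g13 G) / h;
  g14 := g14 G; g24 := (g24 G - g14 G) / h;
  g33 := g33 G; g34 := g34 G; g44 := g44 G |}.

Definition reduce3 (h : R) (G : gram) : gram := {|
  g11 := g11 G; g12 := g12 G; g22 := g22 G;
  g13 := (g13 G - g12 G) / h; g23 := (g23 G - g22 G) / h;
  g14 := g14 G; g24 := g24 G;
  g33 := ((g33 G - g23 G) / h - (g23 G - g22 G) / h) / h;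
  g34 := (g34 G - g24 G) / h; g44 := g44 G |}.

Definition reduce4 (h : R) (G : gram) : gram := {|
  g11 := g11 G; g12 := g12 G; g22 := g22 G;
  g13 := g13 G; g23 := g23 G;
  g14 := (g14 G - g12 G) / h; g24 := (g24 G - g22 G) / h;
  g33 := g33 G; g34 := (g34 G - g23 G) / h;
  g44 := ((g44 G - g24 G) / h - (g24 G - g22 G) / h) / h |}.

Lemma gram_of_reduce2 : forall w v1 v2 v3 v4 G h, gram_of w v1 v2 v3 v4 G ->
  gram_of w v1 (ddiff h v2 v1) v3 v4 (reduce2 h G).
Proof.
  intros w v1 v2 v3 v4 G h []. split; simpl; auto.
  - apply ip_ddiff_r; auto.
  - apply ip_ddiff_r; apply ip_ddiff_l; auto. apply ip_sym; auto.
  - apply ip_ddiff_l; auto.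
  - apply ip_ddiff_l; auto.
Qed.

Lemma gram_of_reduce3 : forall w v1 v2 v3 v4 G h, gram_of w v1 v2 v3 v4 G ->
  gram_of w v1 v2 (ddiff h v3 v2) v4 (reduce3 h G).
Proof.
  intros w v1 v2 v3 v4 G h []. split; simpl; auto.
  - apply ip_ddiff_r; auto.
  - apply ip_ddiff_r; auto.
  - apply ip_ddiff_r; apply ip_ddiff_l; auto. apply ip_sym; auto.
  - apply ip_ddiff_l; auto.
Qed.

Lemma gram_of_reduce4 : forall w v1 v2 v3 v4 G h, gram_of w v1 v2 v3 v4 G ->
  gram_of w v1 v2 v3 (ddiff h v4 v2) (reduce4 h G).
Proof.
  intros w v1 v2 v3 v4 G h []. split; simpl; auto.
  - apply ip_ddiff_r; auto.
  - apply ip_ddiff_r; auto.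
  - apply ip_ddiff_r; auto. apply ip_sym; auto.
  - apply ip_ddiff_r; apply ip_ddiff_l; auto. apply ip_sym; auto.
Qed.

(** For the values and derivatives of a function at [x] and [y = x + h], the
    four vectors become [f(x)], the slope [s] from [x] to [y], and
    [(f'(x) - s) / h], [(f'(y) - s) / h].  As [h] tends to [0] each of the last
    two stays independent of the first two. *)
Definition ddiff_gram (h : R) (G : gram) : gram := reduce4 h (reduce3 h (reduce2 h G)).

(** Determinants only see the denominators: subtracting [v1] or [v2] from the
    other vectors does not change them. *)
Lemma ddiff_gram_dets : forall h G, h <> 0 ->
  detD (ddiff_gram h G) = detD G / h ^ 2 /\
  detE1 (ddiff_gram h G) = detE1 G / h ^ 4 /\
  detE2 (ddiff_gram h G) = detE2 G / h ^ 4 /\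
  detN (ddiff_gram h G) = detN G / h ^ 4.
Proof.
  intros h G Hh. unfold detD, detE1, detE2, detN, det3, ddiff_gram; simpl.
  repeat split; field; exact Hh.
Qed.

(** Homogeneity of the density; for divided differences [a = 1 / |h|] and
    [c = 1 / h ^ 4] leave a factor [1 / |h|], the repulsion of the zeros. *)
Lemma density_scale : forall G H a c, 0 < a -> 0 < c ->
  detD H = detD G * a ^ 2 -> detE1 H = detE1 G * c -> detE2 H = detE2 G * c ->
  detN H = detN G * c -> 0 < detD G -> 0 < detE1 G -> 0 < detE2 G ->
  density H = density G * (c / a ^ 3).
Proof.
  intros G H a c Ha Hc H1 H2 H3 H4 PD P1 P2. unfold density, gram_ratio.
  rewrite H1, H2, H3, H4.
  replace (detE1 G * c * (detE2 G * c)) with (detE1 G * detE2 G * (c * c)) by ring.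
  rewrite (sqrt_mult_alt (detE1 G * detE2 G)) by nneg.
  rewrite sqrt_square by lra.
  rewrite (sqrt_mult_alt (detD G)) by lra. rewrite sqrt_pow2 by lra.
  assert (0 < sqrt (detE1 G * detE2 G)) by pos.
  assert (0 < sqrt (detD G)) by pos.
  replace (detN G * c / (sqrt (detE1 G * detE2 G) * c))
    with (detN G / sqrt (detE1 G * detE2 G)) by (field; lra).
  field. lra.
Qed.

Lemma ddiff_gram_sub : forall h G H, h <> 0 ->
  ddiff_gram h (gsub G H) = gsub (ddiff_gram h G) (ddiff_gram h H).
Proof.
  intros h G H Hh. unfold ddiff_gram, reduce4, reduce3, reduce2, gsub; simpl.
  f_equal; field; exact Hh.
Qed.

(** * Perturbation of Gram determinants *)

(** Each vector [i] has its own scale [m_i], and [K] is common to all entries. *)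
Definition gram_bounded (K m1 m2 m3 m4 B : R) (G : gram) : Prop :=
  (Rabs (g11 G) <= B * (K * (m1 * m1)) /\ Rabs (g12 G) <= B * (K * (m1 * m2)) /\
   Rabs (g22 G) <= B * (K * (m2 * m2)) /\ Rabs (g13 G) <= B * (K * (m1 * m3)) /\
   Rabs (g23 G) <= B * (K * (m2 * m3))) /\
  (Rabs (g14 G) <= B * (K * (m1 * m4)) /\ Rabs (g24 G) <= B * (K * (m2 * m4)) /\
   Rabs (g33 G) <= B * (K * (m3 * m3)) /\ Rabs (g34 G) <= B * (K * (m3 * m4)) /\
   Rabs (g44 G) <= B * (K * (m4 * m4))).

Lemma prod2_pert : forall a c a' c' B eta s t, 1 <= B -> 0 <= eta <= 1 ->
  0 < s -> 0 < t ->
  Rabs a' <= B * s -> Rabs c' <= B * t ->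
  Rabs (a - a') <= eta * s -> Rabs (c - c') <= eta * t ->
  Rabs (a * c - a' * c') <= 3 * B * eta * (s * t) /\ Rabs (a' * c') <= B * B * (s * t)
  /\ Rabs (a * c) <= 4 * (B * B) * (s * t).
Proof.
  intros a c a' c' B eta s t HB He Hs Ht Ha Hc Hda Hdc.
  assert (P1 : Rabs (a' * c') <= B * B * (s * t)).
  { rewrite Rabs_mult. replace (B * B * (s * t)) with ((B * s) * (B * t)) by ring.
    apply Rmult_le_compat; auto; apply Rabs_pos. }
  assert (P2 : Rabs (a * c - a' * c') <= 3 * B * eta * (s * t)).
  { replace (a * c - a' * c') with ((a - a') * (c - c') + (a - a') * c' + a' * (c - c')) by ring.
    eapply Rle_trans; [apply Rabs_triang|]. eapply Rle_trans;
      [apply Rplus_le_compat_r, Rabs_triang|]. rewrite !Rabs_mult.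
    assert (Rabs (a - a') * Rabs (c - c') <= (eta * s) * (eta * t))
      by (apply Rmult_le_compat; auto; apply Rabs_pos).
    assert (Rabs (a - a') * Rabs c' <= (eta * s) * (B * t))
      by (apply Rmult_le_compat; auto; apply Rabs_pos).
    assert (Rabs a' * Rabs (c - c') <= (B * s) * (eta * t))
      by (apply Rmult_le_compat; auto; apply Rabs_pos).
    assert (0 < s * t) by nra.
    assert (eta * eta * (s * t) <= B * eta * (s * t)) by (apply Rmult_le_compat_r; nra).
    lra. }
  split; [exact P2|]. split; [exact P1|].
  replace (a * c) with ((a * c - a' * c') + a' * c') by ring.
  eapply Rle_trans; [apply Rabs_triang|].
  assert (0 < s * t) by nra.
  assert (B * eta * (s * t) <= B * B * (s * t)) by (apply Rmult_le_compat_r; nra).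
  lra.
Qed.

Lemma prod3_pert : forall a c e a' c' e' B eta s t u, 1 <= B -> 0 <= eta <= 1 ->
  0 < s -> 0 < t -> 0 < u ->
  Rabs a' <= B * s -> Rabs c' <= B * t -> Rabs e' <= B * u ->
  Rabs (a - a') <= eta * s -> Rabs (c - c') <= eta * t -> Rabs (e - e') <= eta * u ->
  Rabs (a * (c * e) - a' * (c' * e')) <= 7 * (B * B) * eta * (s * (t * u)) /\
  Rabs (a' * (c' * e')) <= B * B * B * (s * (t * u)).
Proof.
  intros a c e a' c' e' B eta s t u HB He Hs Ht Hu Ha Hc Hee Hda Hdc Hde.
  destruct (prod2_pert c e c' e' B eta t u) as (Q1 & Q2 & Q3); auto.
  assert (Htu : 0 < t * u) by nra.
  assert (Hstu : 0 < s * (t * u)) by nra.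
  split.
  - replace (a * (c * e) - a' * (c' * e')) with
      ((a - a') * (c * e) + a' * (c * e - c' * e')) by ring.
    eapply Rle_trans; [apply Rabs_triang|]. rewrite !(Rabs_mult _ (_ * _)), (Rabs_mult a').
    assert (Rabs (a - a') * Rabs (c * e) <= (eta * s) * (4 * (B * B) * (t * u)))
      by (apply Rmult_le_compat; auto; apply Rabs_pos).
    assert (Rabs a' * Rabs (c * e - c' * e') <= (B * s) * (3 * B * eta * (t * u)))
      by (apply Rmult_le_compat; auto; apply Rabs_pos).
    lra.
  - rewrite Rabs_mult. replace (B * B * B * (s * (t * u))) with ((B * s) * (B * B * (t * u))) by ring.
    apply Rmult_le_compat; auto; apply Rabs_pos.
Qed.

(** Each of the six monomials is a product of three entries whose scales
    multiply to the same quantity. *)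
Lemma detN_pert : forall G H K m1 m2 m3 m4 B eta,
  1 <= B -> 0 <= eta <= 1 -> 0 < K -> 0 < m1 -> 0 < m2 -> 0 < m3 -> 0 < m4 ->
  gram_bounded K m1 m2 m3 m4 B H -> gram_bounded K m1 m2 m3 m4 eta (gsub G H) ->
  let W := K ^ 3 * (m1 ^ 2 * m2 ^ 2 * m3 * m4) in
  Rabs (detN G - detN H) <= 42 * (B * B) * eta * W /\ Rabs (detN H) <= 6 * (B * B * B) * W.
Proof.
  intros G H K m1 m2 m3 m4 B eta HB He HK H1 H2 H3 H4
    ((B11 & B12 & B22 & B13 & B23) & (B14 & B24 & _ & B34 & _))
    ((D11 & D12 & D22 & D13 & D23) & (D14 & D24 & _ & D34 & _)) W.
  assert (P : forall u v, 0 < u -> 0 < v -> 0 < K * (u * v)) by (intros; pos).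
  destruct (prod3_pert _ _ _ _ _ _ B eta _ _ _ HB He (P _ _ H3 H4) (P _ _ H1 H1) (P _ _ H2 H2)
    B34 B11 B22 D34 D11 D22) as [Q1 T1].
  destruct (prod3_pert _ _ _ _ _ _ B eta _ _ _ HB He (P _ _ H3 H4) (P _ _ H1 H2) (P _ _ H1 H2)
    B34 B12 B12 D34 D12 D12) as [Q2 T2].
  destruct (prod3_pert _ _ _ _ _ _ B eta _ _ _ HB He (P _ _ H1 H1) (P _ _ H2 H3) (P _ _ H2 H4)
    B11 B23 B24 D11 D23 D24) as [Q3 T3].
  destruct (prod3_pert _ _ _ _ _ _ B eta _ _ _ HB He (P _ _ H1 H2) (P _ _ H1 H3) (P _ _ H2 H4)
    B12 B13 B24 D12 D13 D24) as [Q4 T4].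
  destruct (prod3_pert _ _ _ _ _ _ B eta _ _ _ HB He (P _ _ H1 H2) (P _ _ H1 H4) (P _ _ H2 H3)
    B12 B14 B23 D12 D14 D23) as [Q5 T5].
  destruct (prod3_pert _ _ _ _ _ _ B eta _ _ _ HB He (P _ _ H2 H2) (P _ _ H1 H3) (P _ _ H1 H4)
    B22 B13 B14 D22 D13 D14) as [Q6 T6].
  apply Rabs_le_between in Q1, Q2, Q3, Q4, Q5, Q6, T1, T2, T3, T4, T5, T6.
  unfold W, detN, det3. split; apply Rabs_le_between; lra.
Qed.

(** Repeating vector 3, or vector 4, turns the mixed determinant into [detE1] or
    [detE2], so that a bound for [detN] serves all three. *)
Definition merge3 (G : gram) : gram := {|
  g11 := g11 G; g12 := g12 G; g22 := g22 G; g13 := g13 G; g23 := g23 G;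
  g14 := g13 G; g24 := g23 G; g33 := g33 G; g34 := g33 G; g44 := g33 G |}.

Definition merge4 (G : gram) : gram := {|
  g11 := g11 G; g12 := g12 G; g22 := g22 G; g13 := g14 G; g23 := g24 G;
  g14 := g14 G; g24 := g24 G; g33 := g44 G; g34 := g44 G; g44 := g44 G |}.

Lemma merge_bounds : forall G K m1 m2 m3 m4 B, gram_bounded K m1 m2 m3 m4 B G ->
  gram_bounded K m1 m2 m3 m3 B (merge3 G) /\ gram_bounded K m1 m2 m4 m4 B (merge4 G).
Proof.
  intros G K m1 m2 m3 m4 B ((B11 & B12 & B22 & B13 & B23) & (B14 & B24 & B33 & B34 & B44)).
  repeat split; assumption.
Qed.

(** Nondegeneracy: the determinants are as large as the scales allow. *)
Definition gram_lower (K m1 m2 m3 m4 c : R) (G : gram) : Prop :=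
  c * (K ^ 2 * (m1 ^ 2 * m2 ^ 2)) <= detD G /\
  c * (K ^ 3 * (m1 ^ 2 * m2 ^ 2 * m3 ^ 2)) <= detE1 G /\
  c * (K ^ 3 * (m1 ^ 2 * m2 ^ 2 * m4 ^ 2)) <= detE2 G.

(** The lower bounds on the determinants of [H] turn entrywise errors into
    relative errors. *)
Lemma gram_compare : forall B c, 1 <= B -> 0 < c ->
  exists C eta0, 0 < C /\ 0 < eta0 /\
  forall K m1 m2 m3 m4 G H eta,
  0 < K -> 0 < m1 -> 0 < m2 -> 0 < m3 -> 0 < m4 -> 0 <= eta <= eta0 ->
  gram_bounded K m1 m2 m3 m4 B H -> gram_bounded K m1 m2 m3 m4 eta (gsub G H) ->
  gram_lower K m1 m2 m3 m4 c H ->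
  0 < detD G /\ 0 < detE1 G /\ 0 < detE2 G /\
  exists e, Rabs e <= C * eta /\ density G = density H * (1 + e).
Proof.
  intros B c HB Hc.
  (* [det3_pert] relative to the lower bound [c]: [C1] controls the errors,
     [C2] the size of the correlation *)
  set (C1 := 42 * (B * B) / c). set (C2 := 6 * (B * B * B) / c).
  assert (HC1 : 0 < C1) by (apply Rdiv_lt_0_compat; nra).
  assert (HBB : 0 < B * B) by nra.
  assert (HC2 : 0 < C2) by (apply Rdiv_lt_0_compat; nra).
  exists ((30 + 30 * C2) * C1), (Rmin 1 (/ (8 * C1))).
  split; [pos|].
  split; [apply Rmin_glb_lt; [lra|pos]|].
  intros K m1 m2 m3 m4 G H eta HK H1 H2 H3 H4 [He0 He] HH HG (LD & L1 & L2).
  assert (He1 : eta <= 1) by (eapply Rle_trans; [exact He|apply Rmin_l]).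
  assert (He2 : eta <= / (8 * C1)) by (eapply Rle_trans; [exact He|apply Rmin_r]).
  assert (He3 : 0 <= C1 * eta <= 1 / 8).
  { split; [nra|]. apply Rle_trans with (C1 * / (8 * C1)).
    - mono.
    - right. field. lra. }
  destruct (merge_bounds _ _ _ _ _ _ _ HH) as [HH3 HH4].
  destruct (merge_bounds _ _ _ _ _ _ _ HG) as [HG3 HG4].
  assert (HE1 : 0 <= eta <= 1) by lra.
  destruct (detN_pert (merge3 G) (merge3 H) K m1 m2 m3 m3 B eta) as [PE1 _]; auto.
  destruct (detN_pert (merge4 G) (merge4 H) K m1 m2 m4 m4 B eta) as [PE2 _]; auto.
  destruct (detN_pert G H K m1 m2 m3 m4 B eta) as [PN PN']; auto.
  destruct HH as ((B11 & B12 & B22 & _) & _). destruct HG as ((D11 & D12 & D22 & _) & _).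
  assert (Pm : forall u v, 0 < u -> 0 < v -> 0 < K * (u * v)) by (intros; pos).
  assert (HB2 : B <= B * B)
    by (rewrite <- (Rmult_1_l B) at 1; mono).
  destruct (prod2_pert _ _ _ _ B eta _ _ HB HE1 (Pm m1 m1 H1 H1) (Pm m2 m2 H2 H2)
    B11 B22 D11 D22) as (PD1 & _ & _).
  destruct (prod2_pert _ _ _ _ B eta _ _ HB HE1 (Pm m1 m2 H1 H2) (Pm m1 m2 H1 H2)
    B12 B12 D12 D12) as (PD2 & _ & _).
  change (detN (merge3 G)) with (detE1 G) in PE1. change (detN (merge3 H)) with (detE1 H) in PE1.
  change (detN (merge4 G)) with (detE2 G) in PE2. change (detN (merge4 H)) with (detE2 H) in PE2.
  set (WD := K ^ 2 * (m1 ^ 2 * m2 ^ 2)) in *.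
  set (W1 := K ^ 3 * (m1 ^ 2 * m2 ^ 2 * m3 ^ 2)) in *.
  set (W2 := K ^ 3 * (m1 ^ 2 * m2 ^ 2 * m4 ^ 2)) in *.
  set (WN := K ^ 3 * (m1 ^ 2 * m2 ^ 2 * m3 * m4)) in *.
  replace (K ^ 3 * (m1 ^ 2 * m2 ^ 2 * m3 * m3)) with W1 in PE1 by (unfold W1; ring).
  replace (K ^ 3 * (m1 ^ 2 * m2 ^ 2 * m4 * m4)) with W2 in PE2 by (unfold W2; ring).
  replace (K * (m1 * m1) * (K * (m2 * m2))) with WD in PD1 by (unfold WD; ring).
  replace (K * (m1 * m2) * (K * (m1 * m2))) with WD in PD2 by (unfold WD; ring).
  assert (QD : Rabs (detD G - detD H) <= 42 * (B * B) * eta * WD).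
  { unfold detD.
    replace (g11 G * g22 G - g12 G * g12 G - (g11 H * g22 H - g12 H * g12 H)) with
      ((g11 G * g22 G - g11 H * g22 H) - (g12 G * g12 G - g12 H * g12 H)) by ring.
    eapply Rle_trans; [apply Rabs_triang|]. rewrite Rabs_Ropp.
    assert (0 <= eta * WD) by (unfold WD; apply Rmult_le_pos; [lra|];
      repeat apply Rmult_le_pos; try nneg).
    apply Rle_trans with (6 * B * (eta * WD)); [lra|].
    replace (42 * (B * B) * eta * WD) with (42 * (B * B) * (eta * WD)) by ring.
    mono. }
  assert (PWD : 0 < WD) by (unfold WD; pos).
  assert (PW1 : 0 < W1) by (unfold W1; pos).
  assert (PW2 : 0 < W2) by (unfold W2; pos).
  assert (PWN : 0 < WN) by (unfold WN; pos).
  assert (REL : forall W X, c * W <= X -> 42 * (B * B) * eta * W <= C1 * eta * X).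
  { intros W X HX. replace (42 * (B * B) * eta * W) with (C1 * eta * (c * W))
      by (unfold C1; field; lra). mono. }
  assert (SQ : c * WN <= sqrt (detE1 H * detE2 H)).
  { rewrite <- (sqrt_square (c * WN)) by nneg.
    apply sqrt_le_1_alt.
    replace (c * WN * (c * WN)) with ((c * W1) * (c * W2)) by (unfold WN, W1, W2; ring).
    apply Rmult_le_compat; try assumption; nneg. }
  assert (PD : 0 < detD H)
    by (eapply Rlt_le_trans; [|exact LD]; pos).
  assert (P1 : 0 < detE1 H)
    by (eapply Rlt_le_trans; [|exact L1]; pos).
  assert (P2 : 0 < detE2 H)
    by (eapply Rlt_le_trans; [|exact L2]; pos).
  destruct (density_pert (detD H) (detE1 H) (detE2 H) (detN H)
    (detD G) (detE1 G) (detE2 G) (detN G) C2 (C1 * eta)) as (R1 & R2 & R3 & e & He' & E);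
    try lra.
  - eapply Rle_trans; [exact QD|]. apply REL; exact LD.
  - eapply Rle_trans; [exact PE1|]. apply REL; exact L1.
  - eapply Rle_trans; [exact PE2|]. apply REL; exact L2.
  - eapply Rle_trans; [exact PN'|].
    replace (6 * (B * B * B) * WN) with (C2 * (c * WN)) by (unfold C2; field; lra).
    mono.
  - eapply Rle_trans; [exact PN|]. apply REL; exact SQ.
  - split; [exact R1|]. split; [exact R2|]. split; [exact R3|].
    exists e. split; [lra|exact E].
Qed.

(** * Decorrelation of Gram determinants *)

(** The Gram determinants of [f(x), f'(x)] and of [f(y), f'(y)], which give the
    one-point densities. *)
Definition point_det1 (G : gram) : R := g11 G * g33 G - g13 G ^ 2.
Definition point_det2 (G : gram) : R := g22 G * g44 G - g24 G ^ 2.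

Lemma prod3_bound : forall u v w a b d B s t r, 0 <= B -> 0 <= a -> 0 <= b -> 0 <= d ->
  0 < s -> 0 < t -> 0 < r ->
  Rabs u <= B * a * s -> Rabs v <= B * b * t -> Rabs w <= B * d * r ->
  Rabs (u * v * w) <= B ^ 3 * (a * b * d) * (s * t * r).
Proof.
  intros u v w a b d B s t r HB Ha Hb Hd Hs Ht Hr Hu Hv Hw. rewrite !Rabs_mult.
  replace (B ^ 3 * (a * b * d) * (s * t * r)) with (B * a * s * (B * b * t) * (B * d * r)) by ring.
  repeat apply Rmult_le_compat; auto; nneg.
Qed.

(** In the determinant of a conditional variance every term but the leading one
    contains at least two entries linking the two points. *)
Lemma det3_diag_decorrelate : forall d11 d22 d12 d13 d23 d33 B z s1 s2 s3,
  0 <= B -> 0 <= z -> 0 < s1 -> 0 < s2 -> 0 < s3 ->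
  Rabs d11 <= B * (s1 * s1) -> Rabs d13 <= B * (s1 * s3) -> Rabs d33 <= B * (s3 * s3) ->
  Rabs d12 <= B * z * (s1 * s2) -> Rabs d23 <= B * z * (s2 * s3) ->
  Rabs (det3 d11 d12 d22 d13 d23 d13 d23 d33 - d22 * (d11 * d33 - d13 ^ 2))
    <= 4 * (B ^ 3 * z ^ 2 * (s1 * s2 * s3) ^ 2).
Proof.
  intros d11 d22 d12 d13 d23 d33 B z s1 s2 s3 HB Hz H1 H2 H3 B11 B13 B33 B12 B23.
  assert (O : forall u s, Rabs u <= B * s -> Rabs u <= B * 1 * s) by (intros; lra).
  assert (T1 := prod3_bound d33 d12 d12 1 z z B (s3 * s3) (s1 * s2) (s1 * s2)
    HB Rle_0_1 Hz Hz ltac:(pos) ltac:(pos) ltac:(pos) (O _ _ B33) B12 B12).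
  assert (T2 := prod3_bound d11 d23 d23 1 z z B (s1 * s1) (s2 * s3) (s2 * s3)
    HB Rle_0_1 Hz Hz ltac:(pos) ltac:(pos) ltac:(pos) (O _ _ B11) B23 B23).
  assert (T3 := prod3_bound d12 d13 d23 z 1 z B (s1 * s2) (s1 * s3) (s2 * s3)
    HB Hz Rle_0_1 Hz ltac:(pos) ltac:(pos) ltac:(pos) B12 (O _ _ B13) B23).
  assert (W : 0 <= B ^ 3 * z ^ 2 * (s1 * s2 * s3) ^ 2) by nneg.
  apply Rabs_le_between in T1, T2, T3. unfold det3. apply Rabs_le_between. lra.
Qed.

(** In that of the conditional covariance every term contains at least one. *)
Lemma detN_decorrelate : forall G B z m1 m2 m3 m4,
  0 <= B -> 0 <= z <= 1 -> 0 < m1 -> 0 < m2 -> 0 < m3 -> 0 < m4 ->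
  gram_bounded 1 m1 m2 m3 m4 B G ->
  Rabs (g12 G) <= B * z * (m1 * m2) -> Rabs (g23 G) <= B * z * (m2 * m3) ->
  Rabs (g14 G) <= B * z * (m1 * m4) -> Rabs (g34 G) <= B * z * (m3 * m4) ->
  Rabs (detN G) <= 6 * (B ^ 3 * z * (m1 * m1 * (m2 * m2) * (m3 * m4))).
Proof.
  intros G B z m1 m2 m3 m4 HB [Hz Hz1] H1 H2 H3 H4
    ((B11 & B12 & B22 & B13 & _) & (B14 & B24 & _)) Z12 Z23 Z14 Z34.
  rewrite Rmult_1_l in B11, B12, B22, B13, B14, B24.
  assert (O : forall u s, Rabs u <= B * s -> Rabs u <= B * 1 * s) by (intros; lra).
  assert (Q1 := prod3_bound (g34 G) (g11 G) (g22 G) z 1 1 B (m3 * m4) (m1 * m1) (m2 * m2)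
    HB Hz Rle_0_1 Rle_0_1 ltac:(pos) ltac:(pos) ltac:(pos) Z34 (O _ _ B11) (O _ _ B22)).
  assert (Q2 := prod3_bound (g34 G) (g12 G) (g12 G) z 1 1 B (m3 * m4) (m1 * m2) (m1 * m2)
    HB Hz Rle_0_1 Rle_0_1 ltac:(pos) ltac:(pos) ltac:(pos) Z34 (O _ _ B12) (O _ _ B12)).
  assert (Q3 := prod3_bound (g23 G) (g11 G) (g24 G) z 1 1 B (m2 * m3) (m1 * m1) (m2 * m4)
    HB Hz Rle_0_1 Rle_0_1 ltac:(pos) ltac:(pos) ltac:(pos) Z23 (O _ _ B11) (O _ _ B24)).
  assert (Q4 := prod3_bound (g12 G) (g13 G) (g24 G) z 1 1 B (m1 * m2) (m1 * m3) (m2 * m4)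
    HB Hz Rle_0_1 Rle_0_1 ltac:(pos) ltac:(pos) ltac:(pos) Z12 (O _ _ B13) (O _ _ B24)).
  assert (Q5 := prod3_bound (g23 G) (g12 G) (g14 G) z 1 1 B (m2 * m3) (m1 * m2) (m1 * m4)
    HB Hz Rle_0_1 Rle_0_1 ltac:(pos) ltac:(pos) ltac:(pos) Z23 (O _ _ B12) (O _ _ B14)).
  assert (Q6 := prod3_bound (g14 G) (g22 G) (g13 G) z 1 1 B (m1 * m4) (m2 * m2) (m1 * m3)
    HB Hz Rle_0_1 Rle_0_1 ltac:(pos) ltac:(pos) ltac:(pos) Z14 (O _ _ B22) (O _ _ B13)).
  apply Rabs_le_between in Q1, Q2, Q3, Q4, Q5, Q6.
  unfold detN, det3. apply Rabs_le_between. lra.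
Qed.

(** The factor [z] carried by the entries linking the two points enters the
    variances squared and the covariance once; as [arcsin_factor] is even, the
    density only sees [z ^ 2]. *)
Lemma gram_decorrelate : forall B c, 1 <= B -> 0 < c ->
  exists C z0, 0 < C /\ 0 < z0 /\
  forall m1 m2 m3 m4 G z,
  0 < m1 -> 0 < m2 -> 0 < m3 -> 0 < m4 -> 0 <= z <= z0 ->
  gram_bounded 1 m1 m2 m3 m4 B G ->
  Rabs (g12 G) <= B * z * (m1 * m2) -> Rabs (g23 G) <= B * z * (m2 * m3) ->
  Rabs (g14 G) <= B * z * (m1 * m4) -> Rabs (g34 G) <= B * z * (m3 * m4) ->
  c * (m1 * m1) <= g11 G -> c * (m2 * m2) <= g22 G ->
  c * (m1 ^ 2 * m3 ^ 2) <= point_det1 G -> c * (m2 ^ 2 * m4 ^ 2) <= point_det2 G ->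
  0 < detD G /\ 0 < detE1 G /\ 0 < detE2 G /\
  exists e, Rabs e <= C * z ^ 2 /\
   density G = sqrt (point_det1 G * point_det2 G) / (g11 G * g22 G) * (1 + e).
Proof.
  intros B c HB Hc.
  set (C1 := 4 * B ^ 3 / c ^ 2).
  assert (HB3 : 1 <= B ^ 3) by (apply pow_R1_Rle; lra).
  assert (Hc2 : 0 < c ^ 2) by pos.
  assert (HC1 : 0 < C1) by (unfold C1; pos).
  exists (10 * C1 + 60 * C1 ^ 2), (Rmin 1 (/ (8 * C1))).
  split; [pose proof (pow2_ge_0 C1); lra|]. split; [pos|].
  intros m1 m2 m3 m4 G z H1 H2 H3 H4 [Hz0 Hz] HG Z12 Z23 Z14 Z34 L1 L2 LF1 LF2.
  assert (Hz1 : z <= 1) by (eapply Rle_trans; [exact Hz|apply Rmin_l]).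
  assert (Hz2 : z <= / (8 * C1)) by (eapply Rle_trans; [exact Hz|apply Rmin_r]).
  assert (EN := detN_decorrelate G B z m1 m2 m3 m4 ltac:(lra) (conj Hz0 Hz1) H1 H2 H3 H4
    HG Z12 Z23 Z14 Z34).
  destruct HG as ((B11 & _ & B22 & B13 & _) & (_ & B24 & B33 & _ & B44)).
  rewrite Rmult_1_l in B11, B22, B13, B24, B33, B44.
  assert (Hzz : 0 <= z ^ 2 <= z) by (split; [nneg|];
    assert (0 <= z * (1 - z)) by nneg; lra).
  assert (Heta : 0 <= C1 * z ^ 2 <= 1 / 8).
  { split; [nneg|]. apply Rle_trans with (C1 * / (8 * C1)).
    - mono.
    - right. field. lra. }
  set (F1 := point_det1 G) in *. set (F2 := point_det2 G) in *. set (D0 := g11 G * g22 G).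
  set (WN := m1 * m1 * (m2 * m2) * (m3 * m4)) in *.
  assert (PWN : 0 < WN) by (unfold WN; pos).
  assert (P11 : 0 < c * (m1 * m1)) by pos. assert (P22 : 0 < c * (m2 * m2)) by pos.
  assert (PF1 : 0 < c * (m1 ^ 2 * m3 ^ 2)) by pos.
  assert (PF2 : 0 < c * (m2 ^ 2 * m4 ^ 2)) by pos.
  assert (LD : c ^ 2 * (m1 * m2) ^ 2 <= D0).
  { unfold D0. replace (c ^ 2 * (m1 * m2) ^ 2) with (c * (m1 * m1) * (c * (m2 * m2))) by ring.
    mono. }
  assert (LE1 : c ^ 2 * (m1 * m2 * m3) ^ 2 <= g22 G * F1).
  { replace (c ^ 2 * (m1 * m2 * m3) ^ 2) with (c * (m2 * m2) * (c * (m1 ^ 2 * m3 ^ 2))) by ring.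
    mono. }
  assert (LE2 : c ^ 2 * (m2 * m1 * m4) ^ 2 <= g11 G * F2).
  { replace (c ^ 2 * (m2 * m1 * m4) ^ 2) with (c * (m1 * m1) * (c * (m2 ^ 2 * m4 ^ 2))) by ring.
    mono. }
  assert (REL : forall W X, c ^ 2 * W <= X -> 4 * (B ^ 3 * z ^ 2 * W) <= C1 * z ^ 2 * X).
  { intros W X HX. replace (4 * (B ^ 3 * z ^ 2 * W)) with (C1 * z ^ 2 * (c ^ 2 * W))
      by (unfold C1; field; lra). mono. }
  assert (ED : Rabs (detD G - D0) <= C1 * z ^ 2 * D0).
  { eapply Rle_trans; [|apply REL; exact LD].
    unfold detD, D0. replace (g11 G * g22 G - g12 G * g12 G - g11 G * g22 G)
      with (- (g12 G * g12 G)) by ring.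
    rewrite Rabs_Ropp, Rabs_mult.
    apply Rle_trans with ((B * z * (m1 * m2)) * (B * z * (m1 * m2))).
    - apply Rmult_le_compat; auto; apply Rabs_pos.
    - replace (B * z * (m1 * m2) * (B * z * (m1 * m2))) with (B ^ 2 * (z ^ 2 * (m1 * m2) ^ 2)) by ring.
      replace (4 * (B ^ 3 * z ^ 2 * (m1 * m2) ^ 2)) with (4 * B ^ 3 * (z ^ 2 * (m1 * m2) ^ 2)) by ring.
      apply Rmult_le_compat_r; [nneg|].
      assert (B ^ 2 <= B ^ 3) by (apply Rle_pow; [lra|lia]). lra. }
  assert (EE1 : Rabs (detE1 G - g22 G * F1) <= C1 * z ^ 2 * (g22 G * F1)).
  { eapply Rle_trans; [|apply REL; exact LE1]. unfold F1, point_det1, detE1.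
    apply det3_diag_decorrelate; auto; lra. }
  assert (EE2 : Rabs (detE2 G - g11 G * F2) <= C1 * z ^ 2 * (g11 G * F2)).
  { eapply Rle_trans; [|apply REL; exact LE2]. unfold F2, point_det2.
    replace (detE2 G) with (det3 (g22 G) (g12 G) (g11 G) (g24 G) (g14 G) (g24 G) (g14 G) (g44 G))
      by (unfold detE2, det3; ring).
    apply det3_diag_decorrelate; auto; lra. }
  assert (PD0 : 0 < D0) by (eapply Rlt_le_trans; [|exact LD]; pos).
  assert (PE10 : 0 < g22 G * F1) by (eapply Rlt_le_trans; [|exact LE1]; pos).
  assert (PE20 : 0 < g11 G * F2) by (eapply Rlt_le_trans; [|exact LE2]; pos).
  assert (SQ : c ^ 2 * WN <= sqrt (g22 G * F1 * (g11 G * F2))).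
  { rewrite <- (sqrt_square (c ^ 2 * WN)) by nneg.
    apply sqrt_le_1_alt.
    replace (c ^ 2 * WN * (c ^ 2 * WN)) with
      ((c ^ 2 * (m1 * m2 * m3) ^ 2) * (c ^ 2 * (m2 * m1 * m4) ^ 2)) by (unfold WN; ring).
    apply Rmult_le_compat; try assumption; nneg. }
  destruct (relative_form _ _ _ PD0 ED) as [d [Ed Hd]].
  destruct (relative_form _ _ _ PE10 EE1) as [e1 [Ee1 He1]].
  destruct (relative_form _ _ _ PE20 EE2) as [e2 [Ee2 He2]].
  destruct (gram_ratio_pert D0 _ _ d e1 e2 (C1 * z ^ 2) PD0 PE10 PE20)
    as (w & e & HS & Hw & HQ & Hee); auto.
  rewrite <- Ee1, <- Ee2 in HS. rewrite <- Ed, <- Ee1, <- Ee2 in HQ.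
  apply Rabs_le_between in Hd, He1, He2, Hw.
  split; [rewrite Ed; pos|]. split; [rewrite Ee1; pos|]. split; [rewrite Ee2; pos|].
  set (sq := sqrt (g22 G * F1 * (g11 G * F2))) in *.
  assert (Psq : 0 < sq) by (eapply Rlt_le_trans; [|exact SQ]; pos).
  set (dl := detN G / sqrt (detE1 G * detE2 G)).
  assert (Hdl : Rabs dl <= 5 / 2 * C1 * z).
  { unfold dl. rewrite HS. assert (Hp : 0 < sq * (1 + w)) by pos.
    rewrite Rabs_div_pos by lra. apply div_le; [lra|]. eapply Rle_trans; [exact EN|].
    apply Rle_trans with (5 / 2 * C1 * z * (c ^ 2 * WN * (5 / 8))).
    - replace (5 / 2 * C1 * z * (c ^ 2 * WN * (5 / 8))) with ((25 / 4) * (B ^ 3 * z * WN))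
        by (unfold C1; field; lra).
      apply Rmult_le_compat_r; [nneg|lra].
    - apply Rmult_le_compat_l; [nneg|]. apply Rmult_le_compat; try lra. nneg. }
  assert (Hg : Rabs (arcsin_factor dl - 1) <= 25 * C1 ^ 2 * z ^ 2).
  { eapply Rle_trans; [apply arcsin_factor_quad|].
    apply Rle_trans with (4 * (5 / 2 * C1 * z) ^ 2); [|right; field].
    apply Rmult_le_compat_l; [lra|]. rewrite <- (pow2_abs dl).
    apply pow_incr. split; [apply Rabs_pos|exact Hdl]. }
  exists ((arcsin_factor dl - 1) * (1 + e) + e). split.
  - eapply Rle_trans; [apply Rabs_triang|]. rewrite Rabs_mult.
    assert (Rabs (1 + e) <= 9 / 4).
    { apply Rabs_le_between in Hee. apply Rabs_le_between. lra. }
    assert (Rabs (arcsin_factor dl - 1) * Rabs (1 + e) <= 25 * C1 ^ 2 * z ^ 2 * (9 / 4))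
      by (apply Rmult_le_compat; auto; apply Rabs_pos).
    assert (0 <= C1 ^ 2 * z ^ 2) by nneg. lra.
  - unfold density. fold dl. rewrite HQ.
    assert (EQ : gram_ratio D0 (g22 G * F1) (g11 G * F2) = sqrt (F1 * F2) / D0).
    { unfold gram_ratio. replace (g22 G * F1 * (g11 G * F2)) with (D0 * (F1 * F2)) by (unfold D0; ring).
      rewrite sqrt_mult_alt by lra.
      assert (0 < sqrt D0) by pos. field. lra. }
    rewrite EQ. fold D0. ring.
Qed.

(** * Conditional variance and covariance of the limiting process *)

Lemma Rpower_pos : forall u b, 0 < Rpower u b.
Proof. intros. apply exp_pos. Qed.

Lemma is_derive_Rpower_l : forall b u : R, 0 < u ->
  is_derive (fun v : R => Rpower v b) u (b * (Rpower u b / u)).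
Proof. intros b u Hu. unfold Rpower. auto_derive; [lra|]. field. lra. Qed.

Lemma Rpower_1_l : forall b, Rpower 1 b = 1.
Proof. intros. unfold Rpower. rewrite ln_1, Rmult_0_r. apply exp_0. Qed.

Lemma ln_nonpos : forall u, 0 < u <= 1 -> ln u <= 0.
Proof. intros u Hu. rewrite <- ln_1. apply ln_le; lra. Qed.

Lemma Rpower_le1 : forall u b, 0 < u <= 1 -> 0 <= b -> Rpower u b <= 1.
Proof.
  intros u b Hu Hb. unfold Rpower. rewrite <- exp_0.
  pose proof (ln_nonpos u Hu).
  assert (b * ln u <= 0) by (rewrite <- (Rmult_0_r b); mono).
  destruct H0 as [H0|H0]; [left; apply exp_increasing; exact H0|rewrite H0; lra].
Qed.

Lemma Rpower_antitone_exp : forall u b c, 0 < u <= 1 -> b <= c -> Rpower u c <= Rpower u b.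
Proof.
  intros u b c Hu Hbc. replace c with (b + (c - b)) by ring. rewrite Rpower_plus.
  pose proof (Rpower_pos u b). pose proof (Rpower_le1 u (c - b) Hu ltac:(lra)).
  rewrite <- (Rmult_1_r (Rpower u b)) at 2. mono.
Qed.

Lemma Rpower_mono_base : forall u v b, 0 < u <= v -> 0 <= b -> Rpower u b <= Rpower v b.
Proof. intros u v b Huv Hb. apply Rle_Rpower_l; lra. Qed.

Lemma mvt_to_1 : forall (f df : R -> R) u, 0 < u < 1 ->
  (forall v, u <= v <= 1 -> is_derive f v (df v)) ->
  exists c, u <= c <= 1 /\ f 1 - f u = df c * (1 - u).
Proof.
  intros f df u Hu H.
  destruct (MVT_gen f u 1 df) as [c [Hc E]].
  - intros v Hv. rewrite Rmin_left, Rmax_right in Hv by lra. apply H; lra.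
  - intros v Hv. rewrite Rmin_left, Rmax_right in Hv by lra.
    apply continuity_pt_filterlim, (ex_derive_continuous f). exists (df v). apply H; lra.
  - rewrite Rmin_left, Rmax_right in Hc by lra. exists c; auto.
Qed.

Lemma one_minus_Rpower_lower : forall b, 0 < b -> exists c, 0 < c /\
  forall u, 0 < u <= 1 -> c * (1 - u) <= 1 - Rpower u b.
Proof.
  intros b Hb. exists (Rmin 1 b). split; [pos|]. intros u Hu.
  destruct (Req_dec u 1) as [->|Hu1]; [rewrite Rpower_1_l; lra|].
  destruct (Rle_dec 1 b) as [Hb1|Hb1].
  - rewrite Rmin_left by lra.
    pose proof (Rpower_antitone_exp u 1 b Hu Hb1) as H. rewrite Rpower_1 in H by lra. lra.
  - rewrite Rmin_right by lra.
    destruct (mvt_to_1 (fun v => Rpower v b) (fun v => b * (Rpower v b / v)) u) as [v [Hv E]].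
    + lra.
    + intros v Hv. apply is_derive_Rpower_l; lra.
    + rewrite Rpower_1_l in E. rewrite E. apply Rmult_le_compat_r; [lra|].
      rewrite <- (Rmult_1_r b) at 1. apply Rmult_le_compat_l; [lra|].
      apply Rmult_le_reg_r with v; [lra|]. unfold Rdiv. rewrite Rmult_assoc, Rinv_l by lra.
      pose proof (Rpower_antitone_exp v b 1 ltac:(lra) ltac:(lra)) as H.
      rewrite Rpower_1 in H by lra. lra.
Qed.

(** The shape of [detE1] and [detE2] for the limiting kernel, as a function of
    [alpha]; divided by [1 - u ^ b] it is that of a conditional variance. *)
Definition cond_var (b u : R) : R := 1 - Rpower u b - b * (1 - u) * Rpower u b.
(** The shape of [detN], up to a further factor [alpha ^ (b / 2)]. *)
Definition cond_cov (b u : R) : R := u * (1 - Rpower u b) - b * (1 - u).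

Lemma cond_var_derive : forall b u : R, 0 < u ->
  is_derive (cond_var b) u (- (b * (b + 1) * (Rpower u b / u) * (1 - u))).
Proof.
  intros b u Hu. unfold cond_var.
  assert (D := is_derive_Rpower_l b u Hu).
  assert (Ex : ex_derive (fun v : R => Rpower v b) u) by (eexists; exact D).
  apply is_derive_unique in D.
  auto_derive; [auto|]. rewrite D.
  match goal with |- ?a = ?b => change (@eq R a b) end.
  field. lra.
Qed.

Lemma cond_cov_derive : forall b u : R, 0 < u ->
  is_derive (cond_cov b) u ((1 + b) * (1 - Rpower u b)).
Proof.
  intros b u Hu. unfold cond_cov.
  assert (D := is_derive_Rpower_l b u Hu).
  assert (Ex : ex_derive (fun v : R => Rpower v b) u) by (eexists; exact D).
  apply is_derive_unique in D.
  auto_derive; [auto|]. rewrite D.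
  match goal with |- ?a = ?b => change (@eq R a b) end.
  field. lra.
Qed.

Lemma cond_var_1 : forall b, cond_var b 1 = 0.
Proof. intros. unfold cond_var. rewrite Rpower_1_l. ring. Qed.

Lemma cond_cov_1 : forall b, cond_cov b 1 = 0.
Proof. intros. unfold cond_cov. rewrite Rpower_1_l. ring. Qed.

Lemma half_Rpower : forall b v, 0 < b -> 1 / 2 <= v <= 1 ->
  Rpower (1 / 2) b <= Rpower v b / v <= 2.
Proof.
  intros b v Hb Hv.
  pose proof (Rpower_mono_base (1 / 2) v b ltac:(lra) ltac:(lra)).
  pose proof (Rpower_le1 v b ltac:(lra) ltac:(lra)).
  pose proof (Rpower_pos v b).
  assert (1 <= / v) by (rewrite <- Rinv_1; apply Rinv_le_contravar; lra).
  assert (/ v <= 2) by (replace 2 with (/ (1 / 2)) by field; apply Rinv_le_contravar; lra).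
  unfold Rdiv. split.
  - eapply Rle_trans; [exact H|]. rewrite <- (Rmult_1_r (Rpower v b)) at 1.
    mono.
  - replace 2 with (1 * 2) by ring. mono.
Qed.

(** The derivative of [cond_var] is [- b (b + 1) u ^ (b - 1) (1 - u)], so the
    function decreases to a zero of order exactly two at [1].  Near [1] this is
    compared with the derivative of [k (1 - u) ^ 2]; below [1 / 2] monotonicity
    is enough. *)
Lemma cond_var_lower : forall b, 0 < b -> exists c, 0 < c /\
  forall u, 0 < u <= 1 -> c * (1 - u) ^ 2 <= cond_var b u.
Proof.
  intros b Hb.
  (* half a lower bound of [b (b + 1) u ^ (b - 1)] over [1/2 <= u <= 1], where
     [u ^ (b - 1) >= u ^ b] *)
  set (k := b * (b + 1) * Rpower (1 / 2) b / 2).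
  pose proof (Rpower_pos (1 / 2) b) as HP.
  assert (Hbb : 0 < b * (b + 1)) by pos.
  assert (Hk : 0 < k) by (unfold k; apply Rdiv_lt_0_compat; [apply Rmult_lt_0_compat|]; lra).
  assert (near : forall u, 1 / 2 <= u <= 1 -> k * (1 - u) ^ 2 <= cond_var b u).
  { intros u Hu. destruct (Req_dec u 1) as [->|Hu1]; [rewrite cond_var_1; simpl; lra|].
    destruct (mvt_to_1 (fun v => cond_var b v - k * (1 - v) ^ 2)
      (fun v => - (b * (b + 1) * (Rpower v b / v) * (1 - v)) + 2 * k * (1 - v)) u)
      as [v [Hv E]].
    - lra.
    - intros v Hv. assert (D := cond_var_derive b v ltac:(lra)).
      assert (Ex : ex_derive (cond_var b) v) by (eexists; exact D).
      apply is_derive_unique in D. auto_derive; [auto|].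
      change (Derive (fun x : R => cond_var b x)) with (Derive (cond_var b)).
      rewrite D. match goal with |- ?a = ?b => change (@eq R a b) end. ring.
    - rewrite cond_var_1 in E. destruct (half_Rpower b v Hb ltac:(lra)) as [HL _].
      assert (0 <= b * (b + 1) * (Rpower v b / v - Rpower (1 / 2) b) * (1 - v)).
      { apply Rmult_le_pos; [|lra]. nneg. }
      replace (2 * k) with (b * (b + 1) * Rpower (1 / 2) b) in E by (unfold k; field).
      assert ((- (b * (b + 1) * (Rpower v b / v) * (1 - v)) +
        b * (b + 1) * Rpower (1 / 2) b * (1 - v)) * (1 - u) <= 0).
      { assert (0 <= (b * (b + 1) * (Rpower v b / v - Rpower (1 / 2) b) * (1 - v)) * (1 - u))
          by nneg. lra. }
      lra. }
  exists (k / 4). split; [lra|]. intros u Hu.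
  destruct (Rle_dec (1 / 2) u) as [H|H].
  - eapply Rle_trans; [|apply near; lra]. apply Rmult_le_compat_r; [apply pow2_ge_0|lra].
  - destruct (MVT_gen (cond_var b) u (1 / 2) (fun v => - (b * (b + 1) * (Rpower v b / v) * (1 - v))))
      as [v [Hv E]].
    + intros v Hv. rewrite Rmin_left in Hv by lra. apply cond_var_derive; lra.
    + intros v Hv. rewrite Rmin_left in Hv by lra.
      apply continuity_pt_filterlim, (ex_derive_continuous (cond_var b)).
      eexists. apply cond_var_derive; lra.
    + rewrite Rmin_left, Rmax_right in Hv by lra.
      pose proof (near (1 / 2) ltac:(lra)) as HN.
      assert (0 <= b * (b + 1) * (Rpower v b / v) * (1 - v) * (1 / 2 - u)).
      { pose proof (Rpower_pos v b).
        assert (0 < Rpower v b / v) by pos.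
        apply Rmult_le_pos; [apply Rmult_le_pos; [apply Rmult_le_pos|]|]; lra. }
      assert ((1 - u) ^ 2 <= 1).
      { nra. }
      apply Rle_trans with (k / 4 * 1); [mono|]. lra.
Qed.

(** Both functions vanish at [1] and so do their derivatives. *)
Lemma cond_var_cov_near_1 : forall b, 0 < b -> exists C, 0 < C /\
  forall u, 1 / 2 <= u <= 1 ->
   Rabs (cond_var b u) <= C * (1 - u) ^ 2 /\ Rabs (cond_cov b u) <= C * (1 - u) ^ 2.
Proof.
  intros b Hb. exists (2 * (b * (b + 1))).
  split; [assert (0 < b * (b + 1)) by pos; lra|].
  assert (Hbb : 0 < b * (b + 1)) by pos.
  assert (P : forall u, 1 / 2 <= u <= 1 -> 0 <= 1 - Rpower u b <= 2 * b * (1 - u)).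
  { intros u Hu. split; [pose proof (Rpower_le1 u b ltac:(lra) ltac:(lra)); lra|].
    destruct (Req_dec u 1) as [->|Hu1]; [rewrite Rpower_1_l; lra|].
    destruct (mvt_to_1 (fun v => Rpower v b) (fun v => b * (Rpower v b / v)) u) as [v [Hv E]].
    - lra.
    - intros v Hv. apply is_derive_Rpower_l; lra.
    - rewrite Rpower_1_l in E. rewrite E.
      destruct (half_Rpower b v Hb ltac:(lra)) as [_ HU].
      apply Rmult_le_compat_r; [lra|].
      rewrite (Rmult_comm 2). mono. }
  intros u Hu. destruct (Req_dec u 1) as [->|Hu1].
  { rewrite cond_var_1, cond_cov_1, Rabs_R0. split; lra. }
  assert (Q : forall f df, f 1 = 0 -> (forall v, u <= v <= 1 -> is_derive f v (df v)) ->
    (forall v, u <= v <= 1 -> Rabs (df v) <= 2 * (b * (b + 1)) * (1 - v)) ->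
    Rabs (f u) <= 2 * (b * (b + 1)) * (1 - u) ^ 2).
  { intros f df F1 FD FB. destruct (mvt_to_1 f df u ltac:(lra) FD) as [v [Hv E]].
    rewrite F1 in E. replace (f u) with (- (df v * (1 - u))) by lra.
    rewrite Rabs_Ropp, Rabs_mult, (Rabs_right (1 - u)) by lra.
    replace ((1 - u) ^ 2) with ((1 - u) * (1 - u)) by ring. rewrite <- Rmult_assoc.
    apply Rmult_le_compat_r; [lra|]. eapply Rle_trans; [apply FB; lra|].
    mono. }
  split.
  - apply (Q (cond_var b) _ (cond_var_1 b) (fun v Hv => cond_var_derive b v ltac:(lra))).
    intros v Hv. destruct (half_Rpower b v Hb ltac:(lra)) as [_ HU].
    pose proof (Rpower_pos v b).
    assert (0 < Rpower v b / v) by pos.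
    rewrite Rabs_Ropp, Rabs_right
     by (apply Rle_ge, Rmult_le_pos; [apply Rmult_le_pos|]; lra).
    apply Rmult_le_compat_r; [lra|]. rewrite (Rmult_comm 2). mono.
  - apply (Q (cond_cov b) _ (cond_cov_1 b) (fun v Hv => cond_cov_derive b v ltac:(lra))).
    intros v Hv. destruct (P v ltac:(lra)) as [P1 P2].
    rewrite Rabs_right by (apply Rle_ge; nneg).
    replace (2 * (b * (b + 1)) * (1 - v)) with ((1 + b) * (2 * b * (1 - v))) by ring.
    mono.
Qed.

(** * The limiting two-point density *)

(** The Gram matrix of the limiting kernel [(1 - x y) ^ (- b)]. *)
Definition binG (b x y : R) : gram :=
  kernel_gram (binK b) (fun t => b * binK b t / (1 - t))
    (fun t => b * (b + 1) * binK b t / (1 - t) ^ 2) x y.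

Lemma alpha_mul : forall x y, alpha x y = (1 - x * x) * (1 - y * y) / (1 - x * y) ^ 2.
Proof. intros. unfold alpha. f_equal. ring. Qed.

Lemma prod_in_01 : forall x y, 1 / 2 <= x < 1 -> 1 / 2 <= y < 1 -> 0 < x * y < 1.
Proof. intros. split; nra. Qed.

Lemma one_minus_alpha : forall x y, 1 - x * y <> 0 -> 1 - alpha x y = (y - x) ^ 2 / (1 - x * y) ^ 2.
Proof. intros. rewrite alpha_mul. field. lra. Qed.

Lemma alpha_range : forall x y, 1 / 2 <= x < 1 -> 1 / 2 <= y < 1 -> 0 < alpha x y <= 1.
Proof.
  intros x y Hx Hy. pose proof (prod_in_01 x y Hx Hy). pose proof (prod_in_01 x x Hx Hx).
  pose proof (prod_in_01 y y Hy Hy). split.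
  - rewrite alpha_mul. apply Rdiv_lt_0_compat; [pos|pos].
  - pose proof (one_minus_alpha x y ltac:(lra)) as E.
    assert (0 <= (y - x) ^ 2 / (1 - x * y) ^ 2)
      by (apply Rmult_le_pos; [apply pow2_ge_0|apply Rlt_le, Rinv_0_lt_compat, pow_lt; lra]).
    lra.
Qed.

Lemma alpha_lt1 : forall x y, 1 / 2 <= x < 1 -> 1 / 2 <= y < 1 -> x <> y -> alpha x y < 1.
Proof.
  intros x y Hx Hy Hxy. pose proof (prod_in_01 x y Hx Hy).
  pose proof (one_minus_alpha x y ltac:(lra)) as E.
  assert (0 < (y - x) ^ 2 / (1 - x * y) ^ 2)
    by (apply Rdiv_lt_0_compat; [apply pow2_gt_0|apply pow_lt]; lra).
  lra.
Qed.

(** The squared correlation of the limiting process is [alpha ^ b]. *)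
Lemma binK_cross : forall b x y, 1 / 2 <= x < 1 -> 1 / 2 <= y < 1 ->
  binK b (x * y) * binK b (x * y) = binK b (x * x) * binK b (y * y) * Rpower (alpha x y) b.
Proof.
  intros b x y Hx Hy. pose proof (prod_in_01 x y Hx Hy). pose proof (prod_in_01 x x Hx Hx).
  pose proof (prod_in_01 y y Hy Hy). unfold binK, Rpower. rewrite <- !exp_plus. f_equal.
  rewrite alpha_mul, ln_div, ln_mult, ln_pow; try lra.
  - simpl. ring.
  - pos.
  - pos.
Qed.

(** Apart from the scale factors of the two points, the determinants are
    functions of [alpha] alone: rational identities once [alpha ^ b] is written
    through the kernel by [binK_cross]. *)
Lemma binG_dets : forall b x y, 1 / 2 <= x < 1 -> 1 / 2 <= y < 1 ->
  let al := alpha x y in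
  let a := binK b (x * x) in let c := binK b (y * y) in
  detD (binG b x y) = a * c * (1 - Rpower al b) /\
  detE1 (binG b x y) = b * a * (a * c) / (1 - x * x) ^ 2 * cond_var b al /\
  detE2 (binG b x y) = b * c * (a * c) / (1 - y * y) ^ 2 * cond_var b al /\
  detN (binG b x y) = b * binK b (x * y) * (a * c) / ((1 - x * x) * (1 - y * y)) * cond_cov b al.
Proof.
  intros b x y Hx Hy al a c.
  pose proof (prod_in_01 x y Hx Hy). pose proof (prod_in_01 x x Hx Hx).
  pose proof (prod_in_01 y y Hy Hy).
  assert (E := binK_cross b x y Hx Hy). fold a c al in E.
  assert (Pa : 0 < a) by apply binK_pos. assert (Pc : 0 < c) by apply binK_pos.
  assert (EA : Rpower al b = binK b (x * y) * binK b (x * y) / (a * c))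
    by (rewrite E; field; lra).
  unfold cond_var, cond_cov. rewrite EA. unfold al. rewrite alpha_mul.
  unfold detD, detE1, detE2, detN, det3, binG; simpl. fold a c.
  set (m := binK b (x * y)).
  repeat split; field; repeat split; lra.
Qed.

(** [cond_cov / cond_var] is [Delta] up to the factor [alpha ^ (b / 2)], and
    [cond_var / (1 - alpha ^ b) ^ (3/2)] is [Sigma]. *)
Lemma binG_density : forall tau x y, - (1 / 2) < tau ->
  1 / 2 <= x < 1 -> 1 / 2 <= y < 1 -> x <> y ->
  density (binG (2 * tau + 1) x y)
  = (2 * tau + 1) * ((1 + f_formula tau (alpha x y)) / ((1 - x ^ 2) * (1 - y ^ 2))).
Proof.
  intros tau x y Ht Hx Hy Hxy.
  set (b := 2 * tau + 1). assert (Hb : 0 < b) by (unfold b; lra).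
  destruct (binG_dets b x y Hx Hy) as (ED & E1 & E2 & EN).
  pose proof (prod_in_01 x y Hx Hy). pose proof (prod_in_01 x x Hx Hx).
  pose proof (prod_in_01 y y Hy Hy).
  pose proof (alpha_range x y Hx Hy) as [Ha0 _]. pose proof (alpha_lt1 x y Hx Hy Hxy) as Ha1.
  assert (EC := binK_cross b x y Hx Hy).
  unfold f_formula, density.
  set (al := alpha x y) in *. set (a := binK b (x * x)) in *. set (c := binK b (y * y)) in *.
  assert (Pa : 0 < a) by apply binK_pos. assert (Pc : 0 < c) by apply binK_pos.
  assert (Pac : 0 < a * c) by pos.
  destruct (one_minus_Rpower_lower b Hb) as [k1 [Hk1 L1]].
  destruct (cond_var_lower b Hb) as [k2 [Hk2 L2]].
  assert (PP : 0 < 1 - Rpower al b).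
  { eapply Rlt_le_trans; [|apply L1; lra]. pos. }
  assert (PS : 0 < cond_var b al).
  { eapply Rlt_le_trans; [|apply L2; lra]. apply Rmult_lt_0_compat; [lra|pos]. }
  assert (Sac : 0 < sqrt (a * c)) by pos.
  assert (SS : sqrt (a * c) * sqrt (a * c) = a * c) by (apply sqrt_sqrt; lra).
  assert (Ppq : 0 < (1 - x * x) * (1 - y * y)) by pos.
  set (r := Rpower al (tau + 1 / 2)).
  assert (Er : binK b (x * y) = sqrt (a * c) * r).
  { rewrite <- (sqrt_square (binK b (x * y))) by (apply Rlt_le, binK_pos).
    rewrite EC, sqrt_mult_alt by lra. f_equal.
    replace (Rpower al b) with (r * r).
    - apply sqrt_square. apply Rlt_le, Rpower_pos.
    - unfold r. rewrite <- Rpower_plus. f_equal. unfold b. field. }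
  assert (ES : sqrt (detE1 (binG b x y) * detE2 (binG b x y))
     = b * (a * c) * sqrt (a * c) * cond_var b al / ((1 - x * x) * (1 - y * y))).
  { rewrite E1, E2.
    match goal with |- _ = ?v => set (V := v) end.
    rewrite <- (sqrt_square V).
    - f_equal. unfold V.
      replace (b * (a * c) * sqrt (a * c) * cond_var b al / ((1 - x * x) * (1 - y * y)) *
        (b * (a * c) * sqrt (a * c) * cond_var b al / ((1 - x * x) * (1 - y * y))))
       with ((b * (a * c)) ^ 2 * (sqrt (a * c) * sqrt (a * c)) * cond_var b al ^ 2
         / ((1 - x * x) * (1 - y * y)) ^ 2) by (field; lra).
      rewrite SS. field. lra.
    - unfold V. apply Rlt_le, Rdiv_lt_0_compat; [|lra].
      pos. }
  rewrite ES, ED, EN, Er.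
  assert (EDel : b * (sqrt (a * c) * r) * (a * c) / ((1 - x * x) * (1 - y * y)) * cond_cov b al /
   (b * (a * c) * sqrt (a * c) * cond_var b al / ((1 - x * x) * (1 - y * y))) = Defs.Delta tau al).
  { unfold Defs.Delta. fold b. fold r.
    replace (1 - Rpower al b - b * Rpower al b * (1 - al)) with (cond_var b al) by (unfold cond_var; ring).
    fold (cond_cov b al). field. repeat split; lra. }
  rewrite EDel.
  change (sqrt (1 - Defs.Delta tau al ^ 2) + Defs.Delta tau al * asin (Defs.Delta tau al)) with (arcsin_factor (Defs.Delta tau al)).
  replace (1 + (arcsin_factor (Defs.Delta tau al) * Sigma tau al - 1)) with (arcsin_factor (Defs.Delta tau al) * Sigma tau al) by ring.
  assert (EQ : gram_ratio (a * c * (1 - Rpower al b)) (detE1 (binG b x y)) (detE2 (binG b x y)) =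
    b * Sigma tau al / ((1 - x ^ 2) * (1 - y ^ 2))).
  { unfold gram_ratio. rewrite ES. unfold Sigma. fold b. fold (cond_var b al).
    replace (Rpower (1 - Rpower al b) (3 / 2))
      with ((1 - Rpower al b) * sqrt (1 - Rpower al b)).
    - rewrite (sqrt_mult_alt (a * c)) by lra.
      assert (0 < sqrt (1 - Rpower al b)) by pos.
      replace (1 - x ^ 2) with (1 - x * x) by ring. replace (1 - y ^ 2) with (1 - y * y) by ring.
      field. repeat split; lra.
    - rewrite <- (Rpower_sqrt (1 - Rpower al b)) by lra.
      rewrite <- (Rpower_1 (1 - Rpower al b)) at 1 by lra. rewrite <- Rpower_plus.
      f_equal. field. }
  rewrite EQ.
  replace (1 - x ^ 2) with (1 - x * x) by ring. replace (1 - y ^ 2) with (1 - y * y) by ring.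
  field. lra.
Qed.

(** Repulsion: [Sigma] is of order [(1 - u) ^ 2 / (1 - u) ^ (3/2)], while [Delta]
    stays bounded. *)
Lemma f_formula_near_1 : forall tau, - (1 / 2) < tau -> exists C, 0 < C /\
  forall u, 1 / 2 <= u < 1 -> Rabs (1 + f_formula tau u) <= C * sqrt (1 - u).
Proof.
  intros tau Ht. set (b := 2 * tau + 1). assert (Hb : 0 < b) by (unfold b; lra).
  destruct (one_minus_Rpower_lower b Hb) as [k1 [Hk1 L1]].
  destruct (cond_var_lower b Hb) as [k2 [Hk2 L2]].
  destruct (cond_var_cov_near_1 b Hb) as [C [HC U]].
  set (Q := 2 * C / k2).
  assert (HQ : 0 < Q) by (unfold Q; pos).
  exists ((1 + Q) * C / (k1 * sqrt k1)).
  assert (Hsk : 0 < sqrt k1) by pos.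
  assert (Hkk : 0 < k1 * sqrt k1) by pos.
  split; [apply Rdiv_lt_0_compat; [pos|lra]|].
  intros u Hu. destruct (U u ltac:(lra)) as [US UW].
  specialize (L1 u ltac:(lra)). specialize (L2 u ltac:(lra)).
  assert (H1u : 0 < (1 - u) ^ 2) by pos.
  assert (PS : 0 < cond_var b u) by (eapply Rlt_le_trans; [|exact L2]; pos).
  rewrite Rabs_right in US by lra.
  unfold f_formula. fold (arcsin_factor (Defs.Delta tau u)).
  replace (1 + (arcsin_factor (Defs.Delta tau u) * Sigma tau u - 1)) with (arcsin_factor (Defs.Delta tau u) * Sigma tau u) by ring.
  rewrite Rabs_mult.
  assert (HD : Rabs (Defs.Delta tau u) <= C / k2).
  { unfold Defs.Delta. fold b. fold (cond_cov b u).
    replace (1 - Rpower u b - b * Rpower u b * (1 - u)) with (cond_var b u) by (unfold cond_var; ring).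
    rewrite Rabs_mult. rewrite Rabs_right by (apply Rle_ge, Rlt_le, Rpower_pos).
    assert (Rpower u (tau + 1 / 2) <= 1) by (apply Rpower_le1; lra).
    assert (Rabs (cond_cov b u / cond_var b u) <= C / k2).
    { rewrite Rabs_div_pos by lra. apply div_le; [lra|].
      eapply Rle_trans; [exact UW|].
      apply Rle_trans with (C * / k2 * (k2 * (1 - u) ^ 2)); [right; field; lra|].
      apply Rmult_le_compat_l; [|lra]. nneg. }
    rewrite <- (Rmult_1_l (C / k2)). apply Rmult_le_compat; auto.
    - apply Rlt_le, Rpower_pos.
    - apply Rabs_pos. }
  assert (HG : Rabs (arcsin_factor (Defs.Delta tau u)) <= 1 + Q).
  { pose proof (arcsin_factor_lip 0 (Defs.Delta tau u)) as HL. rewrite arcsin_factor_0, Rminus_0_r in HL.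
    replace (arcsin_factor (Defs.Delta tau u)) with (1 + (arcsin_factor (Defs.Delta tau u) - 1)) by ring.
    eapply Rle_trans; [apply Rabs_triang|]. rewrite Rabs_R1.
    replace Q with (2 * (C / k2)) by (unfold Q; field; lra). lra. }
  assert (HS : Rabs (Sigma tau u) <= C / (k1 * sqrt k1) * sqrt (1 - u)).
  { unfold Sigma. fold b. fold (cond_var b u).
    assert (HP : 0 < k1 * (1 - u)) by pos.
    assert (HR : k1 * (1 - u) * sqrt (k1 * (1 - u)) <= Rpower (1 - Rpower u b) (3 / 2)).
    { rewrite <- (Rpower_sqrt (k1 * (1 - u))) by lra.
      rewrite <- (Rpower_1 (k1 * (1 - u))) at 1 by lra. rewrite <- Rpower_plus.
      replace (1 + / 2) with (3 / 2) by field. apply Rpower_mono_base; lra. }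
    assert (Hsu : 0 < sqrt (1 - u)) by pos.
    assert (SS : sqrt (1 - u) * sqrt (1 - u) = 1 - u) by (apply sqrt_sqrt; lra).
    rewrite sqrt_mult_alt in HR by lra.
    rewrite Rabs_right by (apply Rle_ge, Rlt_le, Rdiv_lt_0_compat; [lra|apply Rpower_pos]).
    pose proof (Rpower_pos (1 - Rpower u b) (3 / 2)) as HRP.
    apply Rmult_le_reg_r with (Rpower (1 - Rpower u b) (3 / 2)); [lra|].
    unfold Rdiv at 1. rewrite Rmult_assoc, Rinv_l, Rmult_1_r by lra.
    eapply Rle_trans; [exact US|].
    apply Rle_trans with (C / (k1 * sqrt k1) * sqrt (1 - u) * (k1 * (1 - u) * (sqrt k1 * sqrt (1 - u)))).
    - right. replace (C / (k1 * sqrt k1) * sqrt (1 - u) * (k1 * (1 - u) * (sqrt k1 * sqrt (1 - u))))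
       with (C * (1 - u) * (sqrt (1 - u) * sqrt (1 - u))) by (field; lra).
      rewrite SS. ring.
    - apply Rmult_le_compat_l; [|exact HR].
      apply Rmult_le_pos; [|lra]. nneg. }
  apply Rle_trans with ((1 + Q) * (C / (k1 * sqrt k1) * sqrt (1 - u))).
  - apply Rmult_le_compat; auto; apply Rabs_pos.
  - right. field. lra.
Qed.

(** * Gram entries controlled by moments of the weights *)

Lemma kernel_gram_of : forall (w : nat -> R) (K K1 K2 : R -> R) (x y : R),
  (forall t, t = x * x \/ t = x * y \/ t = y * y ->
    is_series (fun j => w j * t ^ j) (K t) /\
    is_series (fun j => w j * dpow t j) (K1 t) /\
    is_series (fun j => w j * ddpow t j) (K2 t)) ->
  gram_of w (fun j => x ^ j) (fun j => y ^ j) (dpow x) (dpow y)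
    (kernel_gram K K1 K2 x y).
Proof.
  intros w K K1 K2 x y H.
  assert (P0 : forall a c, is_series (fun j => w j * (a * c) ^ j) (K (a * c)) ->
    ip w (fun j => a ^ j) (fun j => c ^ j) (K (a * c))).
  { intros a c HS. unfold ip. eapply is_series_ext_R; [|exact HS].
    intros j. simpl. rewrite Rpow_mult_distr. ring. }
  assert (P1 : forall a c, is_series (fun j => w j * dpow (a * c) j) (K1 (a * c)) ->
    ip w (fun j => a ^ j) (dpow c) (a * K1 (a * c))).
  { intros a c HS. unfold ip. eapply is_series_ext_R; [|apply is_series_scal_R; exact HS].
    intros j. unfold dpow. destruct j as [|j]; [simpl; ring|].
    simpl pred. rewrite Rpow_mult_distr. simpl. ring. }
  assert (P2 : forall a c, is_series (fun j => w j * dpow (a * c) j) (K1 (a * c)) ->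
    is_series (fun j => w j * ddpow (a * c) j) (K2 (a * c)) ->
    ip w (dpow a) (dpow c) (K1 (a * c) + a * c * K2 (a * c))).
  { intros a c HS HS2. unfold ip.
    eapply is_series_ext_R; [|exact (is_series_plus _ _ _ _ HS
      (is_series_scal_R (a * c) _ _ HS2))].
    intros j. unfold dpow, ddpow, plus; simpl.
    destruct j as [|[|j]].
    - simpl; ring.
    - simpl; ring.
    - simpl pred. rewrite !Rpow_mult_distr. rewrite (S_INR (S j)). simpl pow. ring. }
  destruct (H (x * x)) as (A0 & A1 & A2); [auto|].
  destruct (H (x * y)) as (B0 & B1 & B2); [auto|].
  destruct (H (y * y)) as (C0 & C1 & C2); [auto|].
  split; simpl; auto.
  rewrite (Rmult_comm x y) in *. auto.
Qed.

Lemma binG_gram_of : forall b x y, 0 < b -> 1 / 2 <= x < 1 -> 1 / 2 <= y < 1 ->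
  gram_of (binc b) (fun j => x ^ j) (fun j => y ^ j) (dpow x) (dpow y) (binG b x y).
Proof.
  intros b x y Hb Hx Hy. apply kernel_gram_of.
  pose proof (prod_in_01 x y Hx Hy). pose proof (prod_in_01 x x Hx Hx).
  pose proof (prod_in_01 y y Hy Hy).
  intros t Ht. assert (0 <= t < 1) by (destruct Ht as [->|[->| ->]]; lra).
  split; [apply binc_series; auto|]. split; [apply binc_series1; auto|apply binc_series2; auto].
Qed.

Lemma ip_bound : forall b w a c l A1 A2 s1 s2 x y theta,
  0 <= A1 -> 0 <= A2 -> 0 <= x -> 0 <= y -> (s1 + s2 <= 4)%nat ->
  moment_bound b theta (x * y) w -> ip w a c l ->
  (forall j, Rabs (a j) <= A1 * (INR j ^ s1 * x ^ j)) ->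
  (forall j, Rabs (c j) <= A2 * (INR j ^ s2 * y ^ j)) ->
  Rabs l <= A1 * A2 * theta * (binK b (x * y) * (/ (1 - x * y)) ^ (s1 + s2)).
Proof.
  intros b w a c l A1 A2 s1 s2 x y theta HA1 HA2 Hx Hy Hs HM Hip Ha Hc.
  destruct (HM (s1 + s2)%nat Hs) as (l' & Hl' & Hle).
  destruct (is_series_dom (fun j => Rabs (w j * a j * c j))
    (fun j => A1 * A2 * (Rabs (w j) * INR j ^ (s1 + s2) * (x * y) ^ j)) (A1 * A2 * l'))
    as (la & Hla & Hla0 & Hla1).
  - intros j. split; [apply Rabs_pos|]. rewrite !Rabs_mult.
    replace (A1 * A2 * (Rabs (w j) * INR j ^ (s1 + s2) * (x * y) ^ j)) with
      (Rabs (w j) * (A1 * (INR j ^ s1 * x ^ j)) * (A2 * (INR j ^ s2 * y ^ j)))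
      by (rewrite pow_add, Rpow_mult_distr; ring).
    pose proof (Rabs_pos (w j)). pose proof (Rabs_pos (a j)). pose proof (Rabs_pos (c j)).
    apply Rmult_le_compat; auto; [apply Rmult_le_pos; auto|].
    apply Rmult_le_compat_l; auto.
  - apply is_series_scal_R. exact Hl'.
  - unfold ip in Hip. rewrite <- (is_series_unique _ _ Hip).
    eapply Rle_trans; [apply Series_Rabs; exists la; exact Hla|].
    cbv beta. rewrite (is_series_unique _ _ Hla).
    eapply Rle_trans; [exact Hla1|]. rewrite (Rmult_assoc (A1 * A2)).
    apply Rmult_le_compat_l; [apply Rmult_le_pos; auto|exact Hle].
Qed.

Lemma pow_vec_bound : forall x j, 0 <= x -> Rabs (x ^ j) <= 1 * (INR j ^ 0 * x ^ j).
Proof.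
  intros x j Hx. rewrite Rabs_right by (apply Rle_ge, pow_le; auto). simpl. lra.
Qed.

Lemma dpow_vec_bound : forall x j, 1 / 2 <= x -> Rabs (dpow x j) <= 2 * (INR j ^ 1 * x ^ j).
Proof.
  intros x j Hx. unfold dpow. pose proof (pos_INR j) as HJ.
  rewrite Rabs_right by (apply Rle_ge, Rmult_le_pos; [auto|nneg]).
  rewrite pow_1. destruct j as [|j]; [simpl; lra|].
  simpl pred. simpl pow.
  assert (0 <= x ^ j) by nneg.
  assert (0 <= INR (S j) * x ^ j) by (apply Rmult_le_pos; auto).
  replace (2 * (INR (S j) * (x * x ^ j))) with (INR (S j) * x ^ j * (2 * x)) by ring.
  rewrite <- (Rmult_1_r (INR (S j) * x ^ j)) at 1. mono.
Qed.

(** * Divided differences of powers *)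

Definition slope (x y : R) : nat -> R :=
  ddiff (y - x) (fun j => y ^ j) (fun j => x ^ j).

Lemma slope_succ : forall x y j, x <> y -> slope x y (S j) = y * slope x y j + x ^ j.
Proof. intros x y j H. unfold slope, ddiff. simpl. field. lra. Qed.

Lemma dpow_succ : forall x j, dpow x (S j) = x * dpow x j + x ^ j.
Proof.
  intros x j. unfold dpow. rewrite S_INR. simpl pred.
  destruct j as [|j]; [simpl; ring|]. simpl. ring.
Qed.

Lemma ddiff_x_succ : forall x y j, x <> y ->
  ddiff (y - x) (dpow x) (slope x y) (S j)
  = x * ddiff (y - x) (dpow x) (slope x y) j - slope x y j.
Proof.
  intros x y j H. unfold ddiff at 1 2. rewrite dpow_succ, slope_succ by auto. field. lra.
Qed.

Lemma ddiff_y_succ : forall x y j, x <> y ->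
  ddiff (y - x) (dpow y) (slope x y) (S j)
  = y * ddiff (y - x) (dpow y) (slope x y) j + slope x y j.
Proof.
  intros x y j H.
  assert (E : slope x y (S j) = x * slope x y j + y ^ j)
    by (unfold slope, ddiff; simpl; field; lra).
  unfold ddiff at 1 2. rewrite dpow_succ, E. field. lra.
Qed.

(** The bound [j z ^ (j - 1)] on a divided difference, multiplied by [z] to avoid
    truncated exponents; the same is done with [z ^ 2] for second differences. *)
Lemma slope_bound : forall x y z j, 0 <= x <= z -> 0 <= y <= z -> x <> y ->
  z * Rabs (slope x y j) <= INR j * z ^ j.
Proof.
  intros x y z j Hx Hy Hxy. induction j as [|j IH].
  - unfold slope, ddiff. simpl. replace ((1 - 1) / (y - x)) with 0 by (field; lra).
    rewrite Rabs_R0. lra.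
  - rewrite slope_succ by auto. rewrite S_INR.
    apply Rle_trans with (z * (y * Rabs (slope x y j) + x ^ j)).
    + apply Rmult_le_compat_l; [lra|]. eapply Rle_trans; [apply Rabs_triang|].
      rewrite Rabs_mult, (Rabs_right y) by lra.
      rewrite (Rabs_right (x ^ j)) by (apply Rle_ge, pow_le; lra). lra.
    + assert (y * (z * Rabs (slope x y j)) <= z * (INR j * z ^ j)).
      { apply Rmult_le_compat; try lra. apply Rmult_le_pos; [lra|apply Rabs_pos]. }
      assert (x ^ j <= z ^ j) by (apply pow_incr; lra).
      assert (z * x ^ j <= z * z ^ j) by mono.
      simpl. lra.
Qed.

(** [j ^ 2 + j <= (j + 1) ^ 2] is what lets the bound pass through the
    recurrences [ddiff_x_succ] and [ddiff_y_succ]. *)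
Lemma ddiff_bound_step : forall q q' s u z j, 0 <= u <= z ->
  z * z * Rabs q <= INR j ^ 2 * z ^ j -> z * Rabs s <= INR j * z ^ j ->
  Rabs q' <= u * Rabs q + Rabs s ->
  z * z * Rabs q' <= INR (S j) ^ 2 * z ^ S j.
Proof.
  intros q q' s u z j Hu Hq Hs Hq'. rewrite S_INR. pose proof (pos_INR j).
  pose proof (Rabs_pos q). pose proof (Rabs_pos s).
  assert (Hz : 0 <= z ^ j) by nneg.
  apply Rle_trans with (z * z * (u * Rabs q + Rabs s)).
  - apply Rmult_le_compat_l; [nneg|exact Hq'].
  - assert (u * (z * z * Rabs q) <= z * (INR j ^ 2 * z ^ j)).
    { apply Rmult_le_compat; try lra. apply Rmult_le_pos; [nneg|lra]. }
    assert (z * (z * Rabs s) <= z * (INR j * z ^ j)) by mono.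
    assert (0 <= (INR j + 1) * (z * z ^ j)) by nneg.
    simpl in *. lra.
Qed.

Lemma ddiff_x_bound : forall x y z j, 0 <= x <= z -> 0 <= y <= z -> x <> y ->
  z * z * Rabs (ddiff (y - x) (dpow x) (slope x y) j) <= INR j ^ 2 * z ^ j.
Proof.
  intros x y z j Hx Hy Hxy. induction j as [|j IH].
  - unfold ddiff, slope, ddiff, dpow. simpl.
    replace ((0 * 1 - (1 - 1) / (y - x)) / (y - x)) with 0 by (field; lra).
    rewrite Rabs_R0. lra.
  - apply ddiff_bound_step with (ddiff (y - x) (dpow x) (slope x y) j) (slope x y j) x; auto.
    + apply slope_bound; auto.
    + rewrite ddiff_x_succ by auto. eapply Rle_trans; [apply Rabs_triang|].
      rewrite Rabs_Ropp, Rabs_mult, (Rabs_right x) by lra. lra.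
Qed.

Lemma ddiff_y_bound : forall x y z j, 0 <= x <= z -> 0 <= y <= z -> x <> y ->
  z * z * Rabs (ddiff (y - x) (dpow y) (slope x y) j) <= INR j ^ 2 * z ^ j.
Proof.
  intros x y z j Hx Hy Hxy. induction j as [|j IH].
  - unfold ddiff, slope, ddiff, dpow. simpl.
    replace ((0 * 1 - (1 - 1) / (y - x)) / (y - x)) with 0 by (field; lra).
    rewrite Rabs_R0. lra.
  - apply ddiff_bound_step with (ddiff (y - x) (dpow y) (slope x y) j) (slope x y j) y; auto.
    + apply slope_bound; auto.
    + rewrite ddiff_y_succ by auto. eapply Rle_trans; [apply Rabs_triang|].
      rewrite Rabs_mult, (Rabs_right y) by lra. lra.
Qed.

(** * Entry bounds for close and for distant points *)

(** All four vectors are dominated by [z ^ j] with [z] the larger point, up to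
    the powers 0, 1, 2, 2 of [j]; each power of [j] costs a factor
    [1 / (1 - z ^ 2)]. *)
Lemma near_bounds : forall b x y z theta w G, 1 / 2 <= x <= z -> 1 / 2 <= y <= z -> z < 1 ->
  x <> y -> 0 <= theta -> moment_bound b theta (z * z) w ->
  gram_of w (fun j => x ^ j) (fun j => y ^ j) (dpow x) (dpow y) G ->
  let P := 1 - z * z in
  gram_bounded (binK b (z * z)) 1 (/ P) (/ P ^ 2) (/ P ^ 2) (16 * theta) (ddiff_gram (y - x) G).
Proof.
  intros b x y z theta w G Hx Hy Hz Hxy Hth HM HG P.
  apply (gram_of_reduce2 _ _ _ _ _ _ (y - x)) in HG.
  apply (gram_of_reduce3 _ _ _ _ _ _ (y - x)) in HG.
  apply (gram_of_reduce4 _ _ _ _ _ _ (y - x)) in HG.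
  fold (ddiff_gram (y - x) G) in HG. fold (slope x y) in HG.
  assert (HP : 0 < P) by (unfold P; nra).
  set (q1 := ddiff (y - x) (dpow x) (slope x y)) in *.
  set (q2 := ddiff (y - x) (dpow y) (slope x y)) in *.
  assert (V0 : forall j, Rabs (x ^ j) <= 1 * (INR j ^ 0 * z ^ j)).
  { intros j. eapply Rle_trans; [apply pow_vec_bound; lra|]. simpl.
    assert (x ^ j <= z ^ j) by (apply pow_incr; lra). lra. }
  assert (V1 : forall j, Rabs (slope x y j) <= 2 * (INR j ^ 1 * z ^ j)).
  { intros j. rewrite pow_1. apply Rmult_le_reg_l with z; [lra|].
    eapply Rle_trans; [apply slope_bound; auto; lra|].
    assert (0 <= INR j * z ^ j) by (apply Rmult_le_pos; [apply pos_INR|nneg]).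
    assert (0 <= (2 * z - 1) * (INR j * z ^ j)) by nneg. lra. }
  assert (V2 : forall q, (forall j, z * z * Rabs (q j) <= INR j ^ 2 * z ^ j) ->
     forall j, Rabs (q j) <= 4 * (INR j ^ 2 * z ^ j)).
  { intros q Hq j. assert (1 / 4 <= z * z) by nra.
    apply Rmult_le_reg_l with (z * z); [lra|].
    eapply Rle_trans; [apply Hq|].
    assert (0 <= INR j ^ 2 * z ^ j) by (apply Rmult_le_pos; apply pow_le; [apply pos_INR|lra]).
    assert (0 <= (4 * (z * z) - 1) * (INR j ^ 2 * z ^ j)) by nneg. lra. }
  assert (V21 : forall j, Rabs (q1 j) <= 4 * (INR j ^ 2 * z ^ j)).
  { apply V2. intros j. apply ddiff_x_bound; auto; lra. }
  assert (V22 : forall j, Rabs (q2 j) <= 4 * (INR j ^ 2 * z ^ j)).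
  { apply V2. intros j. apply ddiff_y_bound; auto; lra. }
  assert (W : forall a c l A1 A2 s1 s2 m1 m2, 0 <= A1 <= 4 -> 0 <= A2 <= 4 ->
    (s1 + s2 <= 4)%nat -> ip w a c l ->
    (forall j, Rabs (a j) <= A1 * (INR j ^ s1 * z ^ j)) ->
    (forall j, Rabs (c j) <= A2 * (INR j ^ s2 * z ^ j)) ->
    m1 = (/ P) ^ s1 -> m2 = (/ P) ^ s2 ->
    Rabs l <= 16 * theta * (binK b (z * z) * (m1 * m2))).
  { intros a c l A1 A2 s1 s2 m1 m2 HA1 HA2 Hs Hip Ha Hc -> ->.
    eapply Rle_trans; [apply (ip_bound b w a c l A1 A2 s1 s2 z z theta); auto; lra|].
    fold P. rewrite <- pow_add.
    pose proof (binK_pos b (z * z)).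
    assert (0 < (/ P) ^ (s1 + s2)) by (apply pow_lt, Rinv_0_lt_compat; lra).
    apply Rmult_le_compat_r; [nneg|].
    apply Rmult_le_compat_r; [lra|]. replace 16 with (4 * 4) by ring.
    mono. }
  assert (I0 : 1 = (/ P) ^ 0) by reflexivity.
  assert (I1 : / P = (/ P) ^ 1) by (rewrite pow_1; reflexivity).
  assert (I2 : / P ^ 2 = (/ P) ^ 2) by (field; lra).
  destruct HG.
  split; repeat split;
   first [ eapply (W _ _ _ 1 1 0%nat 0%nat); eauto; try lra; lia
         | eapply (W _ _ _ 1 2 0%nat 1%nat); eauto; try lra; lia
         | eapply (W _ _ _ 2 2 1%nat 1%nat); eauto; try lra; lia
         | eapply (W _ _ _ 1 4 0%nat 2%nat); eauto; try lra; lia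
         | eapply (W _ _ _ 2 4 1%nat 2%nat); eauto; try lra; lia
         | eapply (W _ _ _ 4 4 2%nat 2%nat); eauto; try lra; lia ].
Qed.

(** Entries linking the two points are governed by the kernel at [x y], which
    is the geometric mean of the kernels at [x ^ 2] and [y ^ 2] times
    [alpha ^ (b / 2)]. *)
Lemma far_bounds : forall b x y theta w G, 0 < b -> 1 / 2 <= x < 1 -> 1 / 2 <= y < 1 ->
  0 <= theta -> moment_bound b theta (x * x) w -> moment_bound b theta (x * y) w ->
  moment_bound b theta (y * y) w ->
  gram_of w (fun j => x ^ j) (fun j => y ^ j) (dpow x) (dpow y) G ->
  let m1 := sqrt (binK b (x * x)) in let m2 := sqrt (binK b (y * y)) in
  let m3 := m1 / (1 - x * x) in let m4 := m2 / (1 - y * y) in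
  let z := Rpower (alpha x y) (b / 2) in
  gram_bounded 1 m1 m2 m3 m4 (4 * theta) G /\
  Rabs (g12 G) <= 4 * theta * z * (m1 * m2) /\ Rabs (g23 G) <= 4 * theta * z * (m2 * m3) /\
  Rabs (g14 G) <= 4 * theta * z * (m1 * m4) /\ Rabs (g34 G) <= 4 * theta * z * (m3 * m4).
Proof.
  intros b x y theta w G Hb Hx Hy Hth Mxx Mxy Myy HG m1 m2 m3 m4 z.
  pose proof (prod_in_01 x y Hx Hy). pose proof (prod_in_01 x x Hx Hx).
  pose proof (prod_in_01 y y Hy Hy).
  pose proof (alpha_range x y Hx Hy) as Hal.
  assert (Hz : 0 < z <= 1) by (split; [apply Rpower_pos|apply Rpower_le1; lra]).
  assert (Hm1 : 0 < m1) by (apply sqrt_lt_R0, binK_pos).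
  assert (Hm2 : 0 < m2) by (apply sqrt_lt_R0, binK_pos).
  assert (Em1 : binK b (x * x) = m1 * m1) by (symmetry; apply sqrt_sqrt, Rlt_le, binK_pos).
  assert (Em2 : binK b (y * y) = m2 * m2) by (symmetry; apply sqrt_sqrt, Rlt_le, binK_pos).
  assert (Em12 : binK b (x * y) = m1 * m2 * z).
  { rewrite <- (sqrt_square (binK b (x * y))) by (apply Rlt_le, binK_pos).
    rewrite binK_cross by auto. rewrite Em1, Em2.
    assert (Ez : Rpower (alpha x y) b = z * z)
      by (unfold z; rewrite <- Rpower_plus; f_equal; field).
    rewrite Ez. replace (m1 * m1 * (m2 * m2) * (z * z)) with ((m1 * m2 * z) * (m1 * m2 * z)) by ring.
    apply sqrt_square. nneg. }
  set (p := 1 - x * x) in *. set (q := 1 - y * y) in *. set (m := 1 - x * y).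
  assert (Hp : 0 < p) by (unfold p; lra). assert (Hq : 0 < q) by (unfold q; lra).
  assert (Hm : 0 < m) by (unfold m; lra).
  assert (Ip : / m <= 2 * / p).
  { replace (2 * / p) with (/ (p / 2)) by (field; lra). apply Rinv_le_contravar; [lra|].
    unfold p, m. nra. }
  assert (Iq : / m <= 2 * / q).
  { replace (2 * / q) with (/ (q / 2)) by (field; lra). apply Rinv_le_contravar; [lra|].
    unfold q, m. nra. }
  assert (Ipq : (/ m) ^ 2 <= / p * / q).
  { replace ((/ m) ^ 2) with (/ (m * m)) by (field; lra). rewrite <- Rinv_mult.
    apply Rinv_le_contravar; [pos|]. unfold p, q, m.
    pose proof (pow2_ge_0 (x - y)). nra. }
  assert (ipp : 0 < / p) by pos.
  assert (iqp : 0 < / q) by pos.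
  assert (imp : 0 < / m) by pos.
  assert (PX : forall j, Rabs (x ^ j) <= 1 * (INR j ^ 0 * x ^ j)) by (intros; apply pow_vec_bound; lra).
  assert (PY : forall j, Rabs (y ^ j) <= 1 * (INR j ^ 0 * y ^ j)) by (intros; apply pow_vec_bound; lra).
  assert (DX : forall j, Rabs (dpow x j) <= 2 * (INR j ^ 1 * x ^ j)) by (intros; apply dpow_vec_bound; lra).
  assert (DY : forall j, Rabs (dpow y j) <= 2 * (INR j ^ 1 * y ^ j)) by (intros; apply dpow_vec_bound; lra).
  assert (Myx : moment_bound b theta (y * x) w) by (rewrite (Rmult_comm y x); exact Mxy).
  destruct HG as [G11 G12 G22 G13 G23 G14 G24 G33 G34 G44].
  assert (Q11 := ip_bound b w _ _ _ 1 1 0 0 x x theta ltac:(lra) ltac:(lra) ltac:(lra) ltac:(lra) ltac:(lia) Mxx G11 PX PX).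
  assert (Q22 := ip_bound b w _ _ _ 1 1 0 0 y y theta ltac:(lra) ltac:(lra) ltac:(lra) ltac:(lra) ltac:(lia) Myy G22 PY PY).
  assert (Q12 := ip_bound b w _ _ _ 1 1 0 0 x y theta ltac:(lra) ltac:(lra) ltac:(lra) ltac:(lra) ltac:(lia) Mxy G12 PX PY).
  assert (Q13 := ip_bound b w _ _ _ 1 2 0 1 x x theta ltac:(lra) ltac:(lra) ltac:(lra) ltac:(lra) ltac:(lia) Mxx G13 PX DX).
  assert (Q24 := ip_bound b w _ _ _ 1 2 0 1 y y theta ltac:(lra) ltac:(lra) ltac:(lra) ltac:(lra) ltac:(lia) Myy G24 PY DY).
  assert (Q14 := ip_bound b w _ _ _ 1 2 0 1 x y theta ltac:(lra) ltac:(lra) ltac:(lra) ltac:(lra) ltac:(lia) Mxy G14 PX DY).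
  assert (Q23 := ip_bound b w _ _ _ 1 2 0 1 y x theta ltac:(lra) ltac:(lra) ltac:(lra) ltac:(lra) ltac:(lia) Myx G23 PY DX).
  assert (Q33 := ip_bound b w _ _ _ 2 2 1 1 x x theta ltac:(lra) ltac:(lra) ltac:(lra) ltac:(lra) ltac:(lia) Mxx G33 DX DX).
  assert (Q44 := ip_bound b w _ _ _ 2 2 1 1 y y theta ltac:(lra) ltac:(lra) ltac:(lra) ltac:(lra) ltac:(lia) Myy G44 DY DY).
  assert (Q34 := ip_bound b w _ _ _ 2 2 1 1 x y theta ltac:(lra) ltac:(lra) ltac:(lra) ltac:(lra) ltac:(lia) Mxy G34 DX DY).
  rewrite (Rmult_comm y x) in Q23.
  rewrite Em1 in Q11, Q13, Q33. rewrite Em2 in Q22, Q24, Q44. rewrite Em12 in Q12, Q14, Q23, Q34.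
  fold p in Q11, Q13, Q33. fold q in Q22, Q24, Q44. fold m in Q12, Q14, Q23, Q34.
  change ((1 + 1)%nat) with 2%nat in Q33, Q44, Q34. change ((0 + 1)%nat) with 1%nat in Q13, Q24, Q14, Q23.
  change ((0 + 0)%nat) with 0%nat in Q11, Q22, Q12.
  rewrite pow_O in Q11, Q22, Q12. rewrite pow_1 in Q13, Q24, Q14, Q23.
  assert (PW : forall a c, 0 < a -> 0 < c -> 0 <= theta * (a * c))
    by (intros; apply Rmult_le_pos; [lra|nneg]).
  assert (X12 : Rabs (g12 G) <= 4 * theta * z * (m1 * m2)).
  { eapply Rle_trans; [exact Q12|].
    assert (0 <= theta * (m1 * m2 * z)) by (apply PW; [apply Rmult_lt_0_compat|]; lra). lra. }
  assert (X23 : Rabs (g23 G) <= 4 * theta * z * (m2 * m3)).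
  { eapply Rle_trans; [exact Q23|].
    assert (0 <= theta * (m1 * m2 * z)) by (apply PW; [apply Rmult_lt_0_compat|]; lra).
    assert (theta * (m1 * m2 * z) * / m <= theta * (m1 * m2 * z) * (2 * / p))
      by mono.
    unfold m3, Rdiv. lra. }
  assert (X14 : Rabs (g14 G) <= 4 * theta * z * (m1 * m4)).
  { eapply Rle_trans; [exact Q14|].
    assert (0 <= theta * (m1 * m2 * z)) by (apply PW; [apply Rmult_lt_0_compat|]; lra).
    assert (theta * (m1 * m2 * z) * / m <= theta * (m1 * m2 * z) * (2 * / q))
      by mono.
    unfold m4, Rdiv. lra. }
  assert (X34 : Rabs (g34 G) <= 4 * theta * z * (m3 * m4)).
  { eapply Rle_trans; [exact Q34|].
    assert (0 <= theta * (m1 * m2 * z)) by (apply PW; [apply Rmult_lt_0_compat|]; lra).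
    assert (theta * (m1 * m2 * z) * (/ m) ^ 2 <= theta * (m1 * m2 * z) * (/ p * / q))
      by mono.
    unfold m3, m4, Rdiv. lra. }
  assert (RZ : forall s, 0 < s -> 4 * theta * z * s <= 4 * theta * (1 * s)).
  { intros s Hs. rewrite Rmult_1_l. apply Rmult_le_compat_r; [lra|].
    rewrite <- (Rmult_1_r (4 * theta)) at 2. mono. }
  assert (Hm3 : 0 < m3) by (unfold m3; pos).
  assert (Hm4 : 0 < m4) by (unfold m4; pos).
  split; [|auto].
  split; repeat split.
  - pose proof (PW m1 m1 Hm1 Hm1). lra.
  - eapply Rle_trans; [exact X12|apply RZ, Rmult_lt_0_compat; auto].
  - pose proof (PW m2 m2 Hm2 Hm2). lra.
  - eapply Rle_trans; [exact Q13|]. unfold m3, Rdiv.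
    pose proof (PW m1 m3 Hm1 Hm3) as K. unfold m3, Rdiv in K. lra.
  - eapply Rle_trans; [exact X23|apply RZ, Rmult_lt_0_compat; auto].
  - eapply Rle_trans; [exact X14|apply RZ, Rmult_lt_0_compat; auto].
  - eapply Rle_trans; [exact Q24|]. unfold m4, Rdiv.
    pose proof (PW m2 m4 Hm2 Hm4) as K. unfold m4, Rdiv in K. lra.
  - eapply Rle_trans; [exact Q33|]. unfold m3, Rdiv. right. ring.
  - eapply Rle_trans; [exact X34|apply RZ, Rmult_lt_0_compat; auto].
  - eapply Rle_trans; [exact Q44|]. unfold m4, Rdiv. right. ring.
Qed.

(** * Nondegeneracy of the limiting Gram matrices *)

Lemma binK_decr : forall b k s t, 0 < b -> 0 < k -> s < 1 -> t < 1 -> 1 - t <= k * (1 - s) ->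
  Rpower k (- b) * binK b s <= binK b t.
Proof.
  intros b k s t Hb Hk Hs Ht H. unfold binK.
  rewrite Rpower_mult_distr by lra. rewrite !Rpower_Ropp.
  apply Rinv_le_contravar; [apply Rpower_pos|]. apply Rpower_mono_base; lra.
Qed.

(** If [alpha >= 1/2] the distances of [x] and [y] to [1] are comparable, because
    [1 - x y] dominates both up to a factor two. *)
Lemma alpha_half_comparable : forall x y z, 1 / 2 <= x <= z -> 1 / 2 <= y <= z -> z < 1 ->
  z = x \/ z = y -> 1 / 2 <= alpha x y ->
  1 - x * x <= 8 * (1 - z * z) /\ 1 - y * y <= 8 * (1 - z * z) /\
  1 - x * y <= 4 * (1 - z * z).
Proof.
  intros x y z Hx Hy Hz Hzz Hal. rewrite alpha_mul in Hal.
  pose proof (prod_in_01 x y ltac:(lra) ltac:(lra)) as H1.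
  pose proof (prod_in_01 x x ltac:(lra) ltac:(lra)) as H2.
  pose proof (prod_in_01 y y ltac:(lra) ltac:(lra)) as H3.
  assert (Hp : (1 - x * x) / 2 <= 1 - x * y) by nra.
  assert (Hq : (1 - y * y) / 2 <= 1 - x * y) by nra.
  assert (HP : 1 - z * z = 1 - x * x \/ 1 - z * z = 1 - y * y)
    by (destruct Hzz as [-> | ->]; auto).
  set (p := 1 - x * x) in *. set (q := 1 - y * y) in *. set (m := 1 - x * y) in *.
  set (P := 1 - z * z) in *.
  assert (0 < p) by (unfold p; lra). assert (0 < q) by (unfold q; lra).
  assert (0 < m) by (unfold m; lra).
  assert (Hm2 : m ^ 2 <= 2 * (p * q)).
  { apply Rmult_le_reg_r with (/ m ^ 2); [pos|].
    rewrite Rinv_r by (apply pow_nonzero; lra). unfold Rdiv in Hal. lra. }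
  clearbody p q m P.
  assert (q <= 8 * p).
  { apply Rmult_le_reg_l with q; [lra|].
    assert (q / 2 * (q / 2) <= m * m) by mono.
    simpl in Hm2. lra. }
  assert (p <= 8 * q).
  { apply Rmult_le_reg_l with p; [lra|].
    assert (p / 2 * (p / 2) <= m * m) by mono.
    simpl in Hm2. lra. }
  assert (m <= 4 * P).
  { apply Rsqr_incr_0_var; [|destruct HP; lra]. unfold Rsqr. simpl in Hm2.
    destruct HP as [-> | ->].
    - assert (p * q <= p * (8 * p)) by mono. lra.
    - assert (p * q <= (8 * q) * q) by mono. lra. }
  destruct HP as [-> | ->]; lra.
Qed.

(** The powers of [y - x] in [ddiff_gram_dets] are compensated by
    [1 - alpha = (y - x) ^ 2 / (1 - x y) ^ 2]. *)
Lemma near_lower : forall b, 0 < b -> exists c, 0 < c /\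
  forall x y z, 1 / 2 <= x <= z -> 1 / 2 <= y <= z -> z < 1 ->
  z = x \/ z = y -> x <> y -> 1 / 2 <= alpha x y ->
  let P := 1 - z * z in
  gram_lower (binK b (z * z)) 1 (/ P) (/ P ^ 2) (/ P ^ 2) c (ddiff_gram (y - x) (binG b x y)).
Proof.
  intros b Hb.
  destruct (one_minus_Rpower_lower b Hb) as [k1 [Hk1 L1]].
  destruct (cond_var_lower b Hb) as [k2 [Hk2 L2]].
  set (kp := Rpower 8 (- b)). assert (Hkp : 0 < kp) by apply Rpower_pos.
  assert (Hkp2 : 0 < kp ^ 2) by pos.
  assert (Hkp3 : 0 < kp ^ 3) by pos.
  (* [kp] compares the kernels at [x ^ 2], [y ^ 2] and [z ^ 2]; [16 = 4 ^ 2] and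
     [16384 = 8 ^ 2 * 4 ^ 4] come from [alpha_half_comparable] *)
  exists (Rmin (kp ^ 2 * k1 / 16) (b * k2 * kp ^ 3 / 16384)).
  assert (Hc1 : 0 < kp ^ 2 * k1 / 16)
    by (apply Rdiv_lt_0_compat; [apply Rmult_lt_0_compat|]; lra).
  assert (Hc2 : 0 < b * k2 * kp ^ 3 / 16384)
    by (apply Rdiv_lt_0_compat; [repeat apply Rmult_lt_0_compat|]; lra).
  split; [pos|].
  intros x y z Hx Hy Hz Hzz Hxy Hal P.
  destruct (alpha_half_comparable x y z Hx Hy Hz Hzz Hal) as (Cp & Cq & Cm).
  pose proof (prod_in_01 x y ltac:(lra) ltac:(lra)) as H1.
  pose proof (prod_in_01 x x ltac:(lra) ltac:(lra)) as H2.
  pose proof (prod_in_01 y y ltac:(lra) ltac:(lra)) as H3.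
  pose proof (prod_in_01 z z ltac:(lra) ltac:(lra)) as H4.
  pose proof (alpha_range x y ltac:(lra) ltac:(lra)) as Har.
  specialize (L1 (alpha x y) Har). specialize (L2 (alpha x y) Har).
  destruct (binG_dets b x y ltac:(lra) ltac:(lra)) as (ED & E1 & E2 & _).
  destruct (ddiff_gram_dets (y - x) (binG b x y) ltac:(lra)) as (ND & N1 & N2 & _).
  rewrite one_minus_alpha in L1, L2 by lra.
  set (a := binK b (x * x)) in *. set (c := binK b (y * y)) in *. set (Z := binK b (z * z)).
  assert (HZ : 0 < Z) by apply binK_pos.
  assert (Ha : kp * Z <= a) by (apply binK_decr; lra).
  assert (Hc : kp * Z <= c) by (apply binK_decr; lra).
  fold P in Cp, Cq, Cm.
  set (p := 1 - x * x) in *. set (q := 1 - y * y) in *. set (m := 1 - x * y) in *.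
  assert (HP : 0 < P) by (unfold P; lra).
  assert (Hp : 0 < p) by (unfold p; lra). assert (Hq : 0 < q) by (unfold q; lra).
  assert (Hm : 0 < m) by (unfold m; lra).
  set (h := y - x) in *. assert (Hh : h <> 0) by (unfold h; lra).
  assert (HkZ : 0 < kp * Z) by pos.
  assert (INV : forall u k, 0 < u -> 0 < k -> u <= k * P -> / k * / P <= / u).
  { intros u k Hu Hk HuP. rewrite <- Rinv_mult. apply Rinv_le_contravar; lra. }
  assert (Im := INV m 4 Hm ltac:(lra) Cm).
  assert (Ip := INV p 8 Hp ltac:(lra) Cp).
  assert (Iq := INV q 8 Hq ltac:(lra) Cq).
  set (i := / P) in *. assert (Hi : 0 < i) by (unfold i; pos).
  assert (PI2 : / P ^ 2 = i ^ 2) by (unfold i; field; lra).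
  rewrite PI2.
  assert (Hih : 0 < h ^ 2) by (apply pow2_gt_0; exact Hh).
  assert (MD : Rmin (kp ^ 2 * k1 / 16) (b * k2 * kp ^ 3 / 16384) <= kp ^ 2 * k1 / 16) by apply Rmin_l.
  assert (ME : Rmin (kp ^ 2 * k1 / 16) (b * k2 * kp ^ 3 / 16384) <= b * k2 * kp ^ 3 / 16384) by apply Rmin_r.
  set (cc := Rmin (kp ^ 2 * k1 / 16) (b * k2 * kp ^ 3 / 16384)) in *. clearbody cc.
  assert (Hacl : (kp * Z) * (kp * Z) <= a * c) by mono.
  assert (Hac0 : 0 < (kp * Z) * (kp * Z)) by pos.
  assert (EST : forall a' r, kp * Z <= a' -> / 8 * i <= / r -> 0 < r ->
    cc * (Z ^ 3 * (1 ^ 2 * i ^ 2 * (i ^ 2) ^ 2))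
    <= b * a' * (a * c) / r ^ 2 * cond_var b (alpha x y) / h ^ 4).
  { intros a' r Ha' Hr Hr0.
    apply Rle_trans with (b * k2 * kp ^ 3 / 16384 * (Z ^ 3 * (1 ^ 2 * i ^ 2 * (i ^ 2) ^ 2))).
    { apply Rmult_le_compat_r; [|exact ME]. apply Rlt_le.
      pos. }
    apply Rle_trans with (b * (kp * Z * ((kp * Z) * (kp * Z))) * (/ 8 * i) ^ 2 * (k2 * (/ 4 * i) ^ 4)).
    { right. field. }
    apply Rle_trans with (b * (a' * (a * c)) * (/ r) ^ 2 * (k2 * (/ m) ^ 4)).
    { assert (U1 : kp * Z * (kp * Z * (kp * Z)) <= a' * (a * c)) by mono.
      assert (U2 : (/ 8 * i) ^ 2 <= (/ r) ^ 2) by (apply pow_incr; lra).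
      assert (U3 : (/ 4 * i) ^ 4 <= (/ m) ^ 4) by (apply pow_incr; lra).
      assert (0 <= (/ 8 * i) ^ 2) by nneg.
      assert (0 <= (/ 4 * i) ^ 4) by nneg.
      assert (0 < kp * Z * (kp * Z * (kp * Z))) by pos.
      apply Rmult_le_compat.
      - apply Rmult_le_pos; [apply Rmult_le_pos|]; lra.
      - nneg.
      - apply Rmult_le_compat; try lra; [nneg|]. mono.
      - mono. }
    apply Rle_trans with (b * (a' * (a * c)) * (/ r) ^ 2 * (k2 * (h ^ 2 / m ^ 2) ^ 2 / h ^ 4)).
    { right. field. repeat split; lra. }
    apply Rle_trans with (b * (a' * (a * c)) * (/ r) ^ 2 * (cond_var b (alpha x y) / h ^ 4)).
    { apply Rmult_le_compat_l.
      - apply Rmult_le_pos; [|apply pow_le, Rlt_le, Rinv_0_lt_compat; lra].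
        apply Rmult_le_pos; [lra|]. nneg.
      - apply Rmult_le_compat_r; [|exact L2]. apply Rlt_le, Rinv_0_lt_compat.
        replace (h ^ 4) with (h ^ 2 * h ^ 2) by ring. pos. }
    right. field. split; lra. }
  split; [|split].
  - rewrite ND, ED.
    apply Rle_trans with (kp ^ 2 * k1 / 16 * (Z ^ 2 * (1 ^ 2 * i ^ 2))).
    { apply Rmult_le_compat_r; [|exact MD]. apply Rlt_le. pos. }
    apply Rle_trans with ((kp * Z) * (kp * Z) * (k1 * (/ 4 * i) ^ 2)); [right; field|].
    apply Rle_trans with (a * c * (k1 * (/ m) ^ 2)).
    { apply Rmult_le_compat; try lra.
      - apply Rmult_le_pos; [lra|nneg].
      - apply Rmult_le_compat_l; [lra|]. apply pow_incr; lra. }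
    apply Rle_trans with (a * c * (k1 * (h ^ 2 / m ^ 2)) / h ^ 2); [right; field; lra|].
    apply Rmult_le_compat_r; [nneg|].
    mono.
  - rewrite N1, E1. apply EST; lra.
  - rewrite N2, E2. apply EST; lra.
Qed.

Lemma far_lower : forall b, 0 < b -> exists c, 0 < c /\
  forall x y, 1 / 2 <= x < 1 -> 1 / 2 <= y < 1 -> alpha x y <= 1 / 2 ->
  let m1 := sqrt (binK b (x * x)) in let m2 := sqrt (binK b (y * y)) in
  gram_lower 1 m1 m2 (m1 / (1 - x * x)) (m2 / (1 - y * y)) c (binG b x y).
Proof.
  intros b Hb.
  destruct (one_minus_Rpower_lower b Hb) as [k1 [Hk1 L1]].
  destruct (cond_var_lower b Hb) as [k2 [Hk2 L2]].
  assert (Hbk : 0 < b * k2) by pos.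
  exists (Rmin (k1 / 2) (b * k2 / 4)). split; [pos|].
  intros x y Hx Hy Hal m1 m2.
  pose proof (prod_in_01 x x ltac:(lra) ltac:(lra)) as H2.
  pose proof (prod_in_01 y y ltac:(lra) ltac:(lra)) as H3.
  pose proof (alpha_range x y Hx Hy) as Har.
  specialize (L1 (alpha x y) Har). specialize (L2 (alpha x y) Har).
  destruct (binG_dets b x y Hx Hy) as (ED & E1 & E2 & _).
  assert (Hm1 : 0 < m1) by (apply sqrt_lt_R0, binK_pos).
  assert (Hm2 : 0 < m2) by (apply sqrt_lt_R0, binK_pos).
  assert (Em1 : binK b (x * x) = m1 * m1) by (symmetry; apply sqrt_sqrt, Rlt_le, binK_pos).
  assert (Em2 : binK b (y * y) = m2 * m2) by (symmetry; apply sqrt_sqrt, Rlt_le, binK_pos).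
  rewrite Em1, Em2 in *.
  set (p := 1 - x * x) in *. set (q := 1 - y * y) in *. set (al := alpha x y) in *.
  assert (Hp : 0 < p) by (unfold p; lra). assert (Hq : 0 < q) by (unfold q; lra).
  assert (MD : Rmin (k1 / 2) (b * k2 / 4) <= k1 / 2) by apply Rmin_l.
  assert (ME : Rmin (k1 / 2) (b * k2 / 4) <= b * k2 / 4) by apply Rmin_r.
  assert (K1 : k1 / 2 <= 1 - Rpower al b).
  { eapply Rle_trans; [|exact L1]. unfold Rdiv. mono. }
  assert (K2 : k2 / 4 <= cond_var b al).
  { eapply Rle_trans; [|exact L2]. unfold Rdiv. apply Rmult_le_compat_l; [lra|].
    replace (/ 4) with ((1 / 2) ^ 2) by field. apply pow_incr. lra. }
  set (cc := Rmin (k1 / 2) (b * k2 / 4)) in *. clearbody cc.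
  assert (SQ : forall u, 0 < u -> 0 < u ^ 2) by (intros; apply pow_lt; auto).
  split; [|split].
  - rewrite ED. replace (m1 * m1 * (m2 * m2) * (1 - Rpower al b))
      with ((1 - Rpower al b) * (1 ^ 2 * (m1 ^ 2 * m2 ^ 2))) by ring.
    apply Rmult_le_compat_r; [|lra]. apply Rlt_le.
    apply Rmult_lt_0_compat; [lra|]. apply Rmult_lt_0_compat; auto.
  - rewrite E1. replace (b * (m1 * m1) * (m1 * m1 * (m2 * m2)) / p ^ 2 * cond_var b al)
      with (b * cond_var b al * (1 ^ 3 * (m1 ^ 2 * m2 ^ 2 * (m1 / p) ^ 2))) by (field; lra).
    apply Rmult_le_compat_r.
    + apply Rlt_le. assert (0 < m1 / p) by pos.
      pos.
    + apply Rle_trans with (b * (k2 / 4)); [lra|]. mono.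
  - rewrite E2. replace (b * (m2 * m2) * (m1 * m1 * (m2 * m2)) / q ^ 2 * cond_var b al)
      with (b * cond_var b al * (1 ^ 3 * (m1 ^ 2 * m2 ^ 2 * (m2 / q) ^ 2))) by (field; lra).
    apply Rmult_le_compat_r.
    + apply Rlt_le. assert (0 < m2 / q) by pos.
      pos.
    + apply Rle_trans with (b * (k2 / 4)); [lra|]. mono.
Qed.

(** * Comparison with the limiting density *)

Lemma binc_moment_bound : forall b, 0 < b -> exists M, 1 <= M /\
  forall t, 0 <= t < 1 -> moment_bound b M t (binc b).
Proof.
  intros b Hb. destruct (risefact_bounded b Hb) as (M & HM & HR).
  exists (1 + M). split; [lra|]. intros t Ht s Hs.
  destruct (binc_moment_series b s t Hb Ht) as (l & Hl & Hl1).
  exists l. split.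
  - eapply is_series_ext_R; [|exact Hl]. intros j. cbv beta.
    rewrite (Rabs_right (binc b j)) by (apply Rle_ge, Rlt_le, binc_pos; lra). reflexivity.
  - eapply Rle_trans; [apply Hl1|]. apply Rmult_le_compat_r.
    + apply Rmult_le_pos; [apply Rlt_le, binK_pos|]. apply pow_le, Rlt_le, Rinv_0_lt_compat; lra.
    + specialize (HR s Hs). lra.
Qed.

(** [K], [K1], [K2] are the generating function of the weights and its first two
    derivatives, at the point [t]. *)
Definition has_moments (w : nat -> R) (K K1 K2 : R -> R) (t : R) : Prop :=
  is_series (fun j => w j * t ^ j) (K t) /\
  is_series (fun j => w j * dpow t j) (K1 t) /\
  is_series (fun j => w j * ddpow t j) (K2 t).

Definition close_at (b eta : R) (w : nat -> R) (x y : R) : Prop :=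
  moment_bound b eta (x * x) (fun j => w j - binc b j) /\
  moment_bound b eta (x * y) (fun j => w j - binc b j) /\
  moment_bound b eta (y * y) (fun j => w j - binc b j).

(** For [alpha >= 1/2] the comparison is made on divided differences, otherwise
    on the original vectors scaled by their norms. *)
Lemma density_compare : forall tau, - (1 / 2) < tau -> exists C eta0, 0 < C /\ 0 < eta0 /\
  forall w K K1 K2 x y eta, 1 / 2 <= x < 1 -> 1 / 2 <= y < 1 -> x <> y -> 0 <= eta <= eta0 ->
  (forall t, t = x * x \/ t = x * y \/ t = y * y -> has_moments w K K1 K2 t) ->
  close_at (2 * tau + 1) eta w x y ->
  let G := kernel_gram K K1 K2 x y in
  0 < detD G /\ 0 < detE1 G /\ 0 < detE2 G /\
  exists e, Rabs e <= C * eta /\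
    density G = (2 * tau + 1) * ((1 + f_formula tau (alpha x y)) / ((1 - x ^ 2) * (1 - y ^ 2)))
      * (1 + e).
Proof.
  intros tau Ht. set (b := 2 * tau + 1). assert (Hb : 0 < b) by (unfold b; lra).
  destruct (binc_moment_bound b Hb) as (M & HM & HMb).
  destruct (near_lower b Hb) as (c1 & Hc1 & NL).
  destruct (far_lower b Hb) as (c2 & Hc2 & FL).
  destruct (gram_compare (16 * M) c1 ltac:(lra) Hc1) as (C1 & e1 & HC1 & He1 & GC1).
  destruct (gram_compare (4 * M) c2 ltac:(lra) Hc2) as (C2 & e2 & HC2 & He2 & GC2).
  exists (16 * C1 + 4 * C2), (Rmin (e1 / 16) (e2 / 4)).
  split; [lra|]. split; [pos|].
  intros w K K1 K2 x y eta Hx Hy Hxy [Heta0 Heta] HS (Cxx & Cxy & Cyy) G.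
  assert (Heta1 : eta <= e1 / 16) by (eapply Rle_trans; [exact Heta|apply Rmin_l]).
  assert (Heta2 : eta <= e2 / 4) by (eapply Rle_trans; [exact Heta|apply Rmin_r]).
  pose proof (prod_in_01 x y Hx Hy) as Lxy. pose proof (prod_in_01 x x Hx Hx) as Lxx.
  pose proof (prod_in_01 y y Hy Hy) as Lyy.
  assert (HG : gram_of w (fun j => x ^ j) (fun j => y ^ j) (dpow x) (dpow y) G)
    by (apply kernel_gram_of; exact HS).
  assert (HH := binG_gram_of b x y Hb Hx Hy).
  assert (HD := gram_of_sub _ _ _ _ _ _ _ _ HG HH).
  pose proof (binG_density tau x y Ht Hx Hy Hxy) as BD. fold b in BD. rewrite <- BD.
  assert (PK := binK_pos b).
  destruct (Rle_dec (1 / 2) (alpha x y)) as [Hal|Hal].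
  - (* [z] is one of the points, so its square is among the controlled products *)
    set (z := Rmax x y).
    assert (Hxz : x <= z) by apply Rmax_l. assert (Hyz : y <= z) by apply Rmax_r.
    assert (Hzz : z = x \/ z = y) by (unfold z, Rmax; destruct (Rle_dec x y); auto).
    assert (Hz : z < 1) by (destruct Hzz; lra).
    assert (Czz : moment_bound b eta (z * z) (fun j => w j - binc b j)) by (destruct Hzz as [-> | ->]; auto).
    assert (Lzz := prod_in_01 z z ltac:(lra) ltac:(lra)).
    assert (BG := near_bounds b x y z eta _ _ ltac:(lra) ltac:(lra) Hz Hxy Heta0 Czz HD).
    assert (BH := near_bounds b x y z M _ _ ltac:(lra) ltac:(lra) Hz Hxy ltac:(lra) (HMb (z * z) ltac:(lra)) HH).
    assert (loglog := NL x y z ltac:(lra) ltac:(lra) Hz Hzz Hxy Hal).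
    cbv zeta in BG, BH, loglog. rewrite ddiff_gram_sub in BG by lra.
    assert (PP : 0 < / (1 - z * z)) by pos.
    assert (PP2 : 0 < / (1 - z * z) ^ 2) by pos.
    destruct (GC1 _ _ _ _ _ _ _ (16 * eta) (PK (z * z)) Rlt_0_1 PP PP2 PP2 ltac:(lra) BH BG loglog)
      as (PD & P1 & P2 & e & He & EE).
    destruct loglog as (LD & LL1 & LL2).
    set (h := y - x) in *. assert (Hh : h <> 0) by (unfold h; lra).
    destruct (ddiff_gram_dets h G Hh) as (ND & N1 & N2 & NN).
    destruct (ddiff_gram_dets h (binG b x y) Hh) as (NDb & N1b & N2b & NNb).
    assert (Hh2 : 0 < h ^ 2) by (apply pow2_gt_0; exact Hh).
    assert (Hh4 : 0 < h ^ 4) by (replace (h ^ 4) with (h ^ 2 * h ^ 2) by ring; pos).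
    assert (UP : forall X k, 0 < k -> 0 < X / k -> 0 < X).
    { intros X k Hk HX. replace X with (X / k * k) by (field; lra). pos. }
    assert (QD : 0 < detD G) by (rewrite ND in PD; apply (UP _ _ Hh2 PD)).
    assert (Q1 : 0 < detE1 G) by (rewrite N1 in P1; apply (UP _ _ Hh4 P1)).
    assert (Q2 : 0 < detE2 G) by (rewrite N2 in P2; apply (UP _ _ Hh4 P2)).
    assert (Pz : forall m4, 0 < m4 -> 0 < c1 * (binK b (z * z) ^ 3 * (1 ^ 2 * (/ (1 - z * z)) ^ 2 * m4 ^ 2))).
    { intros m4 Hm4. pos. }
    assert (QDb : 0 < detD (binG b x y)).
    { rewrite NDb in LD. apply (UP _ _ Hh2). eapply Rlt_le_trans; [|exact LD].
      pos. }
    assert (Q1b : 0 < detE1 (binG b x y)).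
    { rewrite N1b in LL1. apply (UP _ _ Hh4). eapply Rlt_le_trans; [|exact LL1]. auto. }
    assert (Q2b : 0 < detE2 (binG b x y)).
    { rewrite N2b in LL2. apply (UP _ _ Hh4). eapply Rlt_le_trans; [|exact LL2]. auto. }
    split; [exact QD|]. split; [exact Q1|]. split; [exact Q2|].
    exists e. split.
    + eapply Rle_trans; [exact He|]. assert (0 <= C2 * eta) by nneg. lra.
    + assert (Habs : 0 < Rabs h) by (apply Rabs_pos_lt; exact Hh).
      assert (Hia : 0 < / Rabs h) by pos.
      assert (Hi4 : 0 < / h ^ 4) by pos.
      assert (E2 : forall X, X / h ^ 2 = X * (/ Rabs h) ^ 2).
      { intros X. rewrite <- (pow2_abs h). field. lra. }
      rewrite (density_scale G (ddiff_gram h G) (/ Rabs h) (/ h ^ 4)) in EE; auto;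
        [|rewrite ND; apply E2].
      rewrite (density_scale (binG b x y) (ddiff_gram h (binG b x y)) (/ Rabs h) (/ h ^ 4)) in EE; auto;
        [|rewrite NDb; apply E2].
      apply Rmult_eq_reg_r with (/ h ^ 4 / (/ Rabs h) ^ 3).
      * rewrite EE. ring.
      * apply Rgt_not_eq. apply Rdiv_lt_0_compat; [lra|pos].
  - assert (Hal' : alpha x y <= 1 / 2) by lra.
    assert (BG := far_bounds b x y eta _ _ Hb Hx Hy Heta0 Cxx Cxy Cyy HD).
    assert (BH := far_bounds b x y M _ _ Hb Hx Hy ltac:(lra) (HMb (x * x) ltac:(lra)) (HMb (x * y) ltac:(lra))
       (HMb (y * y) ltac:(lra)) HH).
    cbv zeta in BG, BH. destruct BG as [BG _]. destruct BH as [BH _].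
    assert (loglog := FL x y Hx Hy Hal'). cbv zeta in loglog.
    assert (Hm1 : 0 < sqrt (binK b (x * x))) by pos.
    assert (Hm2 : 0 < sqrt (binK b (y * y))) by pos.
    assert (Hm3 : 0 < sqrt (binK b (x * x)) / (1 - x * x)) by pos.
    assert (Hm4 : 0 < sqrt (binK b (y * y)) / (1 - y * y)) by pos.
    destruct (GC2 1 _ _ _ _ _ _ (4 * eta) Rlt_0_1 Hm1 Hm2 Hm3 Hm4 ltac:(lra) BH BG loglog) as (PD & P1 & P2 & e & He & EE).
    split; [exact PD|]. split; [exact P1|]. split; [exact P2|].
    exists e. split; [|exact EE].
    eapply Rle_trans; [exact He|]. assert (0 <= C1 * eta) by nneg. lra.
Qed.

Lemma moment_bound_add : forall b th1 th2 th t w v, 0 <= t < 1 -> th1 + th2 <= th ->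
  moment_bound b th1 t (fun j => w j - v j) -> moment_bound b th2 t v -> moment_bound b th t w.
Proof.
  intros b th1 th2 th t w v Ht Hth H1 H2 s Hs.
  destruct (H1 s Hs) as (l1 & S1 & L1). destruct (H2 s Hs) as (l2 & S2 & L2).
  destruct (is_series_dom (fun j => Rabs (w j) * INR j ^ s * t ^ j)
    (fun j => Rabs (w j - v j) * INR j ^ s * t ^ j + Rabs (v j) * INR j ^ s * t ^ j) (l1 + l2))
    as (l & Sl & Ll).
  - intros j. assert (0 <= INR j ^ s * t ^ j) by (apply Rmult_le_pos; nneg).
    assert (Rabs (w j) <= Rabs (w j - v j) + Rabs (v j)).
    { eapply Rle_trans; [|apply Rabs_triang]. right. f_equal. ring. }
    rewrite !Rmult_assoc, <- Rmult_plus_distr_r.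
    split; [nneg|mono].
  - exact (is_series_plus _ _ _ _ S1 S2).
  - exists l. split; [exact Sl|].
    assert (0 <= binK b t * (/ (1 - t)) ^ s) by (pose proof (binK_pos b t); nneg).
    assert ((th1 + th2) * (binK b t * (/ (1 - t)) ^ s) <= th * (binK b t * (/ (1 - t)) ^ s))
      by mono.
    lra.
Qed.

(** * Decorrelation of distant points *)

(** The limiting Gram matrix supplies the bounds and the lower bounds, and the
    error [eta] is absorbed in the constants.  The limiting one-point
    determinants are [b] times the scales, so the one-point densities are of
    order [1 / (1 - x ^ 2)] and [1 / (1 - y ^ 2)]. *)
Lemma density_decorrelate : forall tau, - (1 / 2) < tau ->
  exists C eta0 al0, 0 < C /\ 0 < eta0 /\ 0 < al0 <= 1 / 2 /\
  forall w K K1 K2 x y eta, 1 / 2 <= x < 1 -> 1 / 2 <= y < 1 -> 0 <= eta <= eta0 ->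
  (forall t, t = x * x \/ t = x * y \/ t = y * y -> has_moments w K K1 K2 t) ->
  close_at (2 * tau + 1) eta w x y -> alpha x y <= al0 ->
  let G := kernel_gram K K1 K2 x y in
  0 < detD G /\ 0 < detE1 G /\ 0 < detE2 G /\
  0 < g11 G /\ 0 < g22 G /\ 0 < point_det1 G /\ 0 < point_det2 G /\
  exists e, Rabs e <= C * Rpower (alpha x y) (2 * tau + 1) /\
    density G - sqrt (point_det1 G * point_det2 G) / (g11 G * g22 G)
      = e / ((1 - x ^ 2) * (1 - y ^ 2)).
Proof.
  intros tau Ht. set (b := 2 * tau + 1). assert (Hb : 0 < b) by (unfold b; lra).
  destruct (binc_moment_bound b Hb) as (M & HM & HMb).
  set (B := 4 * (1 + M)).
  set (c := Rmin (1 / 2) (b / 2)). assert (Hc : 0 < c) by (unfold c; pos).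
  assert (Hcl : c <= 1 / 2) by apply Rmin_l. assert (Hcr : c <= b / 2) by apply Rmin_r.
  destruct (gram_decorrelate B c ltac:(unfold B; lra) Hc) as (C & z0 & HC & Hz0 & GD).
  set (eta0 := Rmin (1 / 8) (b / (48 * B))).
  assert (HB : 8 <= B) by (unfold B; lra).
  (* [alpha <= al0] makes [z = alpha ^ (b / 2)] at most [z0] *)
  set (al0 := Rmin (1 / 2) (Rpower z0 (2 / b))).
  exists (6 * b * C), eta0, al0.
  split; [pos|].
  split; [apply Rmin_glb_lt; [lra|pos]|].
  split; [split; [apply Rmin_glb_lt; [lra|apply Rpower_pos]|apply Rmin_l]|].
  intros w K K1 K2 x y eta Hx Hy [Heta0 Heta] HS (Cxx & Cxy & Cyy) Hal G.
  assert (Heta1 : eta <= 1 / 8) by (eapply Rle_trans; [exact Heta|apply Rmin_l]).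
  assert (Heta2 : eta <= b / (48 * B)) by (eapply Rle_trans; [exact Heta|apply Rmin_r]).
  assert (Hal2 : alpha x y <= Rpower z0 (2 / b)) by (eapply Rle_trans; [exact Hal|apply Rmin_r]).
  pose proof (prod_in_01 x y Hx Hy) as Lxy. pose proof (prod_in_01 x x Hx Hx) as Lxx.
  pose proof (prod_in_01 y y Hy Hy) as Lyy.
  pose proof (alpha_range x y Hx Hy) as Har.
  assert (HG : gram_of w (fun j => x ^ j) (fun j => y ^ j) (dpow x) (dpow y) G)
    by (apply kernel_gram_of; exact HS).
  assert (HH := binG_gram_of b x y Hb Hx Hy).
  assert (HD := gram_of_sub _ _ _ _ _ _ _ _ HG HH).
  assert (MS : forall t, 0 <= t < 1 -> moment_bound b eta t (fun j => w j - binc b j) ->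
    moment_bound b (1 + M) t w)
    by (intros; apply (moment_bound_add b eta M) with (binc b); auto; lra).
  destruct (far_bounds b x y eta _ _ Hb Hx Hy Heta0 Cxx Cxy Cyy HD) as [BD _].
  destruct (far_bounds b x y M _ _ Hb Hx Hy ltac:(lra) (HMb (x * x) ltac:(lra)) (HMb (x * y) ltac:(lra))
    (HMb (y * y) ltac:(lra)) HH) as [BH _].
  destruct (far_bounds b x y (1 + M) _ _ Hb Hx Hy ltac:(lra) (MS (x * x) ltac:(lra) Cxx)
    (MS (x * y) ltac:(lra) Cxy) (MS (y * y) ltac:(lra) Cyy) HG) as (BG & Z12 & Z23 & Z14 & Z34).
  set (m1 := sqrt (binK b (x * x))) in *. set (m2 := sqrt (binK b (y * y))) in *.
  assert (Hm1 : 0 < m1) by (apply sqrt_lt_R0, binK_pos).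
  assert (Hm2 : 0 < m2) by (apply sqrt_lt_R0, binK_pos).
  assert (Em1 : binK b (x * x) = m1 * m1) by (symmetry; apply sqrt_sqrt, Rlt_le, binK_pos).
  assert (Em2 : binK b (y * y) = m2 * m2) by (symmetry; apply sqrt_sqrt, Rlt_le, binK_pos).
  set (p := 1 - x * x) in *. set (q := 1 - y * y) in *.
  assert (Hp : 0 < p) by (unfold p; lra). assert (Hq : 0 < q) by (unfold q; lra).
  set (m3 := m1 / p) in *. set (m4 := m2 / q) in *.
  assert (Hm3 : 0 < m3) by (unfold m3; pos).
  assert (Hm4 : 0 < m4) by (unfold m4; pos).
  set (z := Rpower (alpha x y) (b / 2)) in *.
  assert (Hz : 0 < z) by apply Rpower_pos.
  assert (Hzz0 : z <= z0).
  { unfold z. apply Rle_trans with (Rpower (Rpower z0 (2 / b)) (b / 2)).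
    - apply Rpower_mono_base; lra.
    - rewrite Rpower_mult. replace (2 / b * (b / 2)) with 1 by (field; lra).
      rewrite Rpower_1 by lra. lra. }
  assert (Ez2 : z ^ 2 = Rpower (alpha x y) b).
  { unfold z. simpl. rewrite Rmult_1_r, <- Rpower_plus. f_equal. field. }
  destruct BD as ((X11 & _ & X22 & X13 & _) & (_ & X24 & X33 & _ & X44)).
  destruct BH as ((Y11 & _ & Y22 & Y13 & _) & (_ & Y24 & Y33 & _ & Y44)).
  cbn [g11 g12 g22 g13 g23 g14 g24 g33 g34 g44 gsub] in X11, X22, X13, X24, X33, X44.
  assert (Pm : forall u v, 0 < u -> 0 < v -> 0 < u * v) by (intros; pos).
  assert (P1m : forall u v, 0 < u -> 0 < v -> 0 < 1 * (u * v)) by (intros; pos).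
  assert (V11 : g11 (binG b x y) = m1 * m1) by (rewrite <- Em1; reflexivity).
  assert (V22 : g22 (binG b x y) = m2 * m2) by (rewrite <- Em2; reflexivity).
  assert (VF1 : point_det1 (binG b x y) = b * (m1 ^ 2 * m3 ^ 2)).
  { unfold point_det1, binG. simpl. rewrite Em1. fold p. unfold m3.
    replace (1 - x * x) with p by reflexivity.
    replace (x * x) with (1 - p) by (unfold p; ring).
    replace (x * (b * (m1 * m1) / p) * (x * (b * (m1 * m1) / p) * 1)) with
      ((x * x) * (b * (m1 * m1) / p) ^ 2) by ring.
    replace (x * x) with (1 - p) by (unfold p; ring). field. lra. }
  assert (VF2 : point_det2 (binG b x y) = b * (m2 ^ 2 * m4 ^ 2)).
  { unfold point_det2, binG. simpl. rewrite Em2. fold q. unfold m4.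
    replace (y * y) with (1 - q) by (unfold q; ring).
    replace (y * (b * (m2 * m2) / q) * (y * (b * (m2 * m2) / q) * 1)) with
      ((y * y) * (b * (m2 * m2) / q) ^ 2) by ring.
    replace (y * y) with (1 - q) by (unfold q; ring). field. lra. }
  assert (A11 : 1 / 2 * (m1 * m1) <= g11 G).
  { apply Rabs_le_between in X11. rewrite V11 in X11. pose proof (Pm m1 m1 Hm1 Hm1).
    assert (4 * eta * (m1 * m1) <= 1 / 2 * (m1 * m1)) by mono. lra. }
  assert (A22 : 1 / 2 * (m2 * m2) <= g22 G).
  { apply Rabs_le_between in X22. rewrite V22 in X22. pose proof (Pm m2 m2 Hm2 Hm2).
    assert (4 * eta * (m2 * m2) <= 1 / 2 * (m2 * m2)) by mono. lra. }
  assert (VAR : forall u1 u3 s t e v1 v3 v13, 0 < u1 -> 0 < u3 ->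
     Rabs (s - v1) <= 4 * eta * (1 * (u1 * u1)) -> Rabs (t - v3) <= 4 * eta * (1 * (u3 * u3)) ->
     Rabs (e - v13) <= 4 * eta * (1 * (u1 * u3)) ->
     Rabs v1 <= 4 * M * (1 * (u1 * u1)) -> Rabs v3 <= 4 * M * (1 * (u3 * u3)) ->
     Rabs v13 <= 4 * M * (1 * (u1 * u3)) ->
     Rabs ((s * t - e ^ 2) - (v1 * v3 - v13 ^ 2)) <= b / 2 * (u1 ^ 2 * u3 ^ 2)).
  { intros u1 u3 s t e v1 v3 v13 Hu1 Hu3 S1 S3 S13 T1 T3 T13.
    destruct (prod2_pert s t v1 v3 (4 * M) (4 * eta) (1 * (u1 * u1)) (1 * (u3 * u3))) as (R1 & _ & _);
      auto; try lra.
    destruct (prod2_pert e e v13 v13 (4 * M) (4 * eta) (1 * (u1 * u3)) (1 * (u1 * u3))) as (R2 & _ & _);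
      auto; try lra.
    apply Rle_trans with (24 * B * eta * (u1 ^ 2 * u3 ^ 2)).
    - replace (s * t - e ^ 2 - (v1 * v3 - v13 ^ 2)) with ((s * t - v1 * v3) - (e * e - v13 * v13)) by ring.
      eapply Rle_trans; [apply Rabs_triang|]. rewrite Rabs_Ropp.
      assert (0 <= eta * (u1 ^ 2 * u3 ^ 2))
        by (apply Rmult_le_pos; [lra|apply Rmult_le_pos; nneg]).
      unfold B. lra.
    - apply Rmult_le_compat_r; [apply Rmult_le_pos; nneg|].
      apply Rle_trans with (24 * B * (b / (48 * B))).
      + mono.
      + right. field. lra. }
  assert (F1 := VAR m1 m3 _ _ _ _ _ _ Hm1 Hm3 X11 X33 X13 Y11 Y33 Y13).
  assert (F2 := VAR m2 m4 _ _ _ _ _ _ Hm2 Hm4 X22 X44 X24 Y22 Y44 Y24).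
  fold (point_det1 G) in F1. fold (point_det2 G) in F2.
  fold (point_det1 (binG b x y)) in F1. fold (point_det2 (binG b x y)) in F2.
  rewrite VF1 in F1. rewrite VF2 in F2.
  apply Rabs_le_between in F1, F2.
  assert (P13 : 0 < m1 ^ 2 * m3 ^ 2) by (apply Pm; pos).
  assert (P24 : 0 < m2 ^ 2 * m4 ^ 2) by (apply Pm; pos).
  assert (P11 := Pm m1 m1 Hm1 Hm1). assert (P22 := Pm m2 m2 Hm2 Hm2).
  assert (Q1 : c * (m1 ^ 2 * m3 ^ 2) <= point_det1 G).
  { assert (c * (m1 ^ 2 * m3 ^ 2) <= b / 2 * (m1 ^ 2 * m3 ^ 2)) by mono. lra. }
  assert (Q2 : c * (m2 ^ 2 * m4 ^ 2) <= point_det2 G).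
  { assert (c * (m2 ^ 2 * m4 ^ 2) <= b / 2 * (m2 ^ 2 * m4 ^ 2)) by mono. lra. }
  destruct (GD m1 m2 m3 m4 G z Hm1 Hm2 Hm3 Hm4 ltac:(lra) BG Z12 Z23 Z14 Z34)
    as (PD & PE1 & PE2 & e & He & EE); auto.
  { assert (c * (m1 * m1) <= 1 / 2 * (m1 * m1)) by mono. lra. }
  { assert (c * (m2 * m2) <= 1 / 2 * (m2 * m2)) by mono. lra. }
  split; [exact PD|]. split; [exact PE1|]. split; [exact PE2|].
  assert (G1 : 0 < g11 G) by lra. assert (G2 : 0 < g22 G) by lra.
  assert (W1 : 0 < point_det1 G) by (eapply Rlt_le_trans; [|exact Q1]; apply Pm; lra).
  assert (W2 : 0 < point_det2 G) by (eapply Rlt_le_trans; [|exact Q2]; apply Pm; lra).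
  split; [exact G1|]. split; [exact G2|]. split; [exact W1|]. split; [exact W2|].
  set (rt := sqrt (point_det1 G * point_det2 G) / (g11 G * g22 G)) in *.
  assert (Hrt : 0 <= rt * (p * q) <= 6 * b).
  { assert (Hgg : 0 < g11 G * g22 G) by auto.
    assert (S1 : sqrt (point_det1 G * point_det2 G) <= 3 / 2 * b * (m1 * m3 * (m2 * m4))).
    { assert (Hmm : 0 < m1 * m3 * (m2 * m4)) by auto.
      rewrite <- (sqrt_square (3 / 2 * b * (m1 * m3 * (m2 * m4)))) by nneg.
      apply sqrt_le_1_alt.
      replace (3 / 2 * b * (m1 * m3 * (m2 * m4)) * (3 / 2 * b * (m1 * m3 * (m2 * m4))))
        with ((3 / 2 * b * (m1 ^ 2 * m3 ^ 2)) * (3 / 2 * b * (m2 ^ 2 * m4 ^ 2))) by ring.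
      mono. }
    split.
    - apply Rmult_le_pos; [|apply Rlt_le; auto]. unfold rt.
      apply Rmult_le_pos; [apply sqrt_pos|nneg].
    - apply Rmult_le_reg_r with (g11 G * g22 G); [lra|].
      replace (rt * (p * q) * (g11 G * g22 G)) with (sqrt (point_det1 G * point_det2 G) * (p * q))
        by (unfold rt; field; lra).
      apply Rle_trans with (3 / 2 * b * (m1 * m3 * (m2 * m4)) * (p * q)).
      + apply Rmult_le_compat_r; [apply Rlt_le; auto|exact S1].
      + replace (3 / 2 * b * (m1 * m3 * (m2 * m4)) * (p * q))
          with (6 * b * ((1 / 2 * (m1 * m1)) * (1 / 2 * (m2 * m2)))) by (unfold m3, m4; field; lra).
        apply Rmult_le_compat_l; [lra|]. mono. }
  exists (rt * (p * q) * e). split.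
  - rewrite Rabs_mult, (Rabs_right (rt * (p * q))) by lra. rewrite <- Ez2.
    replace (6 * b * C * z ^ 2) with (6 * b * (C * z ^ 2)) by ring.
    apply Rmult_le_compat; try lra. apply Rabs_pos.
  - rewrite EE. replace (1 - x ^ 2) with p by (unfold p; ring).
    replace (1 - y ^ 2) with q by (unfold q; ring). field. lra.
Qed.

(** * Moments of the error of the weights *)

Lemma exp_le_mono : forall u v, u <= v -> exp u <= exp v.
Proof. intros u v [H| ->]; [left; apply exp_increasing; exact H|lra]. Qed.

Lemma exp_le_1 : forall u, u <= 0 -> exp u <= 1.
Proof. intros u Hu. rewrite <- exp_0. apply exp_le_mono. exact Hu. Qed.

Lemma one_minus_exp_neg : forall u, 0 <= u <= 1 -> u / 2 <= 1 - exp (- u).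
Proof.
  intros u Hu. pose proof (exp_ineq1_le u) as H.
  assert (exp (- u) <= / (1 + u)).
  { rewrite exp_Ropp. apply Rinv_le_contravar; lra. }
  assert (/ (1 + u) <= 1 - u / 2).
  { apply Rmult_le_reg_r with (1 + u); [lra|]. rewrite Rinv_l by lra. nra. }
  lra.
Qed.

Lemma binK_le : forall b k s t, 0 < b -> 0 < k -> s < 1 -> t < 1 -> 1 - t <= k * (1 - s) ->
  binK b s <= Rpower k b * binK b t.
Proof.
  intros b k s t Hb Hk Hs Ht H.
  pose proof (binK_decr b k s t Hb Hk Hs Ht H) as E.
  rewrite Rpower_Ropp in E. pose proof (Rpower_pos k b).
  apply Rmult_le_reg_l with (/ Rpower k b); [pos|].
  rewrite <- Rmult_assoc, Rinv_l, Rmult_1_l by lra. exact E.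
Qed.

(** The smallness conditions under which the first [L] indices (second and third
    condition) and the indices beyond [n] (last one) are negligible at [t]. *)
Definition good_range (b B L : R) (n : nat) (t : R) : Prop :=
  1 / 16 <= t < 1 /\ 2 * L * (1 - t) <= 1 /\
  B * exp 1 * L * Rpower (2 * L * (1 - t)) b <= 1 /\
  16 * B * Rpower 2 b * L * sqrt t ^ n <= 1.

(** Rankin's trick: [t ^ j] is at most [e exp (- 1 / L) ^ j] for [j < L], and
    [sqrt t ^ n * sqrt t ^ j] for [j > n].  Both exceptional parts are then
    bounded by complete moments of [binc b] at other points. *)
Lemma moment_bound_of_errors : forall b, 0 < b -> exists M, 0 < M /\
  forall B L n t eta e, 1 <= B -> 1 <= L -> good_range b B L n t ->
  / L <= eta ->
  (forall j, Rabs (e j) <= B * binc b j) ->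
  (forall j, L <= INR j -> (j <= n)%nat -> Rabs (e j) <= eta * binc b j) ->
  moment_bound b (M * eta) t e.
Proof.
  intros b Hb. destruct (risefact_bounded b Hb) as (M & HM & HR).
  exists (3 * M). split; [lra|].
  intros B L n t eta e HB HL (Ht & R1 & R2 & R3) Heta He1 He2 s Hs.
  set (rho := sqrt t) in *.
  assert (Hrr : rho * rho = t) by (apply sqrt_sqrt; lra).
  assert (Hr0 : 0 < rho) by (unfold rho; pos).
  assert (Hr1 : rho < 1) by (unfold rho; rewrite <- sqrt_1; apply sqrt_lt_1; lra).
  assert (HiL : 0 < / L) by pos.
  assert (HiL1 : / L <= 1) by (rewrite <- Rinv_1; apply Rinv_le_contravar; lra).
  set (t' := exp (- / L)).
  assert (Ht'0 : 0 < t') by apply exp_pos.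
  assert (Ht'1 : / L / 2 <= 1 - t') by (apply one_minus_exp_neg; lra).
  assert (Hrn : 0 < rho ^ n) by pos.
  pose proof (exp_pos 1) as Hexp.
  destruct (binc_moment_series b s t Hb ltac:(lra)) as (l1 & S1 & Q1).
  destruct (binc_moment_series b s t' Hb ltac:(lra)) as (l2 & S2 & Q2).
  destruct (binc_moment_series b s rho Hb ltac:(lra)) as (l3 & S3 & Q3).
  destruct (is_series_dom (fun j => Rabs (e j) * INR j ^ s * t ^ j)
    (fun j => eta * (binc b j * INR j ^ s * t ^ j) +
      (B * exp 1 * (binc b j * INR j ^ s * t' ^ j) + B * rho ^ n * (binc b j * INR j ^ s * rho ^ j)))
    (eta * l1 + (B * exp 1 * l2 + B * rho ^ n * l3))) as (l & Sl & Ql).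
  - intros j. pose proof (Rabs_pos (e j)) as A0. pose proof (pos_INR j) as AJ.
    assert (A1 : 0 <= INR j ^ s) by (apply pow_le; auto).
    assert (A2 : 0 < t ^ j) by pos.
    assert (A3 : 0 < t' ^ j) by pos.
    assert (A4 : 0 < rho ^ j) by pos.
    pose proof (binc_pos b j Hb) as A5.
    split; [nneg|].
    set (h := binc b j * INR j ^ s).
    assert (Hh : 0 <= h) by (unfold h; nneg).
    assert (W1 : 0 <= eta * (h * t ^ j)) by (apply Rmult_le_pos; [lra|nneg]).
    assert (W2 : 0 <= B * exp 1 * (h * t' ^ j))
      by nneg.
    assert (W3 : 0 <= B * rho ^ n * (h * rho ^ j))
      by nneg.
    assert (U : forall k, Rabs (e j) <= k * binc b j ->
       Rabs (e j) * INR j ^ s * t ^ j <= k * (h * t ^ j)).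
    { intros k Hk. unfold h. replace (k * (binc b j * INR j ^ s * t ^ j)) with
        (k * binc b j * INR j ^ s * t ^ j) by ring.
      apply Rmult_le_compat_r; [lra|]. mono. }
    destruct (Rlt_le_dec (INR j) L) as [HjL|HjL].
    + apply Rle_trans with (B * exp 1 * (h * t' ^ j)); [|lra].
      eapply Rle_trans; [apply (U B (He1 j))|].
      replace (B * exp 1 * (h * t' ^ j)) with (B * h * (exp 1 * t' ^ j)) by ring.
      rewrite <- Rmult_assoc. apply Rmult_le_compat_l; [nneg|].
      apply Rle_trans with 1.
      * rewrite <- (pow1 j). apply pow_incr. lra.
      * unfold t'. rewrite <- Rpower_pow by apply exp_pos. unfold Rpower. rewrite ln_exp.
        rewrite <- exp_plus.
        assert (0 <= 1 + INR j * - / L).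
        { assert (INR j * / L <= L * / L) by mono.
          rewrite Rinv_r in H by lra. lra. }
        pose proof (exp_ineq1_le (1 + INR j * - / L)). lra.
    + destruct (Compare_dec.le_lt_dec j n) as [Hjn|Hjn].
      * apply Rle_trans with (eta * (h * t ^ j)); [|lra]. apply U. apply He2; auto.
      * apply Rle_trans with (B * rho ^ n * (h * rho ^ j)); [|lra].
        eapply Rle_trans; [apply (U B (He1 j))|].
        replace (B * rho ^ n * (h * rho ^ j)) with (B * (h * (rho ^ n * rho ^ j))) by ring.
        apply Rmult_le_compat_l; [lra|]. apply Rmult_le_compat_l; [lra|].
        rewrite <- Hrr, Rpow_mult_distr. apply Rmult_le_compat_r; [lra|].
        replace j with (n + (j - n))%nat by lia. rewrite pow_add.
        rewrite <- (Rmult_1_r (rho ^ n)) at 2. apply Rmult_le_compat_l; [lra|].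
        rewrite <- (pow1 (j - n)). apply pow_incr. lra.
  - apply (is_series_plus (V := R_NormedModule)); [apply is_series_scal_R; exact S1|].
    apply (is_series_plus (V := R_NormedModule)); apply is_series_scal_R; assumption.
  - exists l. split; [exact Sl|]. destruct Ql as [_ Ql]. eapply Rle_trans; [exact Ql|].
    set (T := binK b t * (/ (1 - t)) ^ s).
    assert (It : 0 < / (1 - t)) by pos.
    assert (HT : 0 < T) by (unfold T; apply Rmult_lt_0_compat; [apply binK_pos|pos]).
    assert (HRs := HR s Hs).
    assert (risefact_pos' := risefact_pos b s Hb).
    assert (X : forall l' u, 0 <= l' <= risefact b s * u -> 0 <= u -> l' <= M * u).
    { intros l' u Hl' Hu. eapply Rle_trans; [apply Hl'|]. mono. }
    assert (E1 : l1 <= M * T) by (apply X; [exact Q1|lra]).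
    assert (E2 : B * exp 1 * l2 <= M * (/ L * T)).
    { assert (V : binK b t' * (/ (1 - t')) ^ s <= Rpower (2 * L * (1 - t)) b * T).
      { unfold T. rewrite <- Rmult_assoc.
        assert (0 < 2 * L * (1 - t)) by pos.
        assert (HL2 : 1 <= 2 * L * (1 - t')).
        { assert (2 * L * (/ L / 2) <= 2 * L * (1 - t')) by mono.
          replace (2 * L * (/ L / 2)) with 1 in H0 by (field; lra). lra. }
        apply Rmult_le_compat.
        - apply Rlt_le, binK_pos.
        - apply pow_le, Rlt_le, Rinv_0_lt_compat; lra.
        - apply binK_le; try lra.
          replace (2 * L * (1 - t) * (1 - t')) with ((1 - t) * (2 * L * (1 - t'))) by ring.
          rewrite <- (Rmult_1_r (1 - t)) at 1. mono.
        - apply pow_incr. split; [nneg|].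
          apply Rinv_le_contravar; [lra|].
          apply Rmult_le_reg_l with (2 * L); lra. }
      assert (l2 <= M * (Rpower (2 * L * (1 - t)) b * T)).
      { eapply Rle_trans; [apply X; [exact Q2|]|apply Rmult_le_compat_l; [lra|exact V]].
        apply Rmult_le_pos; [apply Rlt_le, binK_pos|].
        apply pow_le, Rlt_le, Rinv_0_lt_compat; lra. }
      apply Rle_trans with (B * exp 1 * (M * (Rpower (2 * L * (1 - t)) b * T))).
      { apply Rmult_le_compat_l; [nneg|lra]. }
      replace (B * exp 1 * (M * (Rpower (2 * L * (1 - t)) b * T))) with
        (M * (/ L * T * (B * exp 1 * L * Rpower (2 * L * (1 - t)) b))) by (field; lra).
      apply Rmult_le_compat_l; [lra|]. rewrite <- (Rmult_1_r (/ L * T)) at 2.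
      apply Rmult_le_compat_l; [nneg|exact R2]. }
    assert (E3 : B * rho ^ n * l3 <= M * (/ L * T)).
    { assert (H1r : 1 - t <= 2 * (1 - rho)).
      { rewrite <- Hrr. assert (0 <= (1 - rho) * (1 - rho)) by nneg. lra. }
      assert (V : binK b rho * (/ (1 - rho)) ^ s <= Rpower 2 b * 16 * T).
      { unfold T. replace (Rpower 2 b * 16 * (binK b t * (/ (1 - t)) ^ s)) with
          (Rpower 2 b * binK b t * (16 * (/ (1 - t)) ^ s)) by ring.
        apply Rmult_le_compat.
        - apply Rlt_le, binK_pos.
        - apply pow_le, Rlt_le, Rinv_0_lt_compat; lra.
        - apply binK_le; lra.
        - apply Rle_trans with ((2 * / (1 - t)) ^ s).
          + apply pow_incr. split; [nneg|].
            replace (2 * / (1 - t)) with (/ ((1 - t) / 2)) by (field; lra).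
            apply Rinv_le_contravar; lra.
          + rewrite Rpow_mult_distr. apply Rmult_le_compat_r; [nneg|].
            replace 16 with (2 ^ 4) by ring. apply Rle_pow; [lra|exact Hs]. }
      assert (l3 <= M * (Rpower 2 b * 16 * T)).
      { eapply Rle_trans; [apply X; [exact Q3|]|apply Rmult_le_compat_l; [lra|exact V]].
        apply Rmult_le_pos; [apply Rlt_le, binK_pos|].
        apply pow_le, Rlt_le, Rinv_0_lt_compat; lra. }
      apply Rle_trans with (B * rho ^ n * (M * (Rpower 2 b * 16 * T))).
      { apply Rmult_le_compat_l; [nneg|lra]. }
      replace (B * rho ^ n * (M * (Rpower 2 b * 16 * T))) with
        (M * (/ L * T * (16 * B * Rpower 2 b * L * rho ^ n))) by (field; lra).
      apply Rmult_le_compat_l; [lra|]. rewrite <- (Rmult_1_r (/ L * T)) at 2.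
      apply Rmult_le_compat_l; [nneg|exact R3]. }
    assert (F1 : eta * l1 <= eta * (M * T)) by mono.
    assert (F2 : M * (/ L * T) <= eta * (M * T)).
    { replace (M * (/ L * T)) with (/ L * (M * T)) by ring.
      apply Rmult_le_compat_r; [nneg|lra]. }
    lra.
Qed.

(** * The intervals for large n *)

Definition loglog (n : nat) : R := ln (ln (INR n)).

Lemma loglog_unbounded : forall M, exists n0, forall n, (n0 <= n)%nat ->
  M <= loglog n /\ exp (exp M) <= INR n.
Proof.
  intros M. destruct (nfloor_ex (exp (exp M)) (Rlt_le _ _ (exp_pos _))) as [k Hk].
  exists (S k). intros n Hn. assert (H : exp (exp M) <= INR n).
  { apply le_INR in Hn. rewrite S_INR in Hn. lra. }
  split; [|exact H]. unfold loglog.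
  rewrite <- (ln_exp M). apply ln_le; [apply exp_pos|].
  rewrite <- (ln_exp (exp M)). apply ln_le; [apply exp_pos|exact H].
Qed.

Lemma exp_quad : forall u, 0 <= u -> u ^ 2 / 4 <= exp u.
Proof.
  intros u Hu. replace (exp u) with (exp (u / 2) * exp (u / 2))
    by (rewrite <- exp_plus; f_equal; field).
  pose proof (exp_ineq1_le (u / 2)) as H.
  replace (u ^ 2 / 4) with ((u / 2) * (u / 2)) by field.
  mono.
Qed.

(** A neighborhood of [I_ d n], needed to approach its points off the
    diagonal. *)
Definition wide (d : R) (n : nat) (x : R) : Prop :=
  1 - 2 * an d n <= x <= 1 - bn d n / 2.

(** With [L = log log n] and [X = exp (d L / 4)] one has [a_n = exp (- X)] and
    [n b_n = exp X], where [X >= k L ^ 2]: powers of [L] cannot compete. *)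
Lemma range_eventually : forall b B d, 0 < b -> 1 <= B -> 0 < d -> exists n0,
  forall n, (n0 <= n)%nat -> 1 <= loglog n /\ 0 < an d n <= 1 / 8 /\ 0 < bn d n /\
   forall t, 1 - 4 * an d n <= t <= 1 - bn d n / 2 -> good_range b B (loglog n) n t.
Proof.
  intros b B d Hb HB Hd.
  (* from [exp u >= u ^ 2 / 4] at [u = d L / 4] *)
  set (k := (d / 4) ^ 2 / 4).
  assert (Hk : 0 < k) by (unfold k; apply Rdiv_lt_0_compat; [apply pow_lt|]; lra).
  set (c2 := Rabs (ln (B * exp 1)) + 1 + 8 * b).
  set (c3 := Rabs (ln (16 * B * Rpower 2 b)) + 1).
  pose proof (Rabs_pos (ln (B * exp 1))) as Hc2. pose proof (Rabs_pos (ln (16 * B * Rpower 2 b))) as Hc3.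
  destruct (loglog_unbounded (Rmax 1 (Rmax (8 / k) (Rmax (c2 / (b * k)) (4 * c3 / k))))) as [n0 Hn0].
  exists n0. intros n Hn. destruct (Hn0 n Hn) as [HL Hexp]. clear Hn0.
  assert (HM1 := Rmax_l 1 (Rmax (8 / k) (Rmax (c2 / (b * k)) (4 * c3 / k)))).
  assert (HM2 := Rmax_r 1 (Rmax (8 / k) (Rmax (c2 / (b * k)) (4 * c3 / k)))).
  assert (HM3 := Rmax_l (8 / k) (Rmax (c2 / (b * k)) (4 * c3 / k))).
  assert (HM4 := Rmax_r (8 / k) (Rmax (c2 / (b * k)) (4 * c3 / k))).
  assert (HM5 := Rmax_l (c2 / (b * k)) (4 * c3 / k)).
  assert (HM6 := Rmax_r (c2 / (b * k)) (4 * c3 / k)).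
  assert (HnN : 0 < INR n) by (eapply Rlt_le_trans; [apply exp_pos|exact Hexp]).
  set (L := loglog n) in *.
  assert (L1 : 1 <= L) by lra.
  assert (Lk : 8 <= k * L).
  { assert (k * (8 / k) <= k * L) by mono.
    replace (k * (8 / k)) with 8 in H by (field; lra). exact H. }
  assert (L2 : c2 <= b * k * L).
  { assert (0 < b * k) by pos.
    assert (b * k * (c2 / (b * k)) <= b * k * L) by mono.
    replace (b * k * (c2 / (b * k))) with c2 in H0 by (field; lra). exact H0. }
  assert (L3 : c3 <= k * L / 4).
  { assert (k / 4 * (4 * c3 / k) <= k / 4 * L) by mono.
    replace (k / 4 * (4 * c3 / k)) with c3 in H by (field; lra). lra. }
  set (X := exp (d / 4 * L)).
  assert (HX : k * (L * L) <= X).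
  { unfold X. eapply Rle_trans; [|apply exp_quad]; [right; unfold k; field|].
    nneg. }
  assert (Edn : dn d n = exp X) by reflexivity.
  assert (Ean : an d n = exp (- X)) by (unfold an; rewrite Edn, exp_Ropp; reflexivity).
  assert (Han : 0 < an d n) by (rewrite Ean; apply exp_pos).
  assert (Hbn : 0 < bn d n).
  { unfold bn. rewrite Edn. apply Rmult_lt_0_compat; [pos|apply exp_pos]. }
  assert (LE : L <= exp L) by (pose proof (exp_ineq1_le L); lra).
  assert (LE8 : 8 * L <= exp (8 * L)) by (pose proof (exp_ineq1_le (8 * L)); lra).
  assert (HLL : 8 * L <= k * (L * L)).
  { rewrite <- Rmult_assoc. mono. }
  assert (H8 : 8 * L * an d n <= exp (8 * L - k * (L * L))).
  { rewrite Ean. unfold Rminus. rewrite exp_plus. apply Rmult_le_compat;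
      [lra | apply Rlt_le, exp_pos | lra | apply exp_le_mono; lra]. }
  assert (H81 : 8 * L * an d n <= 1).
  { eapply Rle_trans; [exact H8|]. apply exp_le_1; lra. }
  assert (Ha8 : an d n <= 1 / 8).
  { assert (8 * 1 * an d n <= 8 * L * an d n) by mono. lra. }
  split; [exact L1|]. split; [lra|]. split; [exact Hbn|].
  intros t Ht.
  assert (Ht1 : 0 < 1 - t) by lra.
  assert (T0 : 0 < 2 * L * (1 - t)) by pos.
  assert (T1 : 2 * L * (1 - t) <= 8 * L * an d n).
  { replace (8 * L * an d n) with (2 * L * (4 * an d n)) by ring. mono. }
  split; [lra|]. split; [lra|]. split.
  - apply Rle_trans with (exp (ln (B * exp 1)) * exp L * exp (b * (8 * L - k * (L * L)))).
    + pose proof (exp_pos 1). assert (0 < B * exp 1) by pos.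
      rewrite exp_ln by lra.
      apply Rmult_le_compat.
      * nneg.
      * apply Rlt_le, Rpower_pos.
      * mono.
      * unfold Rpower. apply exp_le_mono. apply Rmult_le_compat_l; [lra|].
        rewrite <- (ln_exp (8 * L - k * (L * L))). apply ln_le; lra.
    + rewrite <- !exp_plus. apply exp_le_1.
      pose proof (Rle_abs (ln (B * exp 1))) as HA.
      assert (Rabs (ln (B * exp 1)) * 1 <= Rabs (ln (B * exp 1)) * L) by mono.
      assert (c2 * L <= b * k * L * L) by mono.
      unfold c2 in H0. lra.
  - assert (Hsq : sqrt t <= exp (- ((1 - t) / 2))).
    { rewrite <- (sqrt_square (exp (- ((1 - t) / 2)))) by (apply Rlt_le, exp_pos).
      apply sqrt_le_1_alt. rewrite <- exp_plus.
      pose proof (exp_ineq1_le (- ((1 - t) / 2) + - ((1 - t) / 2))). lra. }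
    assert (Hsn : sqrt t ^ n <= exp (- (exp X / 4))).
    { apply Rle_trans with (exp (- ((1 - t) / 2)) ^ n).
      - apply pow_incr. split; [apply sqrt_pos|exact Hsq].
      - rewrite <- Rpower_pow by apply exp_pos. unfold Rpower. rewrite ln_exp.
        apply exp_le_mono.
        assert (E : INR n * bn d n = exp X) by (unfold bn; rewrite Edn; field; lra).
        assert (INR n * (bn d n / 2) <= INR n * (1 - t)) by mono.
        lra. }
    assert (HeX : k * (L * L) <= exp X) by (pose proof (exp_ineq1_le X); lra).
    assert (HP : 0 < 16 * B * Rpower 2 b)
      by (apply Rmult_lt_0_compat; [lra|apply Rpower_pos]).
    apply Rle_trans with (exp (ln (16 * B * Rpower 2 b)) * exp L * exp (- (k * (L * L) / 4))).
    + rewrite exp_ln by lra. apply Rmult_le_compat.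
      * nneg.
      * apply pow_le, sqrt_pos.
      * mono.
      * eapply Rle_trans; [exact Hsn|]. apply exp_le_mono. lra.
    + rewrite <- !exp_plus. apply exp_le_1.
      pose proof (Rle_abs (ln (16 * B * Rpower 2 b))) as HA.
      assert (Rabs (ln (16 * B * Rpower 2 b)) * 1 <= Rabs (ln (16 * B * Rpower 2 b)) * L)
        by mono.
      assert (c3 * L <= k * L / 4 * L) by mono.
      unfold c3 in H0. lra.
Qed.

(** * Asymptotics of the normalized weights *)

(** The maximum is at least [0] even if its range is empty, so that
    [taun >= 1 / log log n] always holds. *)
Lemma taun_bounds : forall tau C1 c n eps, 0 < loglog n ->
  (forall j, (j <= n)%nat -> loglog n <= INR j ->
     Rabs (Rabs (c n j) / (C1 * Rpower (INR j) tau) - 1) <= eps) -> 0 <= eps ->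
  / loglog n <= taun tau C1 c n <= eps + / loglog n /\
  forall j, (j <= n)%nat -> loglog n <= INR j ->
     Rabs (Rabs (c n j) / (C1 * Rpower (INR j) tau) - 1) <= taun tau C1 c n.
Proof.
  intros tau C1 c n eps HL H Heps. unfold taun. fold (loglog n).
  set (g := fun j => Rabs (Rabs (c n j) / (C1 * Rpower (INR j) tau) - 1)) in *.
  set (l := filter (fun j => if Rle_dec (loglog n) (INR j) then true else false) (seq 0 (S n))).
  assert (Hin : forall j, In j l <-> (j <= n)%nat /\ loglog n <= INR j).
  { intros j. unfold l. rewrite filter_In, in_seq.
    destruct (Rle_dec (loglog n) (INR j)); split; intros [A1 A2]; split; auto; try lia;
      try discriminate; contradiction. }
  assert (P : 0 < / loglog n) by (apply Rinv_0_lt_compat; exact HL).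
  assert (HM : 0 <= RList.MaxRlist (map g l) <= eps).
  { destruct l as [|j0 l'] eqn:El; [simpl; lra|].
    assert (HI : In (RList.MaxRlist (map g (j0 :: l'))) (map g (j0 :: l'))).
    { apply RList.MaxRlist_P2. exists (g j0). left. reflexivity. }
    apply in_map_iff in HI. destruct HI as [j [E Hj]]. rewrite <- E.
    apply Hin in Hj. split; [apply Rabs_pos|apply H; apply Hj]. }
  split; [lra|]. intros j Hj HjL.
  assert (g j <= RList.MaxRlist (map g l)).
  { apply RList.MaxRlist_P1. apply in_map. apply Hin. auto. }
  fold (g j). lra.
Qed.

(** Extended by [0] beyond [n], so that the kernel becomes a full series. *)
Definition weight (A : R) (c : nat -> nat -> R) (n j : nat) : R :=
  if Nat.leb j n then c n j ^ 2 / A else 0.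

Lemma exp_minus_1_bound : forall v V, Rabs v <= V -> Rabs (exp v - 1) <= V * exp V.
Proof.
  intros v V Hv. apply Rabs_le_between in Hv.
  pose proof (exp_ineq1_le v). pose proof (exp_ineq1_le (- v)).
  assert (E : exp v * exp (- v) = 1) by (rewrite <- exp_plus, Rplus_opp_r; apply exp_0).
  assert (HV : 1 <= exp V) by (rewrite <- exp_0; apply exp_le_mono; lra).
  assert (Hle : exp v <= exp V) by (apply exp_le_mono; lra).
  pose proof (exp_pos v).
  assert (V * 1 <= V * exp V) by mono.
  apply Rabs_le_between. split; [lra|].
  assert (exp v * (1 - v) <= 1) by (rewrite <- E; mono).
  assert (exp v * v <= exp V * V).
  { destruct (Rle_dec 0 v).
    - mono.
    - apply Rle_trans with 0; [|nneg].
      assert (0 <= exp v * - v) by nneg. lra. }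
  lra.
Qed.

Lemma positive_lower_bound : forall (h : nat -> R) N, (forall j, 0 < h j) ->
  exists dlt, 0 < dlt /\ forall j, (j <= N)%nat -> dlt <= h j.
Proof.
  intros h N Hh. induction N as [|N [dl [Hd IH]]].
  - exists (h O). split; auto. intros j Hj. replace j with O by lia. lra.
  - exists (Rmin dl (h (S N))). split; [apply Rmin_glb_lt; auto|].
    intros j Hj. destruct (Nat.eq_dec j (S N)) as [->|Hne]; [apply Rmin_r|].
    eapply Rle_trans; [apply Rmin_l|]. apply IH. lia.
Qed.

Lemma null_seq_bounded : forall o : nat -> R, is_lim_seq o 0 -> exists O, 0 <= O /\ forall j, o j <= O.
Proof.
  intros o Ho. apply is_lim_seq_spec in Ho. destruct (Ho (mkposreal 1 Rlt_0_1)) as [N HN].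
  simpl in HN.
  assert (F : exists O, 0 <= O /\ forall j, (j <= N)%nat -> o j <= O).
  { clear HN. induction N as [|N [O [HO IH]]].
    - exists (Rmax 0 (o O)). split; [apply Rmax_l|]. intros j Hj.
      replace j with 0%nat by lia. apply Rmax_r.
    - exists (Rmax O (o (S N))). split; [eapply Rle_trans; [exact HO|apply Rmax_l]|].
      intros j Hj. destruct (Nat.eq_dec j (S N)) as [->|Hne]; [apply Rmax_r|].
      eapply Rle_trans; [apply IH; lia|apply Rmax_l]. }
  destruct F as [O [HO F]]. exists (Rmax O 1). split; [eapply Rle_trans; [exact HO|apply Rmax_l]|].
  intros j. destruct (Compare_dec.le_lt_dec j N) as [H|H].
  - eapply Rle_trans; [apply F; exact H|apply Rmax_l].
  - specialize (HN j ltac:(lia)). apply Rabs_lt_between in HN.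
    apply Rle_trans with 1; [lra|apply Rmax_r].
Qed.

(** The constant [A] is [C1 ^ 2 Gamma b], which makes [c_j ^ 2 / A] asymptotic to
    [binc b j].  The crude bound by [B] covers the indices that the asymptotics
    do not reach; the relative error [O(1 / j)] of [binc_asymp] is absorbed by
    the term [1 / log log n] of [taun]. *)
Lemma weights_close : forall (tau C1 C2 N0 : R) (o : nat -> R),
  - (1 / 2) < tau -> 0 < C1 -> 0 < C2 -> 0 < N0 -> is_lim_seq o 0 ->
  exists A B Cw, 0 < A /\ 1 <= B /\ 1 <= Cw /\
  forall eps, 0 < eps -> exists n0, forall c, coeff_assumption tau C1 C2 N0 o c ->
   forall n, (n0 <= n)%nat -> 1 <= loglog n ->
   / loglog n <= taun tau C1 c n <= eps /\
   (forall j, Rabs (weight A c n j - binc (2 * tau + 1) j) <= B * binc (2 * tau + 1) j) /\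
   (taun tau C1 c n <= 1 -> forall j, loglog n <= INR j -> (j <= n)%nat ->
     Rabs (weight A c n j - binc (2 * tau + 1) j) <= Cw * taun tau C1 c n * binc (2 * tau + 1) j).
Proof.
  intros tau C1 C2 N0 o Ht HC1 HC2 HN0 Ho.
  set (b := 2 * tau + 1). assert (Hb : 0 < b) by (unfold b; lra).
  destruct (binc_asymp b Hb) as (kap & Cb & Hkap & HCb & AS).
  set (A := C1 ^ 2 / kap).
  assert (HC12 : 0 < C1 ^ 2) by pos.
  assert (HA : 0 < A) by (unfold A; pos).
  destruct (null_seq_bounded o Ho) as (O & HO & Hbd).
  destruct (nfloor_ex N0 ltac:(lra)) as [N1 HN1].
  destruct (positive_lower_bound (binc b) N1 (fun j => binc_pos b j Hb)) as (dl & Hdl & HDL).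
  assert (HC22 : 0 < C2 ^ 2) by pos.
  (* the three terms serve the indices [j > n], [N0 <= j <= n] and [j < N0] *)
  set (BB := 1 + (1 + O) ^ 2 * exp Cb + C2 ^ 2 / A / dl).
  assert (Hq1 : 0 <= (1 + O) ^ 2 * exp Cb)
    by (apply Rmult_le_pos; [apply pow2_ge_0|apply Rlt_le, exp_pos]).
  assert (Hq2 : 0 < C2 ^ 2 / A / dl) by (repeat pos).
  exists A, BB, (3 + 4 * Cb * exp Cb).
  assert (Hexp := exp_pos Cb).
  split; [exact HA|]. split; [unfold BB; lra|].
  split; [assert (0 < Cb * exp Cb) by pos; lra|].
  (* both weights in terms of the same power of the index *)
  assert (REP : forall cj j e, 0 < INR j -> Rabs cj = C1 * Rpower (INR j) tau * (1 + e) ->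
     exists v, Rabs v <= Cb * / INR j /\ 1 <= INR j /\
     cj ^ 2 / A = binc b j * ((1 + e) ^ 2 * exp (- v))).
  { intros cj j e Hj Hc. assert (Hj1 : (1 <= j)%nat)
      by (destruct j as [|j]; [simpl in Hj; lra|lia]).
    destruct (AS j Hj1) as (v & Hv & Ev). exists v. split; [exact Hv|].
    split; [apply (le_INR 1 j Hj1)|].
    rewrite Ev, <- (pow2_abs cj), Hc.
    replace (b - 1) with (tau + tau) by (unfold b; ring). rewrite Rpower_plus.
    replace (kap * (Rpower (INR j) tau * Rpower (INR j) tau) * exp v * ((1 + e) ^ 2 * exp (- v)))
      with (kap * (Rpower (INR j) tau * Rpower (INR j) tau) * (1 + e) ^ 2 * (exp v * exp (- v))) by ring.
    rewrite <- exp_plus, Rplus_opp_r, exp_0. unfold A. field. lra. }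
  intros eps Heps.
  assert (Ho' := Ho). apply is_lim_seq_spec in Ho'.
  destruct (Ho' (mkposreal (eps / 2) ltac:(lra))) as [J0 HJ0]. simpl in HJ0.
  destruct (loglog_unbounded (Rmax N0 (Rmax (INR J0) (2 / eps)))) as [n0 Hn0].
  exists n0. intros c Hc n Hn HL1. destruct (Hn0 n Hn) as [HL _].
  assert (M1 := Rmax_l N0 (Rmax (INR J0) (2 / eps))).
  assert (M2 := Rmax_r N0 (Rmax (INR J0) (2 / eps))).
  assert (M3 := Rmax_l (INR J0) (2 / eps)). assert (M4 := Rmax_r (INR J0) (2 / eps)).
  assert (HiL : / loglog n <= eps / 2).
  { replace (eps / 2) with (/ (2 / eps)) by (field; lra). apply Rinv_le_contravar; [|lra].
    pos. }
  assert (Pw : forall j, 0 < C1 * Rpower (INR j) tau)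
    by (intros; apply Rmult_lt_0_compat; [lra|apply Rpower_pos]).
  destruct (taun_bounds tau C1 c n (eps / 2)) as [TB TJ]; [lra| |lra|].
  { intros j Hj HjL. destruct (Hc n j Hj) as [Hc1 _]. destruct (Hc1 ltac:(lra)) as (e & He & Ee).
    rewrite Ee. specialize (Pw j).
    replace (C1 * Rpower (INR j) tau * (1 + e) / (C1 * Rpower (INR j) tau) - 1) with e
      by (field; split; [apply Rgt_not_eq, Rpower_pos|lra]).
    eapply Rle_trans; [exact He|].
    assert (HjJ : (J0 <= j)%nat) by (apply INR_le; lra).
    specialize (HJ0 j HjJ). apply Rabs_lt_between in HJ0. lra. }
  split; [lra|]. split.
  - intros j. unfold weight. pose proof (binc_pos b j Hb) as Hh. fold b in Hh.
    destruct (Nat.leb_spec j n) as [Hjn|Hjn].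
    2:{ unfold Rminus. rewrite Rplus_0_l, Rabs_Ropp, Rabs_right by lra.
        rewrite <- (Rmult_1_l (binc b j)) at 1. apply Rmult_le_compat_r; [lra|unfold BB; lra]. }
    assert (U : 0 <= c n j ^ 2 / A <= (BB - 1) * binc b j ->
       Rabs (c n j ^ 2 / A - binc b j) <= BB * binc b j).
    { intros [U1 U2]. apply Rabs_le_between.
      assert (1 * binc b j <= BB * binc b j) by (apply Rmult_le_compat_r; [lra|unfold BB; lra]). lra. }
    apply U. split; [apply Rmult_le_pos; [apply pow2_ge_0|nneg]|].
    destruct (Hc n j Hjn) as [Hc1 Hc2]. destruct (Rle_lt_dec N0 (INR j)) as [Hj|Hj].
    + destruct (Hc1 Hj) as (e & He & Ee).
      destruct (REP (c n j) j e ltac:(lra) Ee) as (v & Hv & Hj1 & Ew). rewrite Ew.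
      rewrite (Rmult_comm (BB - 1)). apply Rmult_le_compat_l; [lra|].
      apply Rle_trans with ((1 + O) ^ 2 * exp Cb); [|unfold BB; lra].
      assert (HeO : Rabs e <= O) by (eapply Rle_trans; [exact He|apply Hbd]).
      apply Rmult_le_compat.
      * apply pow2_ge_0.
      * apply Rlt_le, exp_pos.
      * rewrite <- (pow2_abs (1 + e)). apply pow_incr. split; [apply Rabs_pos|].
        eapply Rle_trans; [apply Rabs_triang|]. rewrite Rabs_R1. lra.
      * apply exp_le_mono.
        assert (Cb * / INR j <= Cb * 1).
        { apply Rmult_le_compat_l; [lra|]. rewrite <- Rinv_1. apply Rinv_le_contravar; lra. }
        apply Rabs_le_between in Hv. lra.
    + specialize (Hc2 Hj).
      assert (HjN : (j <= N1)%nat).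
      { assert (INR j < INR (S N1)) by (rewrite S_INR; lra). apply INR_lt in H. lia. }
      apply Rle_trans with (C2 ^ 2 / A / dl * dl).
      * replace (C2 ^ 2 / A / dl * dl) with (C2 ^ 2 / A) by (field; lra).
        apply Rmult_le_compat_r; [nneg|].
        rewrite <- (pow2_abs (c n j)). apply pow_incr. split; [apply Rabs_pos|exact Hc2].
      * apply Rmult_le_compat; try lra; [unfold BB; lra|apply HDL; exact HjN].
  - intros HT1 j HjL Hjn. pose proof (binc_pos b j Hb) as Hh. fold b in Hh.
    unfold weight. destruct (Nat.leb_spec j n) as [_|K]; [|lia].
    specialize (TJ j Hjn HjL). set (T := taun tau C1 c n) in *.
    set (e := Rabs (c n j) / (C1 * Rpower (INR j) tau) - 1) in *.
    assert (Ee : Rabs (c n j) = C1 * Rpower (INR j) tau * (1 + e)).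
    { unfold e. specialize (Pw j). field. split; [apply Rgt_not_eq, Rpower_pos|lra]. }
    destruct (REP (c n j) j e ltac:(lra) Ee) as (v & Hv & Hj1 & Ew). rewrite Ew.
    replace (binc b j * ((1 + e) ^ 2 * exp (- v)) - binc b j)
      with (((1 + e) ^ 2 * (exp (- v) - 1) + (e * (2 + e))) * binc b j) by ring.
    rewrite Rabs_mult, (Rabs_right (binc b j)) by lra.
    apply Rmult_le_compat_r; [lra|].
    assert (HvT : Rabs (- v) <= Cb * T).
    { rewrite Rabs_Ropp. eapply Rle_trans; [exact Hv|]. apply Rmult_le_compat_l; [lra|].
      eapply Rle_trans; [|apply TB]. apply Rinv_le_contravar; lra. }
    assert (HT0 : 0 < T) by (eapply Rlt_le_trans; [|apply TB]; pos).
    assert (HvE : Rabs (exp (- v) - 1) <= Cb * T * exp Cb).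
    { eapply Rle_trans; [apply (exp_minus_1_bound _ _ HvT)|].
      apply Rmult_le_compat_l; [nneg|]. apply exp_le_mono.
      rewrite <- (Rmult_1_r Cb) at 2. mono. }
    assert (He1 : Rabs e <= 1) by lra.
    eapply Rle_trans; [apply Rabs_triang|]. rewrite !Rabs_mult.
    assert (E4 : Rabs ((1 + e) ^ 2) <= 4).
    { apply Rabs_le_between in He1. rewrite Rabs_right by (apply Rle_ge, pow2_ge_0).
      replace 4 with (2 ^ 2) by ring. apply pow_incr. lra. }
    assert (E3 : Rabs (2 + e) <= 3).
    { eapply Rle_trans; [apply Rabs_triang|]. rewrite (Rabs_right 2) by lra. lra. }
    assert (Rabs ((1 + e) ^ 2) * Rabs (exp (- v) - 1) <= 4 * (Cb * T * exp Cb))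
      by (apply Rmult_le_compat; auto; apply Rabs_pos).
    assert (Rabs e * Rabs (2 + e) <= T * 3) by (apply Rmult_le_compat; auto; apply Rabs_pos).
    lra.
Qed.

(** * The kernel of the random polynomial *)

Definition kern (A : R) (c : nat -> nat -> R) (n : nat) (t : R) : R := kn c n t / A.
Definition kern1 (A : R) (c : nat -> nat -> R) (n : nat) (t : R) : R :=
  sum_f_R0 (fun j => c n j ^ 2 * dpow t j) n / A.
Definition kern2 (A : R) (c : nat -> nat -> R) (n : nat) (t : R) : R :=
  sum_f_R0 (fun j => c n j ^ 2 * ddpow t j) n / A.

Lemma sum_f_R0_derive : forall (f df : nat -> R -> R) (t : R) n,
  (forall j, is_derive (f j) t (df j t)) ->
  is_derive (fun u : R => sum_f_R0 (fun j => f j u) n) t (sum_f_R0 (fun j => df j t) n).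
Proof.
  intros f df t n H. induction n as [|n IH]; simpl; [apply H|].
  apply (is_derive_plus (fun u : R => sum_f_R0 (fun j => f j u) n) (f (S n))); auto.
Qed.

Lemma kern_derive : forall A c n t, is_derive (kern A c n) t (kern1 A c n t).
Proof.
  intros A c n t. unfold kern, kern1, kn.
  apply is_derive_ext with (fun u : R => / A * sum_f_R0 (fun j => c n j ^ 2 * u ^ j) n).
  { intros u. unfold Rdiv. apply Rmult_comm. }
  unfold Rdiv. rewrite Rmult_comm. apply is_derive_scal.
  apply (sum_f_R0_derive (fun j u => c n j ^ 2 * u ^ j) (fun j u => c n j ^ 2 * dpow u j)).
  intros j. unfold dpow. auto_derive; [auto|].
  match goal with |- ?a = ?b => change (@eq R a b) end. ring.
Qed.

Lemma kern1_derive : forall A c n t, is_derive (kern1 A c n) t (kern2 A c n t).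
Proof.
  intros A c n t. unfold kern1, kern2.
  apply is_derive_ext with (fun u : R => / A * sum_f_R0 (fun j => c n j ^ 2 * dpow u j) n).
  { intros u. unfold Rdiv. apply Rmult_comm. }
  unfold Rdiv. rewrite Rmult_comm. apply is_derive_scal.
  apply (sum_f_R0_derive (fun j u => c n j ^ 2 * dpow u j) (fun j u => c n j ^ 2 * ddpow u j)).
  intros j. unfold dpow, ddpow. auto_derive; [auto|].
  match goal with |- ?a = ?b => change (@eq R a b) end. ring.
Qed.

Lemma finite_series : forall (a : nat -> R) n, (forall j, (n < j)%nat -> a j = 0) ->
  is_series a (sum_f_R0 a n).
Proof.
  intros a n Ha. unfold is_series.
  apply (filterlim_ext_loc (fun _ : nat => sum_f_R0 a n)).
  - exists n. intros N HN. rewrite sum_n_Reals.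
    induction HN as [|N HN IH]; [reflexivity|].
    simpl. rewrite <- IH, (Ha (S N)) by lia. ring.
  - apply filterlim_const.
Qed.

Lemma weight_series : forall A c n (v : nat -> R), 0 < A ->
  is_series (fun j => weight A c n j * v j) (sum_f_R0 (fun j => c n j ^ 2 * v j) n / A).
Proof.
  intros A c n v HA.
  replace (sum_f_R0 (fun j => c n j ^ 2 * v j) n / A) with
    (sum_f_R0 (fun j => weight A c n j * v j) n).
  - apply finite_series. intros j Hj. unfold weight.
    destruct (Nat.leb_spec j n); [lia|ring].
  - unfold Rdiv. rewrite Rmult_comm, scal_sum. apply sum_eq. intros j Hj.
    unfold weight. destruct (Nat.leb_spec j n); [field; lra|lia].
Qed.

Lemma weight_has_moments : forall A c n t, 0 < A ->
  has_moments (weight A c n) (kern A c n) (kern1 A c n) (kern2 A c n) t.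
Proof.
  intros A c n t HA. split; [|split]; apply weight_series; exact HA.
Qed.

(** The correlator does not change when the kernel is divided by [A]. *)
Lemma rn_correlator : forall A c n, 0 < A -> rn c n = correlator (kern A c n).
Proof.
  intros A c n HA. apply functional_extensionality; intro x.
  apply functional_extensionality; intro y. unfold rn, correlator, kern.
  replace (kn c n (x ^ 2) / A * (kn c n (y ^ 2) / A)) with
    (kn c n (x ^ 2) * kn c n (y ^ 2) / (A * A)) by (field; lra).
  assert (P : 0 < A * A) by pos.
  rewrite sqrt_div_alt by lra. rewrite sqrt_square by lra.
  unfold Rdiv. rewrite Rinv_mult, Rinv_inv.
  set (u := / sqrt _). field. lra.
Qed.

Definition gramn (A : R) (c : nat -> nat -> R) (n : nat) (x y : R) : gram :=
  kernel_gram (kern A c n) (kern1 A c n) (kern2 A c n) x y.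

Lemma gramn_sign : forall A c n sg x y, sg = 1 \/ sg = - (1) ->
  let G := gramn A c n x y in let H := gramn A c n (sg * x) (sg * y) in
  detD H = detD G /\ detE1 H = detE1 G /\ detE2 H = detE2 G /\ detN H = detN G.
Proof.
  intros A c n sg x y [-> | ->].
  - rewrite !Rmult_1_l. auto.
  - replace (- (1) * x) with (- x) by ring. replace (- (1) * y) with (- y) by ring.
    apply kernel_gram_opp.
Qed.

Lemma rho2_formula_density : forall A c n sg x y, 0 < A ->
  (forall t, 0 < t -> 0 < kern A c n t) -> sg = 1 \/ sg = - (1) -> x <> 0 -> y <> 0 ->
  let G := gramn A c n x y in
  0 < detD G -> 0 < detE1 G -> 0 < detE2 G ->
  rho2_formula c n (sg * x) (sg * y) = / PI ^ 2 * density G.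
Proof.
  intros A c n sg x y HA HK Hsg Hx Hy G PD P1 P2.
  destruct (gramn_sign A c n sg x y Hsg) as (ED & E1 & E2 & EN).
  unfold rho2_formula, deltan, sigman. rewrite (rn_correlator A c n HA).
  rewrite Rmult_assoc. f_equal.
  assert (Hs0 : sg <> 0) by (destruct Hsg; lra).
  rewrite (kac_rice_gram (kern A c n) (kern1 A c n) (kern2 A c n) (sg * x) (sg * y)).
  - fold (gramn A c n (sg * x) (sg * y)). unfold density.
    rewrite ED, E1, E2, EN. reflexivity.
  - intros; apply kern_derive; auto.
  - intros; apply kern1_derive; auto.
  - exact HK.
  - apply Rmult_integral_contrapositive; auto.
  - apply Rmult_integral_contrapositive; auto.
  - unfold gramn in ED. rewrite ED. exact PD.
  - unfold gramn in E1. rewrite E1. exact P1.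
  - unfold gramn in E2. rewrite E2. exact P2.
Qed.

Lemma rho1_gramn : forall A c n sg x, 0 < A ->
  (forall t, 0 < t -> 0 < kern A c n t) -> sg = 1 \/ sg = - (1) -> x <> 0 ->
  rho1 c n (sg * x) = / PI * (sqrt (point_det1 (gramn A c n x x)) / kern A c n (x * x)).
Proof.
  intros A c n sg x HA HK Hsg Hx. unfold rho1. rewrite (rn_correlator A c n HA). f_equal.
  assert (Hs0 : sg <> 0) by (destruct Hsg; lra).
  rewrite (rho1_gram (kern A c n) (kern1 A c n) (kern2 A c n)).
  - replace (sg * x * (sg * x)) with (x * x) by (destruct Hsg as [-> | ->]; ring).
    assert (P : 0 < kern A c n (x * x)) by (apply HK; nra).
    rewrite sqrt_div_alt by (apply pow_lt; exact P). rewrite sqrt_pow2 by lra.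
    f_equal. f_equal. unfold point_det1, gramn; simpl.
    destruct Hsg as [-> | ->]; ring.
  - intros; apply kern_derive; auto.
  - intros; apply kern1_derive; auto.
  - exact HK.
  - apply Rmult_integral_contrapositive; auto.
Qed.

Lemma loglog_le_n : forall n, exp (exp 0) <= INR n -> loglog n <= INR n.
Proof.
  intros n Hn. unfold loglog. rewrite exp_0 in Hn.
  assert (L0 : forall u, 0 < u -> ln u <= u).
  { intros u Hu. pose proof (exp_ineq1_le (ln u)). rewrite exp_ln in H by lra. lra. }
  pose proof (exp_pos 1).
  assert (H1 : 1 <= ln (INR n)) by (rewrite <- (ln_exp 1) at 1; apply ln_le; lra).
  apply Rle_trans with (ln (INR n)); apply L0; lra.
Qed.

(** The constants [A] and [C] are chosen before [d], which is why [alpha0] in the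
    theorem can be independent of [d].  Positivity of the kernel comes from the
    last coefficient, whose index is in the asymptotic range. *)
Lemma eventually_close : forall (tau C1 C2 N0 : R) (o : nat -> R),
  - (1 / 2) < tau -> 0 < C1 -> 0 < C2 -> 0 < N0 -> is_lim_seq o 0 ->
  exists A C, 0 < A /\ 0 < C /\ forall d eps, 0 < d -> 0 < eps -> exists n0,
  forall c, coeff_assumption tau C1 C2 N0 o c -> forall n, (n0 <= n)%nat ->
   0 < an d n <= 1 / 8 /\ 0 < bn d n /\
   0 < taun tau C1 c n <= eps /\ taun tau C1 c n <= 1 /\
   (forall t, 0 < t -> 0 < kern A c n t) /\
   forall x y, wide d n x -> wide d n y ->
    1 / 2 <= x < 1 /\ 1 / 2 <= y < 1 /\
    close_at (2 * tau + 1) (C * taun tau C1 c n) (weight A c n) x y.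
Proof.
  intros tau C1 C2 N0 o Ht HC1 HC2 HN0 Ho.
  set (b := 2 * tau + 1). assert (Hb : 0 < b) by (unfold b; lra).
  destruct (weights_close tau C1 C2 N0 o Ht HC1 HC2 HN0 Ho)
    as (A & B & Cw & HA & HB & HCw & WC).
  destruct (moment_bound_of_errors b Hb) as (M & HM & ME).
  exists A, (M * Cw). split; [exact HA|]. split; [pos|].
  intros d eps Hd Heps.
  (* the second bound keeps [weight A c n n] above half of [binc b n] *)
  set (eps' := Rmin eps (/ (2 * Cw))).
  assert (H2C : 0 < / (2 * Cw)) by pos.
  assert (H2C1 : / (2 * Cw) <= 1) by (rewrite <- Rinv_1; apply Rinv_le_contravar; lra).
  assert (Heps' : 0 < eps') by (unfold eps'; pos).
  assert (He1 : eps' <= eps) by apply Rmin_l.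
  assert (He2 : eps' <= / (2 * Cw)) by apply Rmin_r.
  destruct (WC eps' Heps') as [n1 Hn1].
  destruct (range_eventually b B d Hb HB Hd) as [n2 Hn2].
  destruct (loglog_unbounded 0) as [n3 Hn3].
  exists (Nat.max n1 (Nat.max n2 n3)). intros c Hc n Hn.
  destruct (Hn2 n ltac:(lia)) as (HL & Han & Hbn & HR).
  destruct (Hn3 n ltac:(lia)) as [_ Hexp].
  destruct (Hn1 c Hc n ltac:(lia) HL) as (HT & W1 & W2).
  set (T := taun tau C1 c n) in *.
  assert (HiL : 0 < / loglog n) by pos.
  specialize (W2 ltac:(lra)).
  split; [exact Han|]. split; [exact Hbn|]. split; [lra|]. split; [lra|].
  split.
  - intros t Ht0. unfold kern.
    assert (E := is_series_unique _ _ (weight_series A c n (fun j => t ^ j) HA)).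
    apply Rdiv_lt_0_compat; [|exact HA]. unfold kn.
    assert (Hwn : 0 < c n n ^ 2).
    { specialize (W2 n (loglog_le_n n Hexp) (le_n n)). unfold weight in W2.
      rewrite Nat.leb_refl in W2. apply Rabs_le_between in W2.
      pose proof (binc_pos b n Hb) as Hh. fold b in W2.
      assert (Cw * T <= 1 / 2).
      { apply Rle_trans with (Cw * / (2 * Cw)); [mono|].
        right; field; lra. }
      assert (Cw * T * binc b n <= 1 / 2 * binc b n) by mono.
      assert (0 < c n n ^ 2 / A) by lra.
      replace (c n n ^ 2) with (c n n ^ 2 / A * A) by (field; lra).
      pos. }
    assert (Hlast : 0 < c n n ^ 2 * t ^ n)
      by (apply Rmult_lt_0_compat; [exact Hwn|apply pow_lt; exact Ht0]).
    assert (Hall : forall j, 0 <= c n j ^ 2 * t ^ j)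
      by (intros j; apply Rmult_le_pos; [apply pow2_ge_0|nneg]).
    destruct n as [|n]; [exact Hlast|].
    simpl sum_f_R0. simpl in Hlast. simpl in Hall.
    assert (0 <= sum_f_R0 (fun j => c (S n) j * (c (S n) j * 1) * t ^ j) n)
      by (apply cond_pos_sum; exact Hall).
    lra.
  - intros x y Hx Hy. unfold wide in Hx, Hy.
    assert (Hx1 : 1 / 2 <= x < 1) by lra. assert (Hy1 : 1 / 2 <= y < 1) by lra.
    split; [exact Hx1|]. split; [exact Hy1|].
    replace (M * Cw * T) with (M * (Cw * T)) by ring.
    assert (HT' : / loglog n <= Cw * T).
    { apply Rle_trans with (1 * T); [lra|]. mono. }
    assert (TT : forall u v, 1 - 2 * an d n <= u <= 1 - bn d n / 2 ->
       1 - 2 * an d n <= v <= 1 - bn d n / 2 ->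
       moment_bound b (M * (Cw * T)) (u * v) (fun j => weight A c n j - binc b j)).
    { intros u v Hu Hv. apply (ME B (loglog n) n (u * v) (Cw * T)); auto.
      apply HR. split.
      - assert (0 <= (1 - u) * (1 - v)) by nneg. lra.
      - assert (u * v <= u * 1) by mono. lra. }
    split; [|split]; apply TT; lra.
Qed.

(** * Off the diagonal *)

Lemma two_point_off_diagonal : forall (tau C1 C2 N0 : R) (o : nat -> R),
  - (1 / 2) < tau -> 0 < C1 -> 0 < C2 -> 0 < N0 -> is_lim_seq o 0 ->
  exists C, 0 < C /\ forall d, 0 < d -> exists n0,
  forall c, coeff_assumption tau C1 C2 N0 o c -> forall n, (n0 <= n)%nat ->
   0 < an d n <= 1 / 8 /\ 0 < bn d n /\ 0 < taun tau C1 c n <= 1 /\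
   forall sg x y, sg = 1 \/ sg = - (1) -> wide d n x -> wide d n y -> x <> y ->
    1 / 2 <= x < 1 /\ 1 / 2 <= y < 1 /\
    exists e, Rabs e <= C * taun tau C1 c n /\
     rho2_formula c n (sg * x) (sg * y) =
       (2 * tau + 1) / PI ^ 2
       * ((1 + f_formula tau (alpha x y)) / ((1 - x ^ 2) * (1 - y ^ 2))) * (1 + e).
Proof.
  intros tau C1 C2 N0 o Ht HC1 HC2 HN0 Ho.
  destruct (eventually_close tau C1 C2 N0 o Ht HC1 HC2 HN0 Ho) as (A & C & HA & HC & LN).
  destruct (density_compare tau Ht) as (C' & eta0 & HC' & Heta0 & DC).
  exists (C' * C). split; [pos|]. intros d Hd.
  destruct (LN d (eta0 / C) Hd ltac:(pos)) as [n0 Hn0].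
  exists n0. intros c Hc n Hn.
  destruct (Hn0 c Hc n Hn) as (Han & Hbn & HT & HT1 & HK & HW).
  split; [exact Han|]. split; [exact Hbn|]. split; [lra|].
  intros sg x y Hsg Hx Hy Hxy.
  destruct (HW x y Hx Hy) as (Hx1 & Hy1 & HCl).
  split; [exact Hx1|]. split; [exact Hy1|].
  assert (Heta : C * taun tau C1 c n <= eta0).
  { apply Rle_trans with (C * (eta0 / C)); [mono|].
    right. field. lra. }
  destruct (DC (weight A c n) (kern A c n) (kern1 A c n) (kern2 A c n) x y (C * taun tau C1 c n)
    Hx1 Hy1 Hxy) as (PD & P1 & P2 & e & He & EE); auto.
  - split; [nneg|exact Heta].
  - intros t _. apply weight_has_moments. exact HA.
  - exists e. split; [lra|].
    rewrite (rho2_formula_density A c n sg x y); auto; try lra.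
    unfold gramn. rewrite EE. field.
    pose proof PI_RGT_0. pose proof (prod_in_01 x x Hx1 Hx1). pose proof (prod_in_01 y y Hy1 Hy1).
    repeat split; lra.
Qed.

(** * On the diagonal *)

(** The two-point function of the limiting process vanishes on the diagonal. *)
Lemma f_tau_1 : forall tau, - (1 / 2) < tau -> f_tau tau 1 = - (1).
Proof.
  intros tau Ht. unfold f_tau. destruct (Req_EM_T 1 1) as [_|H]; [|lra].
  apply (@iota_filterlim_locally R_AbsRing R_CompleteNormedModule R (at_left 1));
    [apply Proper_StrongProper, at_left_proper_filter|].
  destruct (f_formula_near_1 tau Ht) as (C & HC & HF).
  apply filterlim_locally. intros eps.
  assert (Hq : 0 < eps / C) by (apply Rdiv_lt_0_compat; [apply cond_pos|lra]).
  assert (Hd : 0 < Rmin (1 / 2) ((eps / C) ^ 2))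
    by (apply Rmin_glb_lt; [lra|apply pow_lt; exact Hq]).
  exists (mkposreal _ Hd). intros u Hu Hu1.
  assert (Hu' : Rabs (u - 1) < Rmin (1 / 2) ((eps / C) ^ 2)) by exact Hu.
  assert (M1 := Rmin_l (1 / 2) ((eps / C) ^ 2)). assert (M2 := Rmin_r (1 / 2) ((eps / C) ^ 2)).
  apply Rabs_lt_between in Hu'.
  change (Rabs (f_formula tau u - - (1)) < eps).
  replace (f_formula tau u - - (1)) with (1 + f_formula tau u) by ring.
  eapply Rle_lt_trans; [apply HF; lra|].
  apply Rlt_le_trans with (C * (eps / C)); [|right; field; lra].
  apply Rmult_lt_compat_l; [lra|].
  rewrite <- (sqrt_pow2 (eps / C)) by lra. apply sqrt_lt_1_alt. lra.
Qed.

(** A function of two variables that is [O(|u - v|)] near the diagonal has the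
    continuous extension [0]. *)
Lemma diagonal_limit : forall (g : R -> R -> R) x C r, 0 < r -> 0 < C ->
  (forall u v, Rabs (u - x) < r -> Rabs (v - x) < r -> u <> v ->
     Rabs (g u v) <= C * Rabs (u - v)) ->
  iota (fun l : R => filterlim (fun p : R * R => g (fst p) (snd p))
      (within (fun p : R * R => fst p <> snd p) (locally (x, x))) (locally l)) = 0.
Proof.
  intros g x C r Hr HC Hg.
  apply (@iota_filterlim_locally R_AbsRing R_CompleteNormedModule (R * R)).
  - split.
    + intros H. destruct H as [dl Hdl].
      assert (Hp := cond_pos dl).
      apply (Hdl (x, x + dl / 2)).
      * split; simpl.
        -- apply ball_center.
        -- change (Rabs (x + dl / 2 - x) < dl).
           replace (x + dl / 2 - x) with (dl / 2) by ring. rewrite Rabs_right; lra.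
      * simpl. lra.
    + apply within_filter, locally_filter.
  - apply filterlim_locally. intros eps.
    assert (Hd : 0 < Rmin r (eps / (2 * C))).
    { apply Rmin_glb_lt; [lra|]. apply Rdiv_lt_0_compat; [apply cond_pos|lra]. }
    exists (mkposreal _ Hd). intros [u v] [Hu Hv] Huv. simpl in *.
    assert (Hu' : Rabs (u - x) < Rmin r (eps / (2 * C))) by exact Hu.
    assert (Hv' : Rabs (v - x) < Rmin r (eps / (2 * C))) by exact Hv.
    assert (M1 := Rmin_l r (eps / (2 * C))). assert (M2 := Rmin_r r (eps / (2 * C))).
    change (Rabs (g u v - 0) < eps). rewrite Rminus_0_r.
    eapply Rle_lt_trans; [apply Hg; auto; lra|].
    apply Rlt_le_trans with (C * (2 * (eps / (2 * C)))); [|right; field; lra].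
    apply Rmult_lt_compat_l; [lra|].
    replace (u - v) with ((u - x) + - (v - x)) by ring.
    eapply Rle_lt_trans; [apply Rabs_triang|]. rewrite Rabs_Ropp. lra.
Qed.

(** The off-diagonal formula gives [rho2 = O(sqrt (1 - alpha))] near the point,
    and [sqrt (1 - alpha (u, v)) = |u - v| / (1 - u v)]. *)
Lemma rho2_diagonal : forall tau (c : nat -> nat -> R) n d sg x C,
  - (1 / 2) < tau -> 0 <= C -> 0 < an d n <= 1 / 8 -> 0 < bn d n ->
  sg = 1 \/ sg = - (1) -> I_ d n x ->
  (forall u v, wide d n u -> wide d n v -> u <> v ->
    1 / 2 <= u < 1 /\ 1 / 2 <= v < 1 /\
    exists e, Rabs e <= C /\
     rho2_formula c n (sg * u) (sg * v) =
       (2 * tau + 1) / PI ^ 2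
       * ((1 + f_formula tau (alpha u v)) / ((1 - u ^ 2) * (1 - v ^ 2))) * (1 + e)) ->
  rho2 c n (sg * x) (sg * x) = 0.
Proof.
  intros tau c n d sg x C Ht HC Ha Hb Hsg Hx H.
  unfold rho2. destruct (Req_EM_T (sg * x) (sg * x)) as [_|K]; [|lra].
  destruct (f_formula_near_1 tau Ht) as (Cf & HCf & HF).
  unfold I_ in Hx.
  set (bb := bn d n) in *. set (aa := an d n) in *.
  set (bt := 2 * tau + 1). assert (Hbt : 0 < bt) by (unfold bt; lra).
  (* [q] bounds the distance to [1] from below on the wide interval *)
  set (q := bb / 2). assert (Hq : 0 < q) by (unfold q; lra).
  assert (HP := PI_RGT_0). assert (HP2 : 0 < PI ^ 2) by pos.
  set (CC := bt / PI ^ 2 * (Cf / q * / (q * q)) * (1 + C)).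
  assert (HCC : 0 < CC).
  { unfold CC. assert (0 < bt / PI ^ 2) by pos.
    assert (0 < Cf / q) by pos.
    assert (0 < / (q * q)) by pos.
    pos. }
  apply (diagonal_limit (rho2_formula c n) (sg * x) CC (Rmin aa (q / 4))); auto.
  { pos. }
  intros u' v' Hu' Hv' Huv'.
  assert (M1 := Rmin_l aa (q / 4)). assert (M2 := Rmin_r aa (q / 4)).
  assert (Hs2 : sg * sg = 1) by (destruct Hsg as [-> | ->]; ring).
  assert (Hsa : Rabs sg = 1).
  { destruct Hsg as [-> | ->]; [apply Rabs_R1|rewrite Rabs_Ropp; apply Rabs_R1]. }
  set (u := sg * u'). set (v := sg * v').
  assert (Eu : u' = sg * u) by (unfold u; rewrite <- Rmult_assoc, Hs2; ring).
  assert (Ev : v' = sg * v) by (unfold v; rewrite <- Rmult_assoc, Hs2; ring).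
  assert (Hu : Rabs (u - x) < Rmin aa (q / 4)).
  { rewrite Eu in Hu'. replace (sg * u - sg * x) with (sg * (u - x)) in Hu' by ring.
    rewrite Rabs_mult, Hsa, Rmult_1_l in Hu'. exact Hu'. }
  assert (Hv : Rabs (v - x) < Rmin aa (q / 4)).
  { rewrite Ev in Hv'. replace (sg * v - sg * x) with (sg * (v - x)) in Hv' by ring.
    rewrite Rabs_mult, Hsa, Rmult_1_l in Hv'. exact Hv'. }
  apply Rabs_lt_between in Hu, Hv.
  assert (Huv : u <> v) by (intros E; apply Huv'; rewrite Eu, Ev, E; reflexivity).
  assert (Wu : wide d n u) by (unfold wide; fold bb aa; unfold q in *; lra).
  assert (Wv : wide d n v) by (unfold wide; fold bb aa; unfold q in *; lra).
  destruct (H u v Wu Wv Huv) as (Hu1 & Hv1 & e & He & EE).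
  fold bt in EE. rewrite Eu, Ev, EE.
  replace (sg * u - sg * v) with (sg * (u - v)) by ring.
  rewrite Rabs_mult with (y := u - v), Hsa, Rmult_1_l.
  assert (Hqu : q <= 1 - u) by (unfold q in *; lra).
  assert (Hqv : q <= 1 - v) by (unfold q in *; lra).
  assert (Quu : 0 <= (1 - u) * u) by nneg.
  assert (Qvv : 0 <= (1 - v) * v) by nneg.
  assert (Quv : 0 <= u * (1 - v)) by nneg.
  assert (HD : Rabs (u - v) <= q / 2) by (apply Rabs_le_between; lra).
  assert (Sal : sqrt (1 - alpha u v) <= Rabs (u - v) / q).
  { rewrite one_minus_alpha by lra.
    replace ((v - u) ^ 2 / (1 - u * v) ^ 2) with (((u - v) / (1 - u * v)) ^ 2) by (field; lra).
    rewrite <- pow2_abs, sqrt_pow2 by apply Rabs_pos.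
    unfold Rdiv. rewrite Rabs_mult, (Rabs_right (/ _)) by (apply Rle_ge; nneg).
    apply Rmult_le_compat_l; [apply Rabs_pos|]. apply Rinv_le_contravar; lra. }
  assert (Hal1 := alpha_lt1 u v Hu1 Hv1 Huv).
  assert (Hal : 1 / 2 <= alpha u v).
  { assert (Rabs (u - v) / q <= 1 / 2).
    { apply Rmult_le_reg_r with q; [lra|]. unfold Rdiv at 1.
      rewrite Rmult_assoc, Rinv_l, Rmult_1_r by lra. lra. }
    assert (SS : sqrt (1 - alpha u v) * sqrt (1 - alpha u v) = 1 - alpha u v)
      by (apply sqrt_sqrt; lra).
    pose proof (sqrt_pos (1 - alpha u v)).
    assert (sqrt (1 - alpha u v) * sqrt (1 - alpha u v) <= 1 / 2 * (1 / 2))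
      by mono.
    lra. }
  rewrite Rabs_mult, Rabs_mult.
  rewrite (Rabs_right (bt / PI ^ 2)) by (apply Rle_ge; nneg).
  replace (CC * Rabs (u - v)) with
    (bt / PI ^ 2 * (Cf * (Rabs (u - v) / q) * / (q * q)) * (1 + C)) by (unfold CC; field; lra).
  assert (B1 : Rabs (1 + e) <= 1 + C).
  { eapply Rle_trans; [apply Rabs_triang|]. rewrite Rabs_R1. lra. }
  assert (B2 : Rabs ((1 + f_formula tau (alpha u v)) / ((1 - u ^ 2) * (1 - v ^ 2)))
     <= Cf * (Rabs (u - v) / q) * / (q * q)).
  { unfold Rdiv at 1. rewrite Rabs_mult.
    assert (Hpp : q * q <= (1 - u ^ 2) * (1 - v ^ 2)) by mono.
    assert (Hqq : 0 < q * q) by pos.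
    rewrite (Rabs_right (/ _)) by (apply Rle_ge; nneg).
    apply Rmult_le_compat.
    - apply Rabs_pos.
    - nneg.
    - eapply Rle_trans; [apply HF; lra|]. mono.
    - apply Rinv_le_contravar; lra. }
  assert (0 < bt / PI ^ 2) by pos.
  apply Rmult_le_compat; auto.
  - apply Rmult_le_pos; [lra|apply Rabs_pos].
  - apply Rabs_pos.
  - mono.
Qed.

(** * Both intervals together *)

Lemma sign_of_interval : forall d n (S : R -> Prop), S = I_ d n \/ S = negI_ d n ->
  exists sg, (sg = 1 \/ sg = - (1)) /\
   forall x, S x -> exists x', x = sg * x' /\ I_ d n x'.
Proof.
  intros d n S [-> | ->].
  - exists 1. split; [auto|]. intros x Hx. exists x. split; [ring|exact Hx].
  - exists (- (1)). split; [auto|]. intros x Hx. exists (- x). split; [ring|exact Hx].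
Qed.

Lemma alpha_sign : forall sg x y, sg = 1 \/ sg = - (1) -> alpha (sg * x) (sg * y) = alpha x y.
Proof.
  intros sg x y Hsg. unfold alpha. destruct Hsg as [-> | ->]; f_equal; ring.
Qed.

Lemma sq_sign : forall sg x, sg = 1 \/ sg = - (1) -> (sg * x) ^ 2 = x ^ 2.
Proof. intros sg x [-> | ->]; ring. Qed.

Lemma I_wide : forall d n x, 0 < an d n -> 0 < bn d n -> I_ d n x -> wide d n x.
Proof. intros d n x Ha Hb Hx. unfold I_ in Hx. unfold wide. lra. Qed.

Theorem lemma3p7 :
  forall (tau C1 C2 N0 : R) (o : nat -> R),
    - (1 / 2) < tau -> 0 < C1 -> 0 < C2 -> 0 < N0 ->
    is_lim_seq o 0 ->
    (forall (d : R) (Sn : nat -> R -> Prop),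
       0 < d < 1 / 2 ->
       (forall n, Sn n = I_ d n \/ Sn n = negI_ d n) ->
       exists (K : R) (n0 : nat),
       forall c : nat -> nat -> R, coeff_assumption tau C1 C2 N0 o c ->
       forall n : nat, (n0 <= n)%nat ->
       forall x y : R, Sn n x -> Sn n y ->
       exists e : R,
         Rabs e <= K * Rpower (taun tau C1 c n) (1 / 16) /\
         rho2 c n x y =
           (2 * tau + 1) / PI ^ 2
           * ((1 + f_tau tau (alpha x y)) / ((1 - x ^ 2) * (1 - y ^ 2)))
           * (1 + e))
    /\
    (exists alpha0 : R, 0 < alpha0 /\
     forall (d : R) (Sn : nat -> R -> Prop),
       0 < d < 1 / 2 ->
       (forall n, Sn n = I_ d n \/ Sn n = negI_ d n) ->
       exists (K : R) (n0 : nat),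
       forall c : nat -> nat -> R, coeff_assumption tau C1 C2 N0 o c ->
       forall n : nat, (n0 <= n)%nat ->
       forall x y : R, Sn n x -> Sn n y ->
       alpha x y <= alpha0 ->
       exists e : R,
         Rabs e <= K * Rpower (alpha x y) (2 * tau + 1) /\
         rho2 c n x y - rho1 c n x * rho1 c n y
           = e / ((1 - x ^ 2) * (1 - y ^ 2))).
Proof.
  intros tau C1 C2 N0 o Ht HC1 HC2 HN0 Ho. split.
  - intros d Sn Hd HS.
    destruct (two_point_off_diagonal tau C1 C2 N0 o Ht HC1 HC2 HN0 Ho) as (C & HC & OD).
    destruct (OD d ltac:(lra)) as [n0 Hn0].
    exists C, n0. intros c Hc n Hn x y Hx Hy.
    destruct (Hn0 c Hc n Hn) as (Han & Hbn & HT & W).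
    destruct (sign_of_interval d n (Sn n) (HS n)) as (sg & Hsg & Hin).
    destruct (Hin x Hx) as (x' & -> & Hx'). destruct (Hin y Hy) as (y' & -> & Hy').
    rewrite alpha_sign, !sq_sign by exact Hsg.
    assert (Wx := I_wide d n x' ltac:(lra) Hbn Hx').
    assert (Wy := I_wide d n y' ltac:(lra) Hbn Hy').
    (* since [taun <= 1], the linear error is the stronger one *)
    assert (HTp : taun tau C1 c n <= Rpower (taun tau C1 c n) (1 / 16)).
    { rewrite <- (Rpower_1 (taun tau C1 c n)) at 1 by lra.
      apply Rpower_antitone_exp; lra. }
    destruct (Req_dec x' y') as [Exy|Hxy].
    + subst y'. exists 0. split.
      { rewrite Rabs_R0. apply Rmult_le_pos; [lra|apply Rlt_le, Rpower_pos]. }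
      assert (Hxx : 1 / 2 <= x' < 1) by (unfold wide in Wx; lra).
      assert (Ea : alpha x' x' = 1).
      { pose proof (one_minus_alpha x' x' ltac:(nra)) as E.
        replace ((x' - x') ^ 2) with 0 in E by ring. lra. }
      rewrite Ea, f_tau_1 by exact Ht.
      rewrite (rho2_diagonal tau c n d sg x' (C * taun tau C1 c n)); auto; try lra.
      nneg.
    + destruct (W sg x' y' Hsg Wx Wy Hxy) as (Hx1 & Hy1 & e & He & EE).
      exists e. split.
      { eapply Rle_trans; [exact He|]. mono. }
      unfold rho2. destruct (Req_EM_T (sg * x') (sg * y')) as [K|_].
      { exfalso. apply Hxy. apply Rmult_eq_reg_l with sg; [exact K|destruct Hsg; lra]. }
      rewrite EE. unfold f_tau. destruct (Req_EM_T (alpha x' y') 1) as [K|_]; [|reflexivity].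
      pose proof (alpha_lt1 x' y' Hx1 Hy1 Hxy). lra.
  - destruct (eventually_close tau C1 C2 N0 o Ht HC1 HC2 HN0 Ho) as (A & C & HA & HC & LN).
    destruct (density_decorrelate tau Ht) as (C' & eta0 & al0 & HC' & Heta0 & Hal0 & DD).
    exists al0. split; [lra|]. intros d Sn Hd HS.
    destruct (LN d (eta0 / C) ltac:(lra) ltac:(pos)) as [n0 Hn0].
    exists (/ PI ^ 2 * C'), n0. intros c Hc n Hn x y Hx Hy.
    destruct (Hn0 c Hc n Hn) as (Han & Hbn & HT & HT1 & HK & W).
    destruct (sign_of_interval d n (Sn n) (HS n)) as (sg & Hsg & Hin).
    destruct (Hin x Hx) as (x' & -> & Hx'). destruct (Hin y Hy) as (y' & -> & Hy').
    rewrite alpha_sign, !sq_sign by exact Hsg. intros Hal.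
    assert (Wx := I_wide d n x' ltac:(lra) Hbn Hx').
    assert (Wy := I_wide d n y' ltac:(lra) Hbn Hy').
    destruct (W x' y' Wx Wy) as (Hx1 & Hy1 & HCl).
    assert (Hxy : x' <> y').
    { intros ->. pose proof (one_minus_alpha y' y' ltac:(nra)) as E.
      replace ((y' - y') ^ 2) with 0 in E by ring. lra. }
    assert (Heta : C * taun tau C1 c n <= eta0).
    { apply Rle_trans with (C * (eta0 / C)); [mono|].
      right. field. lra. }
    destruct (DD (weight A c n) (kern A c n) (kern1 A c n) (kern2 A c n) x' y' (C * taun tau C1 c n)
      Hx1 Hy1) as (PD & P1 & P2 & G1 & G2 & V1 & V2 & e & He & EE); auto.
    { split; [nneg|exact Heta]. }
    { intros t _. apply weight_has_moments. exact HA. }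
    fold (gramn A c n x' y') in *.
    assert (HP := PI_RGT_0). assert (HP2 : 0 < / PI ^ 2) by pos.
    exists (/ PI ^ 2 * e). split.
    { rewrite Rabs_mult, Rabs_right by lra. rewrite Rmult_assoc.
      mono. }
    unfold rho2. destruct (Req_EM_T (sg * x') (sg * y')) as [K|_].
    { exfalso. apply Hxy. apply Rmult_eq_reg_l with sg; [exact K|destruct Hsg; lra]. }
    rewrite (rho2_formula_density A c n sg x' y') by (auto; lra).
    rewrite (rho1_gramn A c n sg x'), (rho1_gramn A c n sg y') by (auto; lra).
    replace (/ PI ^ 2 * e / ((1 - x' ^ 2) * (1 - y' ^ 2)))
      with (/ PI ^ 2 * (e / ((1 - x' ^ 2) * (1 - y' ^ 2)))) by (unfold Rdiv; ring).
    rewrite <- EE.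
    change (point_det1 (gramn A c n y' y')) with (point_det2 (gramn A c n x' y')).
    change (point_det1 (gramn A c n x' x')) with (point_det1 (gramn A c n x' y')).
    change (kern A c n (x' * x')) with (g11 (gramn A c n x' y')).
    change (kern A c n (y' * y')) with (g22 (gramn A c n x' y')).
    rewrite sqrt_mult_alt by lra. field. repeat split; lra.
Qed.
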